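(* Let $k\ge2$ be an integer and let $\tilde L_n^{k,k}(e^x)=1+\sum_{d\ge1}\tilde L_n^{k,k,d}e^{dx}$ be the generating function of the virtual structure constants with $N=k$. Then $$\tilde L_0^{k,k}(e^x)=w_0^{k,k}(x)=\sum_{d=0}^\infty\frac{(kd)!}{(d!)^k}e^{dx},$$ $$\tilde L_1^{k,k}(e^x)=\partial_x\Bigl(x+\frac{w_1^{k,k}(x)}{w_0^{k,k}(x)}\Bigr)=\partial_x\left(x+\frac{\sum_{d=1}^\infty\frac{(kd)!}{(d!)^k}\Bigl(\sum_{i=1}^d\sum_{m=1}^{k-1}\frac{m}{i(ki-m)}\Bigr)e^{dx}}{\sum_{d=0}^\infty\frac{(kd)!}{(d!)^k}e^{dx}}\right),$$ where $w_0^{k,k},w_1^{k,k}$ and $\tilde L_n^{k,k,d}$ are as defined in the context.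
   Context: **The functions $w_j^{k,k}$.** $$w_j^{k,k}(x):=(\partial_z)^j\left.\sum_{d=0}^\infty e^{dx}\frac{(kd)!}{(d!)^k}\prod_{j'=1}^{kd}\Bigl(1+\frac{k}{j'}z\Bigr)\prod_{j'=1}^{d}\Bigl(1+\frac1{j'}z\Bigr)^{-k}\right|_{z=0}$$ (a power series in $e^x$). **Virtual structure constants.** Fix $k$. The rational numbers $\tilde L_n^{N,k,d}$ ($N,n\in{\bf Z}$, $d\ge1$) are defined by descending recursion on $N$. For $N\ge2k$: $\tilde L_n^{N,k,1}$ is given by $\sum_{n=0}^{k-1}\tilde L_n^{N,k,1}w^n=k\prod_{j=1}^{k-1}(jw+(k-j))$ (and $\tilde L_n^{N,k,1}=0$ for $n\notin\{0,\dots,k-1\}$), and $\tilde L_n^{N,k,d}=0$ for $d\ge2$. For $N<2k$: $\tilde L_n^{N,k,d}=\phi_n^{N,k}(Poly_d)$, where $\phi_n^{N,k}$ is the ${\bf Q}$-linear map on homogeneous polynomials of degree $d-1$ in $x,y,z_1,\dots,z_{d-1}$ with $$\phi_n^{N,k}\bigl(x^{d_{i_0}}z_{i_1}^{d_{i_1}}\cdots z_{i_{l-1}}^{d_{i_{l-1}}}y^{d_{i_l}}\bigr)=\prod_{j=1}^l\tilde L_{n+\delta_j}^{N+1,k,i_j-i_{j-1}} .$$ Here each monomial is written uniquely with $0=i_0<i_1<\cdots<i_l=d$, $d_{i_j}\ge1$ for $1\le j\le l-1$, $d_{i_0},d_{i_l}\ge0$, $\sum_{j=0}^ld_{i_j}=d-1$,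 and $\delta=(\delta_1,\dots,\delta_l)=\alpha+\beta+\gamma+\sum_{j=1}^{l-1}(d_{i_j}-1)\epsilon_j+d_{i_l}\epsilon_l\in{\bf Z}^l$ with $\alpha=(l-d,\dots,l-d)$, $\beta=(0,i_1-1,i_2-2,\dots,i_{l-1}-l+1)$, $\gamma=(0,i_1(N-k),\dots,i_{l-1}(N-k))$, $\epsilon_j=(1,\dots,1,0,\dots,0)$ ($j$ ones). The number $\tilde L_n^{N,k,d}$ vanishes unless $0\le n\le N-1-(N-k)d$. **The polynomial $Poly_d$.** With $u_0=x$, $u_d=y$, $$Poly_d(x,y,z_1,\dots,z_{d-1})=\frac{d}{(2\pi\sqrt{-1})^{d-1}}\int_{D_1}du_1\cdots\int_{D_{d-1}}du_{d-1}\prod_{j=1}^{d-1}\frac{u_j^2}{(2u_j-u_{j-1}-u_{j+1})(u_j-z_j)},$$ where $D_j$ goes around both poles $u_j=\frac{u_{j-1}+u_{j+1}}2$ and $u_j=z_j$. Concretely, take counterclockwise circles $|u_j|=R_j$ with $R_j>|z_j|$ and $2R_j>R_{j-1}+R_{j+1}$, where $R_0=|x|$, $R_d=|y|$. It is a homogeneous polynomial of degree $d-1$, and $Poly_1=1$. $\tilde L_n^{k,k}(e^x):=1+\sum_{d\ge1}\tilde L_n^{k,k,d}e^{dx}$ for $n=0,1,\dots,k-1$. *)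

(* Defs.v *)
(* MathComp / MathComp-Analysis.  The notations of mpoly conflict with those of
   MathComp-Analysis: {mpoly T[n]} is written mpoly n T, 'X_{1..n} is written
   multinom n, and P@_m is written mcoeff m P. *)
From HB Require Import structures.
From mathcomp Require Import all_boot all_order all_algebra.
From mathcomp Require Import complex.
From mathcomp Require Import all_classical all_reals all_analysis.
From mathcomp Require Import -(notations) mpoly.
Set Implicit Arguments.
Unset Strict Implicit.
Unset Printing Implicit Defensive.
Import Order.TTheory GRing.Theory Num.Theory.
Import numFieldNormedType.Exports.
Local Open Scope ring_scope.
Local Open Scope classical_set_scope.

Section ContourIntegral.
Variable R : realType.

Definition Cintegral (A : set R) (f : R -> R[i]) : R[i] :=
  Complex (\int[lebesgue_measure]_(t in A) complex.Re (f t))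
          (\int[lebesgue_measure]_(t in A) complex.Im (f t)).

Definition circle_point (r t : R) : R[i] := Complex (r * cos t) (r * sin t).

(* The integral of f(u) du over the counterclockwise circle |u| = r, where
   u = r exp(i t) and du = i u dt. *)
Definition circle_integral (r : R) (f : R[i] -> R[i]) : R[i] :=
  Cintegral `[0, 2 * pi]
    (fun t => f (circle_point r t) * ('i%C * circle_point r t)).

(* For rs = [:: R_1; ...; R_n], the iterated integral
   \int_{|u_1| = R_1} du_1 ... \int_{|u_n| = R_n} du_n f [:: u_1; ...; u_n]. *)
Fixpoint iter_circle_integral (rs : seq R) (f : seq R[i] -> R[i]) : R[i] :=
  if rs is r :: rs' then
    circle_integral r (fun u =>
      iter_circle_integral rs' (fun us => f (u :: us)))
  else f [::].

(* In the definitions below the d+1 variables x, z_1, ..., z_{d-1}, y are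
   z 0, z 1, ..., z (d-1), z d. *)

Definition Poly_integrand (d : nat) (z : nat -> R[i]) (us : seq R[i]) : R[i] :=
  let u := nth 0 (z 0 :: rcons us (z d)) in
  \prod_(1 <= j < d)
    (u j ^+ 2 / ((2 * u j - u j.-1 - u j.+1) * (u j - z j))).

Definition admissible_radii (d : nat) (z : nat -> R[i]) (r : nat -> R) : Prop :=
  [/\ (r 0)%:C%C = `|z 0|, (r d)%:C%C = `|z d| &
      forall j, (0 < j < d)%N ->
        `|z j| < (r j)%:C%C /\ r j.-1 + r j.+1 < 2 * r j].

Definition Poly_value (d : nat) (z : nat -> R[i]) (r : nat -> R) : R[i] :=
  d%:R / (2 * pi%:C%C * 'i%C) ^+ d.-1 *
  iter_circle_integral [seq r j | j <- iota 1 d.-1] (Poly_integrand d z).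

Definition is_Poly (d : nat) (P : mpoly d.+1 rat) : Prop :=
  forall z r, admissible_radii d z r ->
    mmap (ratr : rat -> R[i]) (fun i : 'I_d.+1 => z i) P
    = Poly_value d z r.

(* The polynomial represented by the contour integral; at most one polynomial
   satisfies is_Poly, since admissible radii exist for all z.  Defined for
   d >= 1 only (the value at d = 0 is irrelevant). *)
Definition Poly (d : nat) : mpoly d.+1 rat := xget 0 (@is_Poly d).

End ContourIntegral.

Section VirtualStructureConstants.
Variable k : nat.

(* [:: i_0; i_1; ...; i_l] for the monomial m: i_0 = 0, i_l = d, and the
   interior entries are the i with positive exponent of z_i. *)
Definition breakpoints (d : nat) (m : multinom d.+1) : seq nat :=
  0%N :: rcons [seq i <- iota 1 d.-1 | (0 < m (inord i))%N] d.

(* The j-th component (1 <= j <= l) of alpha + beta + gamma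
   + \sum_{p=1}^{l-1} (d_{i_p} - 1) epsilon_p + d_{i_l} epsilon_l; the j-th
   component of epsilon_p is 1 if j <= p and 0 otherwise. *)
Definition delta (N : int) (d : nat) (m : multinom d.+1) (j : nat) : int :=
  let i := nth 0%N (breakpoints m) in
  let l := (size (breakpoints m)).-1 in
  (l%:Z - d%:Z)
  + ((i j.-1)%:Z - j.-1%:Z)
  + (i j.-1)%:Z * (N - k%:Z)
  + \sum_(j <= p < l) ((m (inord (i p)))%:Z - 1)
  + (m (inord (i l)))%:Z.

(* phi_n^{N,k}, where L n d stands for \tilde L_n^{N+1,k,d}. *)
Definition phi_monomial (L : int -> nat -> rat) (N n : int) (d : nat)
    (m : multinom d.+1) : rat :=
  let i := nth 0%N (breakpoints m) in
  let l := (size (breakpoints m)).-1 in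
  \prod_(1 <= j < l.+1) L (n + delta N m j) (i j - i j.-1)%N.

Definition phi (L : int -> nat -> rat) (N n : int) (d : nat)
    (P : mpoly d.+1 rat) : rat :=
  \sum_(m <- msupp P) mcoeff m P * phi_monomial L N n m.

Definition vsc_base (n : int) (d : nat) : rat :=
  match n, d with
  | Posz n', 1%N =>
      (k%:R *: \prod_(1 <= j < k) (j%:R *: 'X + (k - j)%:R%:P))`_n'
  | _, _ => 0
  end.

(* The value for N = 2k - m; see vsc_ge and vsc_lt. *)
Fixpoint vsc_rec (R : realType) (m : nat) (n : int) (d : nat) : rat :=
  if m is m'.+1 then
    phi (vsc_rec R m') ((2 * k)%:Z - m%:Z) n (Poly R d)
  else vsc_base n d.

(* \tilde L_n^{N,k,d} for d >= 1. *)
Definition vsc (R : realType) (N n : int) (d : nat) : rat :=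
  if ((2 * k)%:Z - N)%R is Posz m then vsc_rec R m n d else vsc_base n d.

Lemma vsc_ge (R : realType) (N n : int) (d : nat) :
  (2 * k)%:Z <= N -> vsc R N n d = vsc_base n d.
Proof.
rewrite -subr_le0 /vsc; case: (_ - N) => [m|m] //.
by rewrite lez_nat leqn0 => /eqP ->.
Qed.

Lemma vsc_lt (R : realType) (N n : int) (d : nat) :
  N < (2 * k)%:Z -> vsc R N n d = phi (vsc R (N + 1)) N n (Poly R d).
Proof.
rewrite -subr_gt0 => hN; rewrite /vsc.
have -> : (2 * k)%:Z - (N + 1) = (2 * k)%:Z - N - 1 by rewrite opprD addrA.
have {3}-> : N = (2 * k)%:Z - ((2 * k)%:Z - N) by rewrite opprB addrC subrK.
case: ((2 * k)%:Z - N) hN => // -[//|m] _.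
by have -> : m.+1%:Z - 1 = m by rewrite -addn1 PoszD addrK.
Qed.

End VirtualStructureConstants.

(* A formal power series in q = e^x is its sequence of coefficients. *)
Definition fps (R : realType) := nat -> R.

Section FormalSeries.
Variable R : realType.
Implicit Types (a b f : fps R).

Definition fps1 : fps R := fun n => (n == 0)%:R.

Definition fps_mul a b : fps R := fun n => \sum_(i < n.+1) a i * b (n - i)%N.

Fixpoint fps_inv_seq a (n : nat) : seq R :=
  if n is n'.+1 then
    let s := fps_inv_seq a n' in
    rcons s (- (a 0)^-1 * \sum_(i < n'.+1) s`_i * a (n'.+1 - i)%N)
  else [:: (a 0)^-1].

Definition fps_inv a : fps R := fun n => (fps_inv_seq a n)`_n.

Definition fps_div a b : fps R := fps_mul a (fps_inv b).

Lemma size_fps_inv_seq a n : size (fps_inv_seq a n) = n.+1.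
Proof. by elim: n => //= n IH; rewrite size_rcons IH. Qed.

Lemma nth_fps_inv_seq a n i : (i <= n)%N -> (fps_inv_seq a n)`_i = fps_inv a i.
Proof.
elim: n => [|n IH]; first by rewrite leqn0 => /eqP ->.
rewrite leq_eqVlt => /predU1P[-> //|lin] /=.
by rewrite nth_rcons size_fps_inv_seq lin IH.
Qed.

Lemma fps_mulV a : a 0%N != 0 -> fps_mul (fps_inv a) a = fps1.
Proof.
move=> a0; apply/funext => -[|n]; rewrite /fps_mul /fps1.
  by rewrite big_ord1 subnn mulVf.
rewrite big_ord_recr /= subnn {2}/fps_inv /= nth_rcons size_fps_inv_seq.
rewrite ltnn eqxx mulNr mulNr mulrAC mulVf // mul1r.
apply/eqP; rewrite subr_eq0; apply/eqP; apply: eq_bigr => i _.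
by rewrite nth_fps_inv_seq // -ltnS ltn_ord.
Qed.

(* LogSeries c f is the expression c x + f(e^x). *)
Record logseries := LogSeries { coef_x : R; series_part : fps R }.

(* The derivative in x of c x + \sum_d f_d e^(d x). *)
Definition dx (g : logseries) : fps R :=
  fun d => coef_x g *+ (d == 0) + d%:R * series_part g d.

(* w_j^{k,k}; the derivative (d/dz)^j at z = 0 is taken coefficientwise. *)
Definition w (k j : nat) : fps R := fun d =>
  derive1n j (fun z : R =>
    (k * d)`!%:R / d`!%:R ^+ k
    * \prod_(1 <= i < (k * d).+1) (1 + k%:R / i%:R * z)
    * \prod_(1 <= i < d.+1) (1 + 1 / i%:R * z) ^- k) 0.

Definition L_series (k : nat) (n : int) : fps R := fun d =>
  if d is 0 then 1 else ratr (vsc k R k%:Z n d).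

Definition hypergeometric (k : nat) : fps R := fun d =>
  (k * d)`!%:R / d`!%:R ^+ k.

Definition hypergeometric_log (k : nat) : fps R := fun d =>
  if d is 0 then 0 else
  (k * d)`!%:R / d`!%:R ^+ k
  * \sum_(1 <= i < d.+1) \sum_(1 <= m < k)
      m%:R / (i%:R * (k%:R * i%:R - m%:R)).

End FormalSeries.

(* Main.v *)
(* A function on a torus which is a uniform limit of Laurent polynomials has a
   constant term [ct], and the contour integral defining [Poly d] is the constant
   term of a product of geometric series.  By descending induction on N,
     \tilde L_n^{N,k,d} = d * ct (u_0^(-n) * u_d^(n-(N-1-(N-k)d))
        * \prod_(0<j<d) u_j^(2-N) / (2u_j-u_(j-1)-u_(j+1))
        * \prod_(0<j<=d) edge (u_(j-1)) (u_j)),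
   where edge x y = k * \prod_(0<m<k) (m x + (k-m) y): passing from N+1 to N,
   terms of positive weight for a suitable grading have no constant term.
     For N = k the edge factors only depend on the ratios u_i / u_(i+1).  Up to
   terms without constant term, u_i / u_(i+1) may be replaced by
   i/(i+1) + (u_0/u_(i+1))/(i+1).  For n = 0 only i/(i+1) contributes, which gives
   \prod_(i<d) edge (i/(i+1)) 1 = (kd)!/(d!)^k.  For n = 1, multiplying the
   integrand by 2u_s-u_(s-1)-u_(s+1) cancels the pole at u_s, so that the constant
   term splits as (\tilde L_1^{k,k,s}/s) * (\tilde L_0^{k,k,d-s}/(d-s)).  Since
   \sum_(0<s<d) (d-s)(2u_s-u_(s-1)-u_(s+1)) = d u_1 - (d-1) u_0 - u_d, the sum of
   (\tilde L_1^{k,k,s}/s) * \tilde L_0^{k,k,d-s} over s <= d is the constant term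
   for d u_1 - (d-1) u_0, a first-order expansion at the points i/(i+1); it equals
   the coefficient of e^(dx) in w_1. *)
Require Import Defs.
From mathcomp Require Import all_boot all_order all_algebra.
From mathcomp Require Import complex.
From mathcomp Require Import all_classical all_reals all_analysis.
From mathcomp Require Import -(notations) mpoly.
From mathcomp Require Import measurable_realfun.
From mathcomp Require Import ring lra zify.
Set Implicit Arguments.
Unset Strict Implicit.
Unset Printing Implicit Defensive.
Import Order.TTheory GRing.Theory Num.Theory.
Import numFieldNormedType.Exports.
Local Open Scope ring_scope.
Local Open Scope classical_set_scope.

(** [Poly] is never computed. Parametrising the circles produces the factor [\prod u_j], which is
    written as a rational combination of the products [theta e]: second differences at the indices
    with [e j > 0], times powers of variables. Each [theta e] is evaluated twice. Inside the contour
    integral it cancels the poles at those indices and yields one monomial [z^e], divided by the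
    product of the distances between consecutive breakpoints. Inside the closed form for [N] it cuts
    the chain at the same breakpoints into chains for [N + 1], whose normalising factors [d]
    multiply to the same product. The two evaluations match term by term, whatever the combination.
    Vanishing has one source: [u_j / fd j u] is half a geometric series in
    [(u_(j-1) + u_(j+1)) / (2 u_j)], so it has nonnegative weight as soon as [w_j] is at most both
    neighbouring weights; the work lies in choosing such weights. Uniform Laurent approximation
    stands in for Fubini and termwise integration, because a mean merely selects monomials of the
    approximants. *)

Section UniformLimits.
Variable R : realType.
Implicit Types (h g : R -> R) (a b : R).

(** Approximation is demanded only on [A], by functions continuous everywhere: the class is then
    closed under uniform limits, and its members are integrable on segments without any continuity
    of their own. *)
Definition unif_lim_cont (A : set R) h :=
  forall e : R, 0 < e ->
    exists2 g, continuous g & forall t, A t -> `|h t - g t| <= e.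

Lemma unif_lim_cont_integrable a b h : unif_lim_cont `[a, b] h ->
  (@lebesgue_measure R).-integrable `[a, b] (EFin \o h).
Proof.
move=> hh; have mA : measurable (`[a, b] : set R) by exact: measurable_itv.
have intc g : continuous g ->
    (@lebesgue_measure R).-integrable `[a, b] (EFin \o g).
  move=> cg; apply: continuous_compact_integrable; first exact: segment_compact.
  exact: continuous_subspaceT.
have ng n : 0 < n.+1%:R^-1 :> R by rewrite invr_gt0 ltr0n.
have /choice[gs gsP] : forall n, exists g,
    continuous g /\ forall t, `[a, b] t -> `|h t - g t| <= n.+1%:R^-1.
  by move=> n; have [g ? ?] := hh _ (ng n); exists g.
(* Measurability passes to the limit of the approximants of precision [1/(n+1)]; domination will
   come from a single approximant of precision 1. *)
have mh : measurable_fun `[a, b] h.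
  apply: (@measurable_fun_cvg _ _ _ _ gs) => [n|t tA].
    apply: measurable_funTS; apply: continuous_measurable_fun.
    by have [] := gsP n.
  apply/cvgrPdist_le => e e0; near=> n.
  have [_ /(_ t tA) /le_trans->//] := gsP n.
  apply: ltW; near: n; exact: near_infty_natSinv_lt (PosNum e0).
have [g cg hg] := hh 1 ltr01.
apply: (@le_integrable _ _ _ lebesgue_measure _ mA (EFin \o h)
         (EFin \o (fun t => `|g t| + 1))).
- exact/measurable_EFinP.
- move=> t tA /=; rewrite lee_fin [leRHS]ger0_norm ?addr_ge0//.
  by rewrite -[h t](subrK (g t)) (le_trans (ler_normD _ _))// addrC lerD ?hg.
- apply: intc => t; apply: cvgD; last exact: cvg_cst.
  by apply: cvg_norm; exact: cg.
Unshelve. all: by end_near. Qed.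

Lemma le_Rintegral_const a b h e : a <= b -> unif_lim_cont `[a, b] h ->
  (forall t, `[a, b] t -> `|h t| <= e) ->
  `|\int[lebesgue_measure]_(t in `[a, b]) h t| <= e * (b - a).
Proof.
move=> ab hh he; have ih := unif_lim_cont_integrable hh.
have := le_normr_Rintegral _ ih; move=> /(_ (measurable_itv _)) /le_trans; apply.
apply: (@le_trans _ _ (\int[lebesgue_measure]_(t in `[a, b]) e)).
  apply: le_Rintegral => //.
  - by have /integrable_abse := ih.
  - have : unif_lim_cont `[a, b] (cst e).
      move=> d d0; exists (cst e); first by move=> ?; exact: cvg_cst.
      by move=> t _; rewrite subrr normr0 ltW.
    exact: unif_lim_cont_integrable.
rewrite Rintegral_cst//= [X in e * fine X]lebesgue_measure_itv /=.
by rewrite lte_fin; case: ltgtP ab => //= ->; rewrite subrr !mulr0.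
Qed.

End UniformLimits.

(** * Complex integrals over one period *)

Section ComplexIntegral.
Variable R : realType.
Local Notation C := R[i].
Local Notation A := (`[0, 2 * pi] : set R).
Implicit Types (h g : R -> R) (F G : R -> C).

Lemma unif_lim_cont_cst c : unif_lim_cont A (cst c : R -> R).
Proof.
move=> e e0; exists (cst c); first by move=> ?; exact: cvg_cst.
by move=> t _; rewrite subrr normr0 ltW.
Qed.

Lemma continuous_unif_lim h : continuous h -> unif_lim_cont A h.
Proof. by move=> ch e e0; exists h => // t _; rewrite subrr normr0 ltW. Qed.

Lemma unif_lim_contD h g :
  unif_lim_cont A h -> unif_lim_cont A g -> unif_lim_cont A (fun t => h t + g t).
Proof.
move=> hh hg e e0; have e2 : 0 < e / 2 by rewrite divr_gt0.
have [h' ch' hh'] := hh _ e2; have [g' cg' hg'] := hg _ e2.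
exists (fun t => h' t + g' t); first by move=> t; apply: cvgD; [exact: ch'|exact: cg'].
move=> t tA; rewrite opprD addrACA (le_trans (ler_normD _ _))//.
by rewrite [e]splitr lerD ?hh' ?hg'.
Qed.

Lemma unif_lim_contZ c h :
  unif_lim_cont A h -> unif_lim_cont A (fun t => c * h t).
Proof.
move=> hh e e0; have e2 : 0 < e / (`|c| + 1) by rewrite divr_gt0// ltr_wpDl.
have [h' ch' hh'] := hh _ e2.
exists (fun t => c * h' t); first by move=> t; apply: cvgMr; exact: ch'.
move=> t tA; rewrite -mulrBr normrM.
apply: (@le_trans _ _ (`|c| * (e / (`|c| + 1)))); first by rewrite ler_wpM2l ?hh'.
by rewrite mulrCA ler_piMr ?(ltW e0)// ler_pdivrMr ?ltr_wpDl// mul1r lerDl.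
Qed.

Lemma unif_lim_cont_limit h :
  (forall e : R, 0 < e -> exists2 g, unif_lim_cont A g &
     forall t, A t -> `|h t - g t| <= e) -> unif_lim_cont A h.
Proof.
move=> hh e e0; have e2 : 0 < e / 2 by rewrite divr_gt0.
have [g ug hg] := hh _ e2; have [g' cg' hg'] := ug _ e2.
exists g' => // t tA; rewrite -[h t](subrK (g t)) -addrA [e]splitr.
by rewrite (le_trans (ler_normD _ _))// lerD ?hg ?hg'.
Qed.

Definition cunif F := unif_lim_cont A (fun t => complex.Re (F t)) /\
                      unif_lim_cont A (fun t => complex.Im (F t)).

Lemma cunifD F G : cunif F -> cunif G -> cunif (fun t => F t + G t).
Proof.
move=> [rF iF] [rG iG]; split.
- have -> : (fun t => complex.Re (F t + G t)) =
      (fun t => complex.Re (F t) + complex.Re (G t)).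
    by apply/funext => t; case: (F t) (G t) => [? ?] [].
  exact: unif_lim_contD.
- have -> : (fun t => complex.Im (F t + G t)) =
      (fun t => complex.Im (F t) + complex.Im (G t)).
    by apply/funext => t; case: (F t) (G t) => [? ?] [].
  exact: unif_lim_contD.
Qed.

Lemma cunifZ (c : C) F : cunif F -> cunif (fun t => c * F t).
Proof.
move=> [rF iF]; case: c => a b; split.
- have -> : (fun t => complex.Re (Complex a b * F t)) =
      (fun t => a * complex.Re (F t) + (- b) * complex.Im (F t)).
    by apply/funext => t; case: (F t) => x y /=; rewrite mulNr.
  by apply: unif_lim_contD; exact: unif_lim_contZ.
- have -> : (fun t => complex.Im (Complex a b * F t)) =
      (fun t => a * complex.Im (F t) + b * complex.Re (F t)).
    by apply/funext => t; case: (F t) => x y /=.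
  by apply: unif_lim_contD; exact: unif_lim_contZ.
Qed.

Lemma cunif_cst (c : C) : cunif (fun=> c).
Proof. by split; exact: unif_lim_cont_cst. Qed.

Lemma normc_ge_Im (x : C) : `|complex.Im x|%:C%C <= `|x|.
Proof.
have -> : complex.Im x = - complex.Re (x * 'i%C) by rewrite ReiNIm opprK.
by rewrite normrN (le_trans (normc_ge_Re _))// normrM -[leRHS]mulr1
  complexiE normCi.
Qed.

Lemma normc_le_ReIm (x : C) :
  `|x| <= (`|complex.Re x| + `|complex.Im x|)%:C%C.
Proof.
rewrite {1}(complexE x) (le_trans (ler_normD _ _))// normrM complexiE normCi.
have nR (y : R) : `|y%:C%C| = `|y|%:C%C by rewrite normc_def /= expr0n addr0 sqrtr_sqr.
by rewrite mul1r !nR rmorphD.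
Qed.

Lemma cunif_limit F : (forall e : R, 0 < e -> exists2 G, cunif G &
   forall t, A t -> `|F t - G t| <= e%:C%C) -> cunif F.
Proof.
move=> hF; split; apply: unif_lim_cont_limit => e /hF[G [rG iG] FG].
- exists (fun t => complex.Re (G t)) => // t /FG.
  move=> /(le_trans (normc_ge_Re _)); rewrite lecR.
  by case: (F t) (G t) => [? ?] [].
- exists (fun t => complex.Im (G t)) => // t /FG.
  move=> /(le_trans (normc_ge_Im _)); rewrite lecR.
  by case: (F t) (G t) => [? ?] [].
Qed.

Lemma eq_Cintegral F G : (forall t, A t -> F t = G t) ->
  Cintegral A F = Cintegral A G.
Proof.
move=> FG; rewrite /Cintegral; congr Complex; apply: eq_Rintegral => t;
  by rewrite inE => tA; rewrite FG.
Qed.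

Lemma CintegralD F G : cunif F -> cunif G ->
  Cintegral A (fun t => F t + G t) = Cintegral A F + Cintegral A G.
Proof.
move=> [rF iF] [rG iG]; rewrite /Cintegral /=.
have e1 t : complex.Re (F t + G t) = complex.Re (F t) + complex.Re (G t).
  by case: (F t) (G t) => [? ?] [].
have e2 t : complex.Im (F t + G t) = complex.Im (F t) + complex.Im (G t).
  by case: (F t) (G t) => [? ?] [].
under eq_Rintegral do rewrite e1.
under [X in Complex _ X]eq_Rintegral do rewrite e2.
by rewrite !RintegralD //=; try exact: unif_lim_cont_integrable.
Qed.

Lemma CintegralZ (c : C) F : cunif F ->
  Cintegral A (fun t => c * F t) = c * Cintegral A F.
Proof.
move=> [rF iF]; rewrite /Cintegral; case: c => a b.
have e1 t : complex.Re (Complex a b * F t) =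
  a * complex.Re (F t) + (- b) * complex.Im (F t).
  by case: (F t) => x y /=; rewrite mulNr.
have e2 t : complex.Im (Complex a b * F t) =
  a * complex.Im (F t) + b * complex.Re (F t).
  by case: (F t) => x y /=.
under eq_Rintegral do rewrite e1.
under [X in Complex _ X]eq_Rintegral do rewrite e2.
have i1 := unif_lim_cont_integrable rF.
have i2 := unif_lim_cont_integrable iF.
have j c := unif_lim_cont_integrable (unif_lim_contZ c rF).
have k c := unif_lim_cont_integrable (unif_lim_contZ c iF).
rewrite !RintegralD //= !RintegralZl //=.
by rewrite mulNr.
Qed.

(** The extra factor 2 is the price of bounding real and imaginary parts separately; it is harmless
    because all errors are later sent to 0. *)
Lemma Cintegral_le F (e : R) : cunif F ->
  (forall t, A t -> `|F t| <= e%:C%C) ->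
  `|Cintegral A F| <= (2 * (2 * pi * e))%:C%C.
Proof.
move=> [rF iF] hF; rewrite (le_trans (normc_le_ReIm _))// lecR /=.
have p0 : 0 <= 2 * pi :> R by rewrite mulr_ge0 ?pi_ge0.
rewrite [leRHS]mulr_natl [leRHS]mulr2n lerD//.
- rewrite (le_trans (le_Rintegral_const (e := e) p0 rF _))//; last first.
    by rewrite subr0 mulrC.
  by move=> t /hF /(le_trans (normc_ge_Re _)); rewrite lecR.
- rewrite (le_trans (le_Rintegral_const (e := e) p0 iF _))//; last first.
    by rewrite subr0 mulrC.
  by move=> t /hF /(le_trans (normc_ge_Im _)); rewrite lecR.
Qed.

Definition cis (t : R) : C := Complex (cos t) (sin t).

Lemma cisD s t : cis (s + t) = cis s * cis t.
Proof. by rewrite /cis cosD sinD; simpc; congr Complex; rewrite addrC mulrC [X in _ + X]mulrC. Qed.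

Lemma cis0 : cis 0 = 1.
Proof. by rewrite /cis cos0 sin0. Qed.

Lemma cis_neq0 t : cis t != 0.
Proof.
apply/eqP => h; have := cisD t (- t); rewrite subrr cis0 h mul0r => /eqP.
by rewrite oner_eq0.
Qed.

Lemma cisN t : cis (- t) = (cis t)^-1.
Proof.
apply: (mulfI (cis_neq0 t)); rewrite -cisD subrr cis0 mulfV//.
exact: cis_neq0.
Qed.

Lemma cisX t (m : int) : cis t ^ m = cis (m%:~R * t).
Proof.
have cisXn (n : nat) : cis t ^+ n = cis (n%:R * t).
  elim: n => [|n IH]; first by rewrite expr0 mul0r cis0.
  by rewrite exprS IH -cisD -natr1 mulrDl mul1r addrC.
case: m => n; first by rewrite -exprnP cisXn.
by rewrite NegzE -exprnN cisXn -cisN rmorphN /= mulNr.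
Qed.

Lemma circle_pointE (r t : R) : circle_point r t = r%:C%C * cis t.
Proof. by rewrite /circle_point /cis; simpc. Qed.

Lemma norm_circle_point (r t : R) : 0 <= r -> `|circle_point r t| = r%:C%C.
Proof.
move=> r0; rewrite normc_def /=; congr (_%:C%C).
by rewrite !exprMn -mulrDr cos2Dsin2 mulr1 sqrtr_sqr ger0_norm.
Qed.

Lemma cunif_cis (m : R) : cunif (fun t => cis (m * t)).
Proof.
split; apply: continuous_unif_lim => t /=.
- by apply: (@continuous_comp _ _ _ (fun t => m * t) cos);
    [exact: mulrl_continuous|exact: continuous_cos].
- by apply: (@continuous_comp _ _ _ (fun t => m * t) sin);
    [exact: mulrl_continuous|exact: continuous_sin].
Qed.

End ComplexIntegral.

(** * Orthogonality of the characters of the circle *)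

Section CircleMean.
Variable R : realType.
Local Notation C := R[i].
Local Notation A := (`[0, 2 * pi] : set R).

Lemma sin_int2pi (m : int) : sin (m%:~R * (2 * pi)) = 0 :> R.
Proof.
have hn (n : nat) : sin (n%:R * (2 * pi)) = 0 :> R.
  by rewrite -[RHS]sin0 -[RHS](periodicn (@sinD2pi R) n) add0r !mulr_natl.
by case: m => n; rewrite ?NegzE ?rmorphN /= ?mulNr ?sinN ?hn ?oppr0.
Qed.

Lemma cos_int2pi (m : int) : cos (m%:~R * (2 * pi)) = 1 :> R.
Proof.
have hn (n : nat) : cos (n%:R * (2 * pi)) = 1 :> R.
  by rewrite -[RHS]cos0 -[RHS](periodicn (@cosD2pi R) n) add0r !mulr_natl.
by case: m => n; rewrite ?NegzE ?rmorphN /= ?mulNr ?cosN ?hn.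
Qed.

Lemma Rintegral_FTC (F f : R -> R) (a b : R) : a < b ->
  (forall x : R, is_derive x 1 F (f x)) -> continuous f ->
  \int[lebesgue_measure]_(t in `[a, b]) f t = F b - F a.
Proof.
move=> ab dF cf; have cF : continuous F.
  by move=> x; apply/differentiable_continuous/derivable1_diffP/ex_derive.
have dFx x : derivable F x 1 by apply: ex_derive.
rewrite /Rintegral (@continuous_FTC2 _ f F)//.
- exact: continuous_subspaceT.
- split => //; first exact/cvg_at_right_filter/cF.
  exact/cvg_at_left_filter/cF.
- by move=> x _; rewrite derive1E derive_val.
Qed.

Lemma Cintegral_cis (m : int) :
  Cintegral A (fun t => cis (m%:~R * t)) = if m == 0 then (2 * pi)%:C%C else 0.
Proof.
have p0 : 0 < 2 * pi :> R by rewrite mulr_gt0 ?pi_gt0.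
case: eqP => [->|/eqP m0].
  rewrite /Cintegral /cis /=.
  under eq_Rintegral do rewrite mul0r cos0.
  under [X in Complex _ X]eq_Rintegral do rewrite mul0r sin0.
  rewrite (@Rintegral_FTC id (fun=> 1)) ?subr0//; last by move=> x; exact: cvg_cst.
  rewrite (@Rintegral_FTC (fun=> 0) (fun=> 0)) ?subr0//.
  by move=> x; exact: cvg_cst.
have mR : m%:~R != 0 :> R by rewrite intr_eq0.
have cl (c : R) : continuous (fun x : R => c * x) by move=> x; exact: mulrl_continuous.
have dS (x : R) : is_derive x 1 (fun x => m%:~R^-1 * sin (m%:~R * x) : R) (cos (m%:~R * x)).
  apply: is_derive_eq.
  by rewrite [_%:A]mulr1 [cos _ * _]mulrC; exact: mulKf.
have dC (x : R) : is_derive x 1 (fun x => - m%:~R^-1 * cos (m%:~R * x) : R) (sin (m%:~R * x)).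
  apply: is_derive_eq.
  by rewrite [_%:A]mulr1 mulrC mulrN scaleNr scalerN opprK; exact: mulKf.
rewrite /Cintegral /cis /=; congr Complex.
- rewrite (Rintegral_FTC p0 dS).
  + by rewrite sin_int2pi !mulr0 sin0 mulr0 subrr.
  + move=> x; apply: (@continuous_comp R R R (fun x : R => m%:~R * x : R) cos);
      [exact: cl|exact: continuous_cos].
- rewrite (Rintegral_FTC p0 dC).
  + by rewrite cos_int2pi mulr0 cos0 subrr.
  + move=> x; apply: (@continuous_comp R R R (fun x : R => m%:~R * x : R) sin);
      [exact: cl|exact: continuous_sin].
Qed.
End CircleMean.

(** * Means over a torus and uniform Laurent approximation *)

Section TorusMean.
Variable R : realType.
Local Notation C := R[i].
Local Notation A := (`[0, 2 * pi] : set R).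
Variables (vs : seq nat) (r : nat -> R) (b : nat -> C).
Implicit Types (u : nat -> C) (f g F G : (nat -> C) -> C) (m : nat -> int)
  (q : seq (C * (nat -> int))) (js : seq nat) (K : pred (nat -> int)) (e : R).

Definition upd u j (v : C) : nat -> C := fun i => if i == j then v else u i.

(** Coordinates outside [vs] are frozen at [b]; in the contour integral this is how the end
    variables [x] and [y] become constants. *)
Definition torus u :=
  forall j, if j \in vs then `|u j| = (r j)%:C%C else u j = b j.

Definition circle_mean j F u : C :=
  ((2 * pi)^-1)%:C%C * Cintegral A (fun t => F (upd u j (circle_point (r j) t))).

Definition mean js F := foldr circle_mean F js.

Definition mono m u : C := \prod_(j <- vs) u j ^ m j.

Definition laurent q u : C := \sum_(p <- q) p.1 * mono p.2 u.

Definition free_of js m := all (fun j => m j == 0) js.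

Definition const_part js q := [seq p <- q | free_of js p.2].

(* [f] is a uniform limit on the torus of Laurent polynomials in the variables
   [vs] whose exponents satisfy [K]. *)
Definition lau K f := forall e, 0 < e -> exists2 q, all (K \o snd) q &
  forall u, torus u -> `|f u - laurent q u| <= e%:C%C.

Hypotheses (vs_uniq : uniq vs) (r_gt0 : forall j, j \in vs -> 0 < r j).

Lemma torus_neq0 u j : torus u -> j \in vs -> u j != 0.
Proof.
move=> /(_ j) + jv; rewrite jv -normr_eq0 => ->.
by rewrite eq_sym -(rmorph0 (real_complex R)) (inj_eq (@complexI _)) lt_eqF ?r_gt0.
Qed.

Lemma torus_upd u j t : j \in vs -> torus u ->
  torus (upd u j (circle_point (r j) t)).
Proof.
move=> jv Tu i; rewrite /upd; case: eqP => [->|_]; last exact: Tu.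
by rewrite jv norm_circle_point// ltW ?r_gt0.
Qed.

Lemma mono_upd m u j v : j \in vs ->
  mono m (upd u j v) = v ^ m j * \prod_(i <- vs | i != j) u i ^ m i.
Proof.
move=> jv; rewrite /mono (bigD1_seq j)//= {1}/upd eqxx; congr (_ * _).
by apply: eq_bigr => i /negbTE ij; rewrite /upd ij.
Qed.

Lemma circle_mean_mono m u j : j \in vs ->
  circle_mean j (mono m) u = if m j == 0 then mono m u else 0.
Proof.
move=> jv; have pn : 2 * pi != 0 :> R by rewrite mulf_neq0 ?gt_eqF ?pi_gt0.
rewrite /circle_mean.
have -> : (fun t => mono m (upd u j (circle_point (r j) t))) =
   (fun t => ((r j)%:C%C ^ m j * \prod_(i <- vs | i != j) u i ^ m i)
             * cis ((m j)%:~R * t)).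
  by apply/funext => t; rewrite mono_upd// circle_pointE expfzMl cisX mulrAC.
rewrite CintegralZ; last exact: cunif_cis.
rewrite Cintegral_cis; case: eqP => [m0|]; last by rewrite !mulr0.
rewrite mulrC -mulrA -rmorphM mulfV// mulr1 /mono m0 expr0z mul1r.
by rewrite [RHS](bigD1_seq j)//= m0 expr0z mul1r.
Qed.

Lemma cunif_laurent q u j : j \in vs ->
  cunif (fun t => laurent q (upd u j (circle_point (r j) t))).
Proof.
move=> jv; elim: q => [|p q IH].
  have -> : (fun t => laurent [::] (upd u j (circle_point (r j) t))) = fun=> 0.
    by apply/funext => t; rewrite /laurent big_nil.
  exact: cunif_cst.
have -> : (fun t => laurent (p :: q) (upd u j (circle_point (r j) t))) =
  (fun t => (p.1 * (r j)%:C%C ^ p.2 j * \prod_(i <- vs | i != j) u i ^ p.2 i)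
             * cis ((p.2 j)%:~R * t) + laurent q (upd u j (circle_point (r j) t))).
  apply/funext => t; rewrite /laurent big_cons; congr (_ + _).
  rewrite mono_upd// circle_pointE expfzMl cisX -!mulrA; congr (_ * (_ * _)).
  by rewrite mulrC.
by apply: cunifD => //; apply/cunifZ/cunif_cis.
Qed.

Lemma cunif_lau K f u j : lau K f -> torus u -> j \in vs ->
  cunif (fun t => f (upd u j (circle_point (r j) t))).
Proof.
move=> lf Tu jv; apply: cunif_limit => e /lf[q _ hq].
exists (fun t => laurent q (upd u j (circle_point (r j) t))).
  exact: cunif_laurent.
by move=> t _; apply/hq/torus_upd.
Qed.

Lemma circle_mean_laurent q u j : j \in vs ->
  circle_mean j (laurent q) u = laurent (const_part [:: j] q) u.
Proof.
move=> jv; elim: q => [|p q IH].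
  rewrite /circle_mean; have -> : (fun t => laurent [::] (upd u j (circle_point (r j) t))) =
     (fun=> 0 * 1 : C) by apply/funext => t; rewrite /laurent big_nil mul0r.
  by rewrite CintegralZ ?mul0r ?mulr0 /laurent ?big_nil//; exact: cunif_cst.
have -> : circle_mean j (laurent (p :: q)) u =
   p.1 * circle_mean j (mono p.2) u + circle_mean j (laurent q) u.
  rewrite /circle_mean.
  have -> : (fun t => laurent (p :: q) (upd u j (circle_point (r j) t))) =
     (fun t => p.1 * mono p.2 (upd u j (circle_point (r j) t)) +
        laurent q (upd u j (circle_point (r j) t))).
    by apply/funext => t; rewrite /laurent big_cons.
  have cm : cunif (fun t => mono p.2 (upd u j (circle_point (r j) t))).
    have -> : (fun t => mono p.2 (upd u j (circle_point (r j) t))) =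
       (fun t => laurent [:: (1, p.2)] (upd u j (circle_point (r j) t))).
      by apply/funext => t; rewrite /laurent big_seq1 mul1r.
    exact: cunif_laurent.
  rewrite CintegralD; [|exact: cunifZ|exact: cunif_laurent].
  by rewrite CintegralZ// mulrDr mulrCA.
rewrite IH circle_mean_mono// /const_part /= andbT.
by case: eqP => _; rewrite /laurent ?big_cons // mulr0 add0r.
Qed.

Lemma lau_sub K K' f : (forall m, K m -> K' m) -> lau K f -> lau K' f.
Proof.
move=> KK lf e /lf[q Kq hq]; exists q => //.
by apply: sub_all Kq => p; exact: KK.
Qed.

Lemma lau_laurent K q : all (K \o snd) q -> lau K (laurent q).
Proof. by move=> Kq e e0; exists q => // u _; rewrite subrr normr0 ler0c ltW. Qed.

Lemma lauT K f : lau K f -> lau xpredT f.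
Proof. exact: lau_sub. Qed.

Lemma circle_mean_le f g e u j : j \in vs -> torus u ->
  lau xpredT f -> lau xpredT g ->
  (forall v, torus v -> `|f v - g v| <= e%:C%C) ->
  `|circle_mean j f u - circle_mean j g u| <= (2 * e)%:C%C.
Proof.
move=> jv Tu lf lg fg; have pp : 0 < 2 * pi :> R by rewrite mulr_gt0 ?pi_gt0.
rewrite /circle_mean -mulrBr -[Cintegral _ _ - _]/(_ + - _) -mulN1r.
have cf := cunif_lau lf Tu jv; have cg := cunif_lau lg Tu jv.
rewrite -CintegralZ// -CintegralD//; last exact: cunifZ.
rewrite normrM; apply: (@le_trans _ _ (((2 * pi)^-1)%:C%C * (2 * (2 * pi * e))%:C%C)).
  have pV : 0 <= (2 * pi)^-1 :> R by rewrite invr_ge0 ltW.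
  rewrite normc_def /= expr0n addr0 sqrtr_sqr ger0_norm// ler_wpM2l ?ler0c//.
  apply: Cintegral_le; first by apply: cunifD => //; exact: cunifZ.
  by move=> t _; rewrite mulN1r fg//; exact: torus_upd.
by rewrite -rmorphM lecR mulrCA (mulrA _^-1) mulVf ?gt_eqF// mul1r.
Qed.

Lemma const_part_cons j js q :
  const_part (j :: js) q = const_part [:: j] (const_part js q).
Proof. by rewrite /const_part -filter_predI; apply: eq_filter => p /=; rewrite andbT. Qed.

Lemma const_partK K js q : all (K \o snd) q -> all (K \o snd) (const_part js q).
Proof.
move=> h; rewrite all_filter; apply: sub_all h => p Kp.
by apply/implyP.
Qed.

(** Both claims are proved in one induction, since the estimate for one more circle needs the inner
    mean to be itself a uniform limit of Laurent polynomials, hence integrable. Each circle doubles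
    the error, by [circle_mean_le]. *)
Lemma mean_approx_lau K js f : {subset js <= vs} -> lau K f ->
  (forall q e, (forall u, torus u -> `|f u - laurent q u| <= e%:C%C) ->
   forall u, torus u ->
     `|mean js f u - laurent (const_part js q) u| <= (2 ^+ size js * e)%:C%C)
  /\ lau K (mean js f).
Proof.
elim: js => [|j js IH] sub lf.
  split=> // q e h u Tu; rewrite expr0 mul1r.
  have -> : const_part [::] q = q by apply/all_filterP/allP.
  exact: h.
have jv : j \in vs by apply: sub; rewrite mem_head.
have {}IH := IH (fun i h => sub i (mem_behead (s := j :: js) h)) lf.
have [IH1 IH2] := IH.
have step q e : (forall u, torus u -> `|f u - laurent q u| <= e%:C%C) ->
   forall u, torus u -> `|mean (j :: js) f u - laurent (const_part (j :: js) q) u|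
     <= (2 ^+ size (j :: js) * e)%:C%C.
  move=> h u Tu; rewrite const_part_cons -circle_mean_laurent//= exprS -mulrA.
  apply: circle_mean_le => //; first exact: lauT IH2.
  - by apply: lau_laurent; exact/allP.
  - exact: IH1.
split=> // e e0; have e2 : 0 < e / 2 ^+ size (j :: js).
  by rewrite divr_gt0 ?exprn_gt0.
have [q Kq hq] := lf _ e2; exists (const_part (j :: js) q).
  exact: const_partK.
move=> u Tu; apply: (le_trans (step _ _ hq u Tu)).
by rewrite mulrC divfK// expf_neq0.
Qed.

Lemma mean_approx K js f q e : {subset js <= vs} -> lau K f ->
  (forall u, torus u -> `|f u - laurent q u| <= e%:C%C) ->
  forall u, torus u ->
     `|mean js f u - laurent (const_part js q) u| <= (2 ^+ size js * e)%:C%C.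
Proof. by move=> sub lf; have [h _] := mean_approx_lau sub lf; exact: h. Qed.

Lemma lau_mean K js f : {subset js <= vs} -> lau K f -> lau K (mean js f).
Proof. by move=> sub lf; have [_] := mean_approx_lau sub lf. Qed.

End TorusMean.

(** * Algebra of approximable functions and of their means *)

Section MeanTheory.
Variable R : realType.
Local Notation C := R[i].
Variables (vs : seq nat) (r : nat -> R) (b : nat -> C).
Hypotheses (vs_uniq : uniq vs) (r_gt0 : forall j, j \in vs -> 0 < r j).
Implicit Types (u v : nat -> C) (f g F G : (nat -> C) -> C) (m : nat -> int)
  (q : seq (C * (nat -> int))) (js : seq nat) (K : pred (nat -> int)) (e : R).
Local Notation torus := (torus vs r b).
Local Notation lau := (lau vs r b).
Local Notation mean := (mean r).
Local Notation laurent := (laurent vs).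
Local Notation mono := (mono vs).
Local Notation circle_mean := (circle_mean r).

Definition torus_pt j : C := if j \in vs then (r j)%:C%C else b j.

Lemma torus_ptP : torus torus_pt.
Proof.
move=> j; rewrite /torus_pt; have [jv|jv] := boolP (j \in vs) => //.
by rewrite ger0_norm// ler0c ltW// r_gt0.
Qed.

Lemma small_eq0 (x : C) (B : R) :
  (forall e, 0 < e -> `|x| <= (B * e)%:C%C) -> x = 0.
Proof.
move=> h; apply/eqP; rewrite -normr_le0.
case: x h => x y; rewrite normc_def /=; set s := Num.sqrt _ => h.
rewrite lecR leNgt; apply/negP => s0.
have B1 : 0 < `|B| + 1 by rewrite ltr_wpDl.
have := h (s / (`|B| + 1) / 2) _; rewrite !divr_gt0// => /(_ isT).
rewrite lecR; apply/negP; rewrite -ltNge mulrA.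
apply: (@le_lt_trans _ _ (s / 2)); last by rewrite ltr_pdivrMr// mulr_natr mulr2n ltrDl.
rewrite ler_wpM2r// mulrCA ler_piMr ?(ltW s0)// ler_pdivrMr// mul1r.
by rewrite (le_trans (ler_norm B))// lerDl.
Qed.

Lemma eq_lau K f g : (forall u, torus u -> f u = g u) -> lau K f -> lau K g.
Proof.
by move=> fg lf e /lf[q Kq hq]; exists q => // u Tu; rewrite -fg// hq.
Qed.

Lemma eq_mean js f g u : {subset js <= vs} -> torus u ->
  (forall v, torus v -> f v = g v) -> mean js f u = mean js g u.
Proof.
move=> + + fg; elim: js u => [|j js IH] u sub Tu; first exact: fg.
rewrite /= /circle_mean; congr (_ * _); apply: eq_Cintegral => t _.
apply: IH; first by move=> i ij; apply: sub; rewrite inE ij orbT.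
by apply: torus_upd => //; apply: sub; rewrite mem_head.
Qed.

Lemma lau_limit K f : (forall e, 0 < e -> exists2 g, lau K g &
    forall u, torus u -> `|f u - g u| <= e%:C%C) -> lau K f.
Proof.
move=> h e e0; have e2 : 0 < e / 2 by rewrite divr_gt0.
have [g lg fg] := h _ e2; have [q Kq hq] := lg _ e2.
exists q => // u Tu; rewrite -[f u](subrK (g u)) -addrA [e]splitr rmorphD.
by rewrite (le_trans (ler_normD _ _))// lerD ?fg ?hq.
Qed.

Lemma lauD K f g : lau K f -> lau K g -> lau K (fun u => f u + g u).
Proof.
move=> lf lg e e0; have e2 : 0 < e / 2 by rewrite divr_gt0.
have [p Kp hp] := lf _ e2; have [q Kq hq] := lg _ e2.
exists (p ++ q); first by rewrite all_cat Kp.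
move=> u Tu; rewrite /laurent big_cat /= opprD addrACA [e]splitr rmorphD.
by rewrite (le_trans (ler_normD _ _))// lerD ?hp ?hq.
Qed.

Lemma norm_mono m u : torus u ->
  `|mono m u| = (\prod_(j <- vs) r j ^ m j)%:C%C.
Proof.
move=> Tu; rewrite /mono normr_prod rmorph_prod /=; apply: eq_big_seq => j jv.
have -> : `|u j ^ m j| = `|u j| ^ m j.
  by case: (m j) => n; rewrite ?NegzE -?exprnP -?exprnN ?normfV ?normrX.
by have := Tu j; rewrite jv => ->; rewrite fmorphXz.
Qed.

Lemma laurent_bound q : exists2 B : R, 0 <= B &
  forall u, torus u -> `|laurent q u| <= B%:C%C.
Proof.
elim: q => [|p q [B B0 IH]].
  by exists 0 => // u _; rewrite /laurent big_nil normr0.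
exists (complex.Re `|p.1| * `|\prod_(j <- vs) r j ^ p.2 j| + B).
  by rewrite addr_ge0// mulr_ge0// -ler0c RRe_real ?normr_real.
move=> u Tu; rewrite /laurent big_cons rmorphD (le_trans (ler_normD _ _))//.
rewrite lerD ?IH// normrM rmorphM [X in _ <= X * _]/(`|p.1|) ler_wpM2l//.
by rewrite norm_mono// lecR ler_norm.
Qed.

Lemma lau_bound K f : lau K f -> exists2 B : R, 0 <= B &
  forall u, torus u -> `|f u| <= B%:C%C.
Proof.
move=> /(_ _ ltr01)[q _ hq]; have [B B0 hB] := laurent_bound q.
exists (1 + B); first by rewrite addr_ge0.
move=> u Tu; rewrite -[f u](subrK (laurent q u)) rmorphD.
by rewrite (le_trans (ler_normD _ _))// lerD ?hq ?hB.
Qed.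

Lemma lauZ K c f : lau K f -> lau K (fun u => c * f u).
Proof.
move=> lf e e0; have [|] := eqVneq c 0 => [->|c0].
  by exists [::] => // u _; rewrite mul0r /laurent big_nil subrr normr0 ler0c ltW.
have cn0 : 0 < complex.Re `|c|.
  by rewrite -(ltcR 0) RRe_real ?normr_real// normr_gt0.
have [q Kq hq] := lf _ (divr_gt0 e0 cn0).
exists [seq (c * p.1, p.2) | p <- q]; first by rewrite all_map.
move=> u Tu; rewrite /laurent big_map /=.
under eq_bigr do rewrite -mulrA.
rewrite -mulr_sumr -mulrBr normrM (le_trans (ler_wpM2l _ (hq u Tu)))//.
rewrite -[`|c|](@RRe_real _ `|c|) ?normr_real// -rmorphM lecR.
by rewrite mulrC divfK ?gt_eqF.
Qed.

Lemma monoM m m' u : torus u ->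
  mono m u * mono m' u = mono (fun j => m j + m' j) u.
Proof.
move=> Tu; rewrite /mono -big_split /=; apply: eq_big_seq => j jv.
by rewrite expfzDr//; exact: torus_neq0 Tu jv.
Qed.

Lemma lau_mono K m : K m -> lau K (mono m).
Proof.
move=> Km; apply: (@eq_lau _ (laurent [:: (1, m)])).
  by move=> u _; rewrite /laurent big_seq1 mul1r.
by apply: lau_laurent; rewrite /= Km.
Qed.

Lemma lau_monoM K1 K2 K m f : K1 m -> lau K2 f ->
  (forall m1 m2, K1 m1 -> K2 m2 -> K (fun j => m1 j + m2 j)) ->
  lau K (fun u => mono m u * f u).
Proof.
move=> Km lf KK; apply: lau_limit => e e0.
have [B B0 hB] := laurent_bound [:: (1, m)].
have B1 : 0 < B + 1 by rewrite ltr_wpDl.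
have [q Kq hq] := lf _ (divr_gt0 e0 B1).
exists (fun u => mono m u * laurent q u).
  apply: (@eq_lau _ (laurent [seq (p.1, fun j => m j + p.2 j) | p <- q])).
    move=> u Tu; rewrite /laurent big_map mulr_sumr; apply: eq_bigr => p _ /=.
    by rewrite -monoM// mulrCA.
  apply: lau_laurent; rewrite all_map; apply: sub_all Kq => p /= Kp.
  exact: KK.
move=> u Tu; rewrite -mulrBr normrM.
have := hB u Tu; rewrite /laurent big_seq1 mul1r => hm.
apply: (le_trans (ler_pM _ _ hm (hq u Tu))) => //.
rewrite -rmorphM lecR mulrCA ler_piMr ?(ltW e0)// ler_pdivrMr// mul1r.
by rewrite lerDl.
Qed.

(** Only [f] is replaced by an approximant, with a precision divided by a bound of [g]; the products
    of its monomials with [g] fall under [lau_monoM]. *)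
Lemma lauM K1 K2 K f g : lau K1 f -> lau K2 g ->
  (forall m1 m2, K1 m1 -> K2 m2 -> K (fun j => m1 j + m2 j)) ->
  lau K (fun u => f u * g u).
Proof.
move=> lf lg KK; apply: lau_limit => e e0.
have [B B0 hB] := lau_bound lg; have B1 : 0 < B + 1 by rewrite ltr_wpDl.
have [q Kq hq] := lf _ (divr_gt0 e0 B1).
exists (fun u => laurent q u * g u).
  elim: q Kq {hq} => [_|p q IH /= /andP[Kp Kq]].
    apply: (@eq_lau _ (laurent [::])); last exact: lau_laurent.
    by move=> u _; rewrite /laurent big_nil mul0r.
  apply: (@eq_lau _ (fun u => p.1 * (mono p.2 u * g u) + laurent q u * g u)).
    by move=> u _; rewrite /laurent big_cons mulrDl mulrA.
  by apply: lauD; [apply: lauZ; exact: lau_monoM KK|exact: IH].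
move=> u Tu; rewrite -mulrBl normrM.
apply: (le_trans (ler_pM _ _ (hq u Tu) (hB u Tu))) => //.
rewrite -rmorphM lecR mulrAC -mulrA ler_piMr ?(ltW e0)// ler_pdivrMr// mul1r.
by rewrite lerDl.
Qed.

Lemma meanD js f g u : {subset js <= vs} -> torus u ->
  lau xpredT f -> lau xpredT g ->
  mean js (fun v => f v + g v) u = mean js f u + mean js g u.
Proof.
move=> sub Tu lf lg; apply/eqP; rewrite -subr_eq0; apply/eqP.
apply: (@small_eq0 _ (2 ^+ size js * 4)) => e e0.
have [p _ hp] := lf _ e0; have [q _ hq] := lg _ e0.
have hpq v : torus v -> `|f v + g v - laurent (p ++ q) v| <= (2 * e)%:C%C.
  move=> Tv; rewrite /laurent big_cat /= opprD addrACA.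
  rewrite (le_trans (ler_normD _ _))// mulr_natl mulr2n rmorphD.
  by rewrite lerD ?hp ?hq.
have h1 := mean_approx vs_uniq r_gt0 sub (lauD lf lg) hpq Tu.
have h2 := mean_approx vs_uniq r_gt0 sub lf hp Tu.
have h3 := mean_approx vs_uniq r_gt0 sub lg hq Tu.
set P := laurent (const_part js p) u in h2.
set Q := laurent (const_part js q) u in h3.
have PQ : laurent (const_part js (p ++ q)) u = P + Q.
  by rewrite /const_part filter_cat /laurent big_cat.
rewrite PQ in h1.
rewrite (_ : _ - _ = (mean js (fun v => f v + g v) u - (P + Q))
  - (mean js f u - P) - (mean js g u - Q)); last by ring.
apply: (le_trans (ler_normB _ _)).
rewrite (_ : 2 ^+ size js * 4 * e = (2 ^+ size js * (2 * e) + 2 ^+ size js * e)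
   + 2 ^+ size js * e); last by ring.
rewrite 2!rmorphD lerD// (le_trans (ler_normB _ _))// lerD//.
Qed.

Definition indep js F := forall u v, torus u -> torus v ->
  {in [predC js], u =1 v} -> F u = F v.

Lemma indep_sub js js' F : {subset js' <= js} -> indep js F -> indep js' F.
Proof.
move=> sub iF u v Tu Tv uv; apply: iF => // i; rewrite inE => ij.
by apply: uv; rewrite inE; apply: contra ij => /sub.
Qed.

Lemma indep_upd js F j t u : indep js F -> j \in js -> j \in vs -> torus u ->
  F (upd u j (circle_point (r j) t)) = F u.
Proof.
move=> iF jj jv Tu; apply: iF => //; first exact: torus_upd.
by move=> i; rewrite inE /upd; case: eqP => // ->; rewrite jj.
Qed.

Lemma mean_indepM js F G u : {subset js <= vs} -> torus u ->
  indep js F -> lau xpredT G ->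
  mean js (fun v => F v * G v) u = F u * mean js G u.
Proof.
move=> + + + lG; elim: js u => [|j js IH] u sub Tu iF //=.
have jv : j \in vs by apply: sub; rewrite mem_head.
have sub' : {subset js <= vs} by move=> i ij; apply: sub; rewrite inE ij orbT.
have iF' : indep js F by apply: indep_sub iF => i ij; rewrite inE ij orbT.
rewrite /circle_mean mulrCA; congr (_ * _).
rewrite -CintegralZ; last by apply: (cunif_lau vs_uniq r_gt0 _ Tu jv); exact: (lau_mean vs_uniq r_gt0 sub' lG).
apply: eq_Cintegral => t _; rewrite IH//; last exact: torus_upd.
by rewrite (indep_upd t iF) ?mem_head.
Qed.

Lemma lau_cst K c : K (fun=> 0) -> lau K (fun=> c).
Proof.
move=> K0; apply: (@eq_lau _ (fun u => c * mono (fun=> 0) u)).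
  by move=> u _; rewrite /mono big1 ?mulr1// => j _; rewrite expr0z.
by apply: lauZ; exact: lau_mono.
Qed.

Lemma mean_cst js c u : {subset js <= vs} -> torus u -> mean js (fun=> c) u = c.
Proof.
move=> sub Tu; elim: js u Tu sub => [|j js IH] u Tu sub //=.
have jv : j \in vs by apply: sub; rewrite mem_head.
have sub' : {subset js <= vs} by move=> i ij; apply: sub; rewrite inE ij orbT.
rewrite /circle_mean (@eq_Cintegral _ _ (fun t => c * cis (0%:~R * t))).
  rewrite CintegralZ ?Cintegral_cis ?eqxx; last exact: cunif_cis.
  rewrite mulrCA -rmorphM mulVf ?mulr1//.
  by rewrite mulf_neq0 ?gt_eqF ?pi_gt0.
by move=> t _; rewrite mul0r cis0 mulr1 IH//; exact: torus_upd.
Qed.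

Lemma mean_indep js F u : {subset js <= vs} -> torus u -> indep js F ->
  mean js F u = F u.
Proof.
move=> sub Tu iF; rewrite -[RHS]mulr1 -(mean_cst 1 sub Tu) -mean_indepM//.
  by apply: eq_mean => // v _; rewrite mulr1.
exact: lau_cst.
Qed.

Lemma meanZ js c f u : {subset js <= vs} -> torus u -> lau xpredT f ->
  mean js (fun v => c * f v) u = c * mean js f u.
Proof. by move=> sub Tu lf; rewrite (@mean_indepM js (fun=> c)). Qed.

(** No monomial of an approximant survives the mean, so the mean is within every precision of 0. *)
Lemma mean_vanish K js f u : {subset js <= vs} -> torus u -> lau K f ->
  (forall m, K m -> ~~ free_of js m) -> mean js f u = 0.
Proof.
move=> sub Tu lf KK; apply: (@small_eq0 _ (2 ^+ size js)) => e e0.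
have [q Kq hq] := lf _ e0; have := mean_approx vs_uniq r_gt0 sub lf hq Tu.
suff -> : const_part js q = [::] by rewrite /laurent big_nil subr0.
apply/eqP; rewrite -[_ == _]negbK -has_filter -all_predC.
by apply: sub_all Kq => p /KK.
Qed.

(** This plays the role of Fubini: the surviving monomials depend only on the set of averaged
    variables, so the order of the circles is immaterial. *)
Lemma mean_eq_mem K js js' f u : {subset js <= vs} -> js =i js' -> torus u ->
  lau K f -> mean js f u = mean js' f u.
Proof.
move=> sub jj Tu lf; apply/eqP; rewrite -subr_eq0; apply/eqP.
have sub' : {subset js' <= vs} by move=> i; rewrite -jj; exact: sub.
apply: (@small_eq0 _ (2 ^+ size js + 2 ^+ size js')) => e e0.
have [q Kq hq] := lf _ e0; have h1 := mean_approx vs_uniq r_gt0 sub lf hq Tu.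
have := mean_approx vs_uniq r_gt0 sub' lf hq Tu.
have <- : const_part js q = const_part js' q.
  by apply: eq_filter => p; exact: eq_all_r.
set P := laurent _ _ in h1 * => h2.
rewrite (_ : _ - _ = (mean js f u - P) - (mean js' f u - P)); last by ring.
by rewrite (le_trans (ler_normB _ _))// mulrDl rmorphD lerD.
Qed.

Lemma mean_cat js js' f : mean (js ++ js') f = mean js (mean js' f).
Proof. by rewrite /mean foldr_cat. Qed.

End MeanTheory.

(** * Weights of monomials and geometric series for the poles *)

Section WeightedDegree.
Variable R : realType.
Local Notation C := R[i].
Variables (vs : seq nat) (r : nat -> R) (b : nat -> C).
Hypotheses (vs_uniq : uniq vs) (r_gt0 : forall j, j \in vs -> 0 < r j).
Implicit Types (u v : nat -> C) (f g F G : (nat -> C) -> C) (m : nat -> int)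
  (w : nat -> int) (c : int) (x : bool) (e : R).
Local Notation torus := (torus vs r b).
Local Notation lau := (lau vs r b).

Definition wdeg w m : int := \sum_(j <- vs) w j * m j.

(** One flag lets every closure lemma serve two purposes: lower bounds on weights make constant
    terms vanish, exact weights express homogeneity. *)
Definition rel_deg x c c' := if x then c <= c' else c == c' :> int.

(* With [x] true (resp. false), all the monomials of the approximants of [f]
   have weight at least (resp. exactly) [c]. *)
Definition lau_deg x w c f := lau (fun m => rel_deg x c (wdeg w m)) f.

(** A variable outside [vs] is constant on the torus, so it weighs 0 whatever [w] says. *)
Definition eff w i : int := if i \in vs then w i else 0.

Lemma rel_deg_refl x c : rel_deg x c c.
Proof. by case: x => /=. Qed.

Lemma rel_degD x c1 c2 d1 d2 :
  rel_deg x c1 d1 -> rel_deg x c2 d2 -> rel_deg x (c1 + c2) (d1 + d2).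
Proof. by case: x => /= [|/eqP-> /eqP->//]; exact: lerD. Qed.

Lemma rel_deg_trans x c1 c2 c3 : rel_deg x c1 c2 -> rel_deg x c2 c3 -> rel_deg x c1 c3.
Proof. by case: x => /= [|/eqP->//]; exact: le_trans. Qed.

Lemma wdegD w m m' : wdeg w (fun j => m j + m' j) = wdeg w m + wdeg w m'.
Proof. by rewrite /wdeg -big_split; apply: eq_bigr => j _; rewrite mulrDr. Qed.

Lemma wdeg0 w : wdeg w (fun=> 0) = 0.
Proof. by rewrite /wdeg big1// => j _; rewrite mulr0. Qed.

Lemma lau_degT x w c f : lau_deg x w c f -> lau xpredT f.
Proof. exact: lauT. Qed.

Lemma lau_deg_eq x w c f g : (forall u, torus u -> f u = g u) ->
  lau_deg x w c f -> lau_deg x w c g.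
Proof. exact: eq_lau. Qed.

Lemma lau_deg_weak x w c c' f : rel_deg x c' c -> lau_deg x w c f -> lau_deg x w c' f.
Proof. by move=> cc; apply: lau_sub => m; exact: rel_deg_trans. Qed.

Lemma lau_degD x w c f g : lau_deg x w c f -> lau_deg x w c g ->
  lau_deg x w c (fun u => f u + g u).
Proof. exact: lauD. Qed.

Lemma lau_degZ x w c a f : lau_deg x w c f -> lau_deg x w c (fun u => a * f u).
Proof. exact: lauZ. Qed.

Lemma lau_degM x w c c' f g : lau_deg x w c f -> lau_deg x w c' g ->
  lau_deg x w (c + c') (fun u => f u * g u).
Proof.
rewrite /lau_deg => lf lg; have := lauM r_gt0 lf lg; apply => m1 m2 h1 h2.
by rewrite wdegD; exact: rel_degD.
Qed.

Lemma lau_deg_cst x w a : lau_deg x w 0 (fun=> a).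
Proof. by apply: lau_cst; rewrite wdeg0 rel_deg_refl. Qed.

Lemma lau_deg_sum x w c (I : Type) (s : seq I) (P : pred I) (F : I -> (nat -> C) -> C) :
  (forall i, P i -> lau_deg x w c (F i)) ->
  lau_deg x w c (fun u => \sum_(i <- s | P i) F i u).
Proof.
move=> h; elim: s => [|i s IH].
  apply: (@lau_deg_eq _ _ _ (fun u => 0 * laurent vs [::] u)).
    by move=> u _; rewrite mul0r big_nil.
  by apply: lau_degZ; apply: lau_laurent.
case Pi : (P i); last by apply: lau_deg_eq IH => u _; rewrite big_cons Pi.
apply: (@lau_deg_eq _ _ _ (fun u => F i u + \sum_(j <- s | P j) F j u)).
  by move=> u _; rewrite big_cons Pi.
by apply: lau_degD => //; exact: h.
Qed.

Lemma lau_deg_prod x w (I : eqType) (s : seq I) (P : pred I) (c : I -> int)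
    (F : I -> (nat -> C) -> C) :
  (forall i, i \in s -> P i -> lau_deg x w (c i) (F i)) ->
  lau_deg x w (\sum_(i <- s | P i) c i) (fun u => \prod_(i <- s | P i) F i u).
Proof.
elim: s => [|i s IH] h.
  rewrite big_nil; apply: lau_deg_eq (lau_deg_cst x w 1).
  by move=> u _; rewrite big_nil.
have {}IH : lau_deg x w (\sum_(i <- s | P i) c i) (fun u => \prod_(i <- s | P i) F i u).
  by apply: IH => j js; apply: h; rewrite inE js orbT.
rewrite big_cons; case Pi : (P i); last first.
  by apply: lau_deg_eq IH => u _; rewrite big_cons Pi.
apply: (@lau_deg_eq _ _ _ (fun u => F i u * \prod_(j <- s | P j) F j u)).
  by move=> u _; rewrite big_cons Pi.
by apply: lau_degM => //; apply: h => //; exact: mem_head.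
Qed.

Lemma lau_degX x w c f n : lau_deg x w c f ->
  lau_deg x w (c *+ n) (fun u => f u ^+ n).
Proof.
move=> lf; elim: n => [|n IH].
  by apply: lau_deg_eq (lau_deg_cst x w 1) => u _; rewrite expr0.
rewrite mulrS; apply: lau_deg_eq (lau_degM lf IH) => u _.
by rewrite exprS.
Qed.

Lemma lau_deg_varX x w i (n : int) : i \in vs ->
  lau_deg x w (w i * n) (fun u => u i ^ n).
Proof.
move=> iv; apply: (@lau_deg_eq _ _ _ (mono vs (fun j => if j == i then n else 0))).
  move=> u _; rewrite /mono (bigD1_seq i)//= eqxx big1 ?mulr1//.
  by move=> j /negbTE ->; rewrite expr0z.
apply: lau_mono; rewrite /wdeg (bigD1_seq i)//= eqxx big1 ?addr0 ?rel_deg_refl//.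
by move=> j /negbTE ->; rewrite mulr0.
Qed.

Lemma lau_deg_var x w i : lau_deg x w (eff w i) (fun u => u i).
Proof.
rewrite /eff; case: ifP => iv.
  rewrite -[w i]mulr1; exact: (lau_deg_varX x w 1 iv).
apply: lau_deg_eq (lau_deg_cst x w (b i)) => u /(_ i).
by rewrite iv.
Qed.

Lemma lau_deg_inv x w i : i \in vs -> lau_deg x w (- w i) (fun u => (u i)^-1).
Proof.
move=> iv; rewrite -mulrN1; apply: lau_deg_eq (lau_deg_varX x w (-1) iv) => u _.
by rewrite exprN1.
Qed.

Lemma lau_limit_deg x w c f : (forall e, 0 < e -> exists2 g, lau_deg x w c g &
    forall u, torus u -> `|f u - g u| <= e%:C%C) -> lau_deg x w c f.
Proof. exact: lau_limit. Qed.

(** Partial sums of the geometric series are polynomials in [t], and the remainder is at most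
    [q ^+ M / (1 - q)] uniformly on the torus. *)
Lemma lau_deg_geom x w t (q : R) : lau_deg x w 0 t -> q < 1 ->
  (forall u, torus u -> `|t u| <= q%:C%C) ->
  lau_deg x w 0 (fun u => (1 - t u)^-1).
Proof.
move=> lt q1 htq.
have q0 : 0 <= q by rewrite -ler0c; apply: le_trans (htq _ (torus_ptP b r_gt0)).
apply: lau_limit_deg => e e0.
have oq : 0 < 1 - q by rewrite subr_gt0.
have [M hM] : exists M, q ^+ M <= e * (1 - q).
  have : (fun n => q ^+ n) @ \oo --> (0 : R) by apply: cvg_expr; rewrite ger0_norm.
  move=> /cvgrPdist_le /(_ _ (mulr_gt0 e0 oq)) [M _ hM].
  by exists M; have := hM M (leqnn M); rewrite sub0r normrN ger0_norm// exprn_ge0.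
exists (fun u => \sum_(i < M) t u ^+ i).
  apply: lau_deg_sum => i _; rewrite -(mul0rn _ i); exact: lau_degX.
move=> u Tu.
have nt : (1 - q)%:C%C <= `|1 - t u|.
  rewrite rmorphB (le_trans _ (lerB_dist _ _))// normr1 rmorph1 lerB//.
  exact: htq.
have ot : 1 - t u != 0 by rewrite -normr_gt0 (lt_le_trans _ nt)// ltcR.
have -> : (1 - t u)^-1 - \sum_(i < M) t u ^+ i = t u ^+ M / (1 - t u).
  apply: (mulIf ot); rewrite mulrBl mulVf// divfK//.
  by rewrite -[1 - t u]opprB mulrN opprK mulrC -subrX1 addrC subrK.
rewrite normrM normfV ler_pdivrMr ?normr_gt0// normrX.
apply: (@le_trans _ _ ((q ^+ M)%:C%C)).
  by rewrite rmorphXn lerXn2r// ?nnegrE// ?ler0c//; exact: htq.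
apply: (@le_trans _ _ (e * (1 - q))%:C%C); first by rewrite lecR.
by rewrite rmorphM ler_wpM2l ?ler0c // ltW.
Qed.

(* The second difference [fd j] is the linear form attached to the pole
   [u_j = (u_(j-1) + u_(j+1)) / 2]. *)
Definition fd j u : C := 2 * u j - u j.-1 - u j.+1.

(** The radius inequality makes [2 u_j] dominate the sum of its neighbours, so the pole expands in
    the neighbours divided by [u_j]. The bounds on the neighbours are stated on points so as to
    cover frozen ones. *)
Definition admissible j := [/\ j \in vs, r j.-1 + r j.+1 < 2 * r j &
  forall u, torus u -> `|u j.-1| <= (r j.-1)%:C%C /\ `|u j.+1| <= (r j.+1)%:C%C].

Lemma fd_neq0 j u : admissible j -> torus u -> fd j u != 0.
Proof.
move=> [jv rr hu] Tu; rewrite -normr_gt0 /fd -addrA -opprD.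
apply: (@lt_le_trans _ _ (2 * r j - (r j.-1 + r j.+1))%:C%C).
  by rewrite ltcR subr_gt0.
apply: le_trans (lerB_dist _ _); rewrite rmorphB rmorphM rmorph_nat rmorphD lerB//.
  rewrite normrM; have := Tu j; rewrite jv => ->.
  by rewrite (ger0_norm (ler0n _ 2)).
by have [h1 h2] := hu u Tu; rewrite (le_trans (ler_normD _ _))// lerD.
Qed.

Lemma lau_deg_pole x w j : admissible j ->
  rel_deg x (w j) (eff w j.-1) -> rel_deg x (w j) (eff w j.+1) ->
  lau_deg x w 0 (fun u => u j / fd j u).
Proof.
move=> adj w1 w2; have [jv rr hu] := adj; have rj := r_gt0 jv.
pose t u : C := 2^-1 * (u j.-1 * (u j)^-1 + u j.+1 * (u j)^-1).
have lt : lau_deg x w 0 t.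
  apply: lau_degZ; apply: lau_degD.
  - apply: (@lau_deg_weak _ _ (eff w j.-1 - w j)).
      by rewrite -(subrr (w j)); apply: rel_degD => //; exact: rel_deg_refl.
    by apply: lau_degM; [exact: lau_deg_var|exact: lau_deg_inv].
  - apply: (@lau_deg_weak _ _ (eff w j.+1 - w j)).
      by rewrite -(subrr (w j)); apply: rel_degD => //; exact: rel_deg_refl.
    by apply: lau_degM; [exact: lau_deg_var|exact: lau_deg_inv].
apply: (@lau_deg_eq _ _ _ (fun u => 2^-1 * (1 - t u)^-1)).
  move=> u Tu; have uj := torus_neq0 r_gt0 Tu jv.
  have := fd_neq0 adj Tu; rewrite /t /fd => fj.
  have -> : 1 - 2^-1 * (u j.-1 / u j + u j.+1 / u j) =
            (2 * u j - u j.-1 - u j.+1) / (2 * u j).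
    by field; rewrite uj.
  by field; rewrite uj fj.
apply: lau_degZ.
apply: (@lau_deg_geom _ _ _ ((r j.-1 + r j.+1) / (2 * r j)) lt).
  by rewrite ltr_pdivrMr ?mul1r// mulr_gt0.
move=> u Tu; have [h1 h2] := hu u Tu; have uj := torus_neq0 r_gt0 Tu jv.
rewrite /t -mulrDl mulrA (mulrC _^-1) -mulrA -invfM normrM normfV.
rewrite normrM; have := Tu j; rewrite jv => ->.
rewrite (ger0_norm (ler0n _ 2)) rmorphM fmorphV rmorphM rmorph_nat rmorphD.
rewrite ler_wpM2r ?invr_ge0 ?mulr_ge0 ?ler0c ?(ltW rj)//.
by rewrite (le_trans (ler_normD _ _))// lerD.
Qed.

(** The expansion is in powers of [z / u_j]: only nonpositive powers of [u_j] occur, and these have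
    nonnegative weight when [w j] is nonpositive. *)
Lemma lau_deg_simple_pole x w j (z : C) : j \in vs -> `|z| < (r j)%:C%C ->
  rel_deg x (w j) 0 -> lau_deg x w 0 (fun u => u j / (u j - z)).
Proof.
move=> jv zr wj; have rj := r_gt0 jv.
have zE : `|z| = (Normc.normc z)%:C%C by [].
apply: (@lau_deg_eq _ _ _ (fun u => (1 - z * (u j)^-1)^-1)).
  move=> u Tu; have uj := torus_neq0 r_gt0 Tu jv.
  have uz : u j - z != 0.
    rewrite subr_eq0; apply: contraTneq zr => <-.
    by have := Tu j; rewrite jv => ->; rewrite ltxx.
  have -> : 1 - z * (u j)^-1 = (u j - z) / u j by field.
  by rewrite invf_div.
apply: (@lau_deg_geom _ _ _ (Normc.normc z / r j)).
- apply: lau_degZ; apply: (@lau_deg_weak _ _ (- w j)); last exact: lau_deg_inv.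
  by case: x wj => /= [|/eqP ->]; rewrite ?oppr0// oppr_ge0.
- by rewrite ltr_pdivrMr// mul1r -ltcR -zE.
- move=> u Tu; rewrite normrM normfV rmorphM fmorphV.
  by have := Tu j; rewrite jv => ->.
Qed.

(** A monomial free of all the variables weighs 0, which weight at least 1 excludes. *)
Lemma mean_deg_vanish w f u : torus u -> lau_deg true w 1 f -> mean r vs f u = 0.
Proof.
move=> Tu lf; apply: (mean_vanish vs_uniq r_gt0 _ Tu lf) => // m /= h.
apply: contraTN h => /allP h; rewrite /wdeg big1_seq//= => j jv.
by rewrite (eqP (h j jv)) mulr0.
Qed.

End WeightedDegree.

(** * Constant terms and their factorisation *)

Section ConstantTerm.
Variable R : realType.
Local Notation C := R[i].
Variables (vs : seq nat) (r : nat -> R) (b : nat -> C).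
Hypotheses (vs_uniq : uniq vs) (r_gt0 : forall j, j \in vs -> 0 < r j).
Implicit Types (u v : nat -> C) (f g F G : (nat -> C) -> C) (m : nat -> int)
  (w : nat -> int) (c : C) (js : seq nat).
Local Notation torus := (torus vs r b).
Local Notation lauT := (lau vs r b xpredT).
Local Notation lau_deg := (lau_deg vs r b).
Local Notation torus_pt := (torus_pt vs r b).
Local Notation torus_ptP := (torus_ptP b r_gt0).
Local Notation indep := (indep vs r b).

(** All variables of [vs] being averaged, every point of the torus would give the same value. *)
Definition ct f : C := mean r vs f torus_pt.

Lemma eq_ct f g : (forall u, torus u -> f u = g u) -> ct f = ct g.
Proof. by move=> fg; apply: (eq_mean r_gt0 _ torus_ptP fg). Qed.

Lemma ctD f g : lauT f -> lauT g -> ct (fun u => f u + g u) = ct f + ct g.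
Proof. by move=> lf lg; apply: (meanD vs_uniq r_gt0 _ torus_ptP lf lg). Qed.

Lemma ctZ c f : lauT f -> ct (fun u => c * f u) = c * ct f.
Proof. by move=> lf; apply: (meanZ vs_uniq r_gt0 c _ torus_ptP lf). Qed.

Lemma ct_cst c : ct (fun=> c) = c.
Proof. exact: (mean_cst r_gt0 c _ torus_ptP). Qed.

Lemma ct_sum (I : Type) (s : seq I) (P : pred I) (F : I -> (nat -> C) -> C) :
  (forall i, P i -> lauT (F i)) ->
  ct (fun u => \sum_(i <- s | P i) F i u) = \sum_(i <- s | P i) ct (F i).
Proof.
move=> lF; elim: s => [|i s IH].
  rewrite big_nil -[RHS]ct_cst; apply: eq_ct => u _; exact: big_nil.
rewrite big_cons -IH; case Pi : (P i); last first.
  by apply: eq_ct => u _; rewrite big_cons Pi.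
rewrite -ctD; [|exact: lF|]; last first.
  elim: s {IH} => [|j s IH].
    by apply: (eq_lau _ (@lau_cst _ vs r b xpredT 0 isT)) => u _; rewrite big_nil.
  case Pj : (P j); last by apply: (eq_lau _ IH) => u _; rewrite big_cons Pj.
  by apply: (eq_lau _ (lauD (lF j Pj) IH)) => u _; rewrite big_cons Pj.
by apply: eq_ct => u _; rewrite big_cons Pi.
Qed.

Lemma ct_vanish w f : lau_deg true w 1 f -> ct f = 0.
Proof. exact: (mean_deg_vanish vs_uniq r_gt0 torus_ptP). Qed.

Lemma ct_mod w f g : lauT f -> lauT g ->
  lau_deg true w 1 (fun u => f u - g u) -> ct f = ct g.
Proof.
move=> lf lg /ct_vanish h; have lN : lauT (fun u => - 1 * g u) by exact: lauZ.
move: h; rewrite (@eq_ct _ (fun u => f u + - 1 * g u)); last first.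
  by move=> u _; rewrite mulN1r.
by rewrite ctD// ctZ// mulN1r => /eqP; rewrite subr_eq0 => /eqP.
Qed.

Lemma indep_mean js js' F : {subset js' <= vs} -> indep js F ->
  indep js (mean r js' F).
Proof.
elim: js' => [//|j js' IH] sub iF u v Tu Tv uv /=.
have jv : j \in vs by apply: sub; rewrite mem_head.
rewrite /circle_mean; congr (_ * _); apply: eq_Cintegral => t _.
apply: IH => //; try exact: torus_upd.
  by move=> i ij; apply: sub; rewrite inE ij orbT.
by move=> i ij; rewrite /upd; case: eqP => // _; exact: uv.
Qed.

(** After the mean only [u_s] can remain, and a monomial of weight 0 in [u_s] alone is trivial
    because [w s] is nonzero. The means of the approximants are therefore constants, the sums of the
    surviving coefficients. *)
Lemma mean_homog_const w s js F : {subset js <= vs} -> s \in vs -> w s != 0 ->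
  {in vs, forall j, j != s -> j \in js} -> lau_deg false w 0 F ->
  forall u v, torus u -> torus v -> mean r js F u = mean r js F v.
Proof.
move=> sub sv ws cover lF u v Tu Tv; apply/eqP; rewrite -subr_eq0; apply/eqP.
apply: (@small_eq0 _ _ (2 ^+ size js * 2)) => e e0.
have [q Kq hq] := lF _ e0; have h := mean_approx vs_uniq r_gt0 sub lF hq.
have E u' : torus u' -> laurent vs (const_part js q) u' =
    \sum_(p <- const_part js q) p.1.
  move=> Tu'; elim: q Kq {hq h} => [|p q IH]; first by rewrite /laurent !big_nil.
  rewrite /= => /andP[/eqP Kp /IH {}IH]; case: ifP => // fp.
  rewrite /laurent !big_cons -IH; congr (_ + _).
  rewrite /mono big1_seq ?mulr1//= => j jv; suff -> : p.2 j = 0 by rewrite expr0z.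
  have [->|js'] := eqVneq j s; last by exact/eqP/(allP fp)/cover.
  have p0 i : i \in vs -> i != s -> p.2 i = 0.
    by move=> iv ni; exact/eqP/(allP fp)/cover.
  move: Kp; rewrite /wdeg (bigD1_seq s)//= big1_seq; last first.
    by move=> i /andP[ni iv]; rewrite p0// mulr0.
  by rewrite addr0 => /esym/eqP; rewrite mulf_eq0 (negbTE ws) => /eqP.
have h1 := h u Tu; have h2 := h v Tv; rewrite E// in h1; rewrite E// in h2.
set P := \sum_(p <- _) _ in h1 h2.
rewrite (_ : _ - _ = (mean r js F u - P) - (mean r js F v - P)); last by ring.
rewrite (le_trans (ler_normB _ _))// -mulrA mulr_natl mulr2n mulrDr rmorphD.
by rewrite lerD.
Qed.

(* By homogeneity, the mean of [F] over the variables before [s] is constant in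
   the only remaining variable, [u_s]. *)
Lemma ct_split w s F G : s \in vs -> w s != 0 -> lau_deg false w 0 F ->
  lauT G -> indep [seq j <- vs | s < j]%N F -> indep [seq j <- vs | j < s]%N G ->
  ct (fun u => F u * G u) = ct F * ct G.
Proof.
move=> sv ws lF lG; set Rr := [seq j <- vs | _]; set L := [seq j <- vs | _] => iF iG.
have subR : {subset Rr <= vs} by move=> j; rewrite mem_filter => /andP[].
have subL : {subset L <= vs} by move=> j; rewrite mem_filter => /andP[].
have subs : {subset [:: s] <= vs} by move=> j; rewrite inE => /eqP ->.
have lF' := lau_degT lF.
(* The variables after [s] are averaged innermost, then those before [s], and [u_s] last. *)
have vsE f : lauT f -> ct f = mean r [:: s] (mean r L (mean r Rr f)) torus_pt.
  move=> lf; rewrite -!mean_cat; apply: (mean_eq_mem vs_uniq r_gt0 _ _ torus_ptP lf) => //.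
  move=> j; rewrite !mem_cat inE !mem_filter.
  by case: ltngtP => [js|js|->]; rewrite ?sv ?orbF ?andbF//=.
have mLF : exists c, forall u, torus u -> mean r L F u = c.
  exists (mean r L F torus_pt) => u Tu.
  have E v : torus v -> mean r (L ++ Rr) F v = mean r L F v.
    move=> Tv; rewrite mean_cat; apply: (eq_mean r_gt0 subL Tv) => v' Tv'.
    exact: (mean_indep vs_uniq r_gt0 subR Tv' iF).
  rewrite -!E//; last exact: torus_ptP.
  apply: (mean_homog_const _ sv ws _ lF) => //; last exact: torus_ptP.
    by move=> j; rewrite mem_cat => /orP[/subL|/subR].
  move=> j jv js; rewrite mem_cat !mem_filter jv !andbT.
  by rewrite -neq_ltn.
have [c hc] := mLF.
set H := mean r Rr G.
have lH : lauT H by apply: (lau_mean vs_uniq r_gt0 subR lG).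
have lFG : lauT (fun u => F u * G u) by exact: (lauM r_gt0 lF' lG).
have step1 u : torus u -> mean r Rr (fun u => F u * G u) u = F u * H u.
  by move=> Tu; exact: (mean_indepM vs_uniq r_gt0 subR Tu iF lG).
have step2 u : torus u -> mean r L (fun u => F u * H u) u = c * H u.
  move=> Tu; rewrite -(hc u Tu) mulrC.
  rewrite -(mean_indepM vs_uniq r_gt0 subL Tu (indep_mean subR iG) lF').
  by apply: (eq_mean r_gt0 subL Tu) => v _; rewrite mulrC.
have -> : ct F = c.
  rewrite vsE// -[RHS](mean_cst r_gt0 c subs torus_ptP).
  apply: (eq_mean r_gt0 subs torus_ptP) => u Tu; rewrite -(hc u Tu).
  apply: (eq_mean r_gt0 subL Tu) => v Tv.
  exact: (mean_indep vs_uniq r_gt0 subR Tv iF).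
rewrite !vsE// -(meanZ vs_uniq r_gt0 c subs torus_ptP); last first.
  by apply: (lau_mean vs_uniq r_gt0 subL).
apply: (eq_mean r_gt0 subs torus_ptP) => u Tu.
rewrite (eq_mean r_gt0 subL Tu step1) step2//; congr (_ * _).
apply/esym/(mean_indep vs_uniq r_gt0 subL Tu); exact: indep_mean subR iG.
Qed.

End ConstantTerm.

(** * The constant term of a product of poles *)

Section Poles.
Variable R : realType.
Local Notation C := R[i].
Variables (vs : seq nat) (r : nat -> R) (b : nat -> C).
Hypotheses (vs_uniq : uniq vs) (r_gt0 : forall j, j \in vs -> 0 < r j).
Implicit Types (u v : nat -> C) (f g F G : (nat -> C) -> C) (w : nat -> int).
Local Notation torus := (torus vs r b).
Local Notation lauT := (lau vs r b xpredT).
Local Notation lau_deg := (lau_deg vs r b).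
Local Notation eff := (eff vs).
Local Notation admissible := (admissible vs r b).
Local Notation ct := (ct vs r b).

Let lvar x w j : lau_deg x w (eff w j) (fun u => u j).
Proof. exact: lau_deg_var. Qed.

Let linv x w j : j \in vs -> lau_deg x w (- w j) (fun u => (u j)^-1).
Proof. exact: lau_deg_inv. Qed.

Definition pole j u : C := u j / fd j u.

Definition wt_at i : nat -> int := fun j => (j == i)%:Z.

Lemma eff_wt_at_ge0 i j : 0 <= eff (wt_at i) j.
Proof. by rewrite /eff; case: ifP. Qed.

Lemma lau_deg_pole_at i j : admissible j -> j != i ->
  lau_deg true (wt_at i) 0 (pole j).
Proof.
move=> aj ji; apply: (lau_deg_pole vs_uniq r_gt0 aj);
  by rewrite /= {1}/wt_at (negbTE ji) eff_wt_at_ge0.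
Qed.

Lemma lauT_pole j : admissible j -> lauT (pole j).
Proof.
move=> aj; have h : lau_deg false (fun=> 0) 0 (pole j).
  by apply: (lau_deg_pole vs_uniq r_gt0 aj); rewrite /= /eff if_same.
exact: lau_degT h.
Qed.

Lemma lauT_prod (s : seq nat) (P : pred nat) (F : nat -> (nat -> C) -> C) :
  (forall i, i \in s -> P i -> lauT (F i)) ->
  lauT (fun u => \prod_(i <- s | P i) F i u).
Proof.
move=> h; have l0 f : lauT f -> lau_deg true (fun=> 0) 0 f.
  by apply: lau_sub => m _; rewrite /= /wdeg big1// => j _; rewrite mul0r.
have : lau_deg true (fun=> 0) (\sum_(i <- s | P i) 0)
    (fun u => \prod_(i <- s | P i) F i u).
  by apply: (lau_deg_prod r_gt0) => i si Pi; apply: l0; exact: h.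
exact: lau_degT.
Qed.

Lemma lau_deg_prod0 x w (s : seq nat) (P : pred nat) (F : nat -> (nat -> C) -> C) :
  (forall i, i \in s -> P i -> lau_deg x w 0 (F i)) ->
  lau_deg x w 0 (fun u => \prod_(i <- s | P i) F i u).
Proof.
by move=> h; have := lau_deg_prod r_gt0 h; rewrite big1.
Qed.

Lemma lauTM f g : lauT f -> lauT g -> lauT (fun u => f u * g u).
Proof. by move=> lf lg; exact: (lauM r_gt0 lf lg). Qed.

Lemma lauT_var j : lauT (fun u => u j).
Proof. exact: lau_degT (lvar false (fun=> 0) j). Qed.

Lemma lauT_inv j : j \in vs -> lauT (fun u => (u j)^-1).
Proof. by move=> jv; exact: lau_degT (linv false (fun=> 0) jv). Qed.

Lemma lauT_fd j : lauT (fd j).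
Proof.
rewrite /fd; have l := lauT_var.
apply: (@eq_lau _ _ _ _ _ (fun u => 2 * u j + (-1 * u j.-1 + -1 * u j.+1))).
  by move=> u _; rewrite !mulN1r addrA.
by apply: lauD; [exact: lauZ|apply: lauD; exact: lauZ].
Qed.

(** Discrete interpolation: up to second differences, [u_(a+n)] lies on the line through [u_a] and
    [u_(a+n+1)]. *)
Lemma sum_fd a n u : \sum_(1 <= i < n.+1) i%:R * fd (a + i) u =
  n.+1%:R * u (a + n)%N - u a - n%:R * u (a + n).+1.
Proof.
elim: n => [|n IH]; first by rewrite big_geq// addn0 mul1r mul0r !subrr.
rewrite big_nat_recr//= IH /fd !addnS /= -!natr1; ring.
Qed.

(** By [sum_fd], [(n+1-a) u_n] is [(n-a) fd n], which removes the last pole, plus terms that lose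
    their constant term once multiplied by the poles over [u_n]. Iterated, a run of [m] consecutive
    poles contributes [1/(m+1)]. *)
Lemma ct_pole_peel (P : pred nat) a n : (a < n)%N ->
  (forall j, (a < j <= n)%N -> P j) -> (0 < a -> ~~ P a)%N ->
  (forall j, (1 <= j <= n)%N -> P j -> admissible j) ->
  (n.+1 - a)%:R * ct (fun u => \prod_(1 <= j < n.+1 | P j) pole j u) =
  (n - a)%:R * ct (fun u => \prod_(1 <= j < n | P j) pole j u).
Proof.
move=> an Pan Pa adm.
have n0 : (0 < n)%N by case: n an {Pan adm}.
have Pn : P n by apply: Pan; rewrite an leqnn.
have adn : admissible n by apply: adm => //; rewrite n0 leqnn.
have [nv _ _] := adn.
have lP m : (m <= n.+1)%N -> lauT (fun u => \prod_(1 <= j < m | P j) pole j u).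
  move=> mn; apply: lauT_prod => i; rewrite mem_index_iota => /andP[i1 im] Pi.
  by apply/lauT_pole/adm => //; rewrite i1 -ltnS (leq_trans im).
pose D u := \sum_(1 <= i < (n - a)%N) i%:R *
    (fd (a + i) u * (u n)^-1 * \prod_(1 <= j < n.+1 | P j) pole j u)
  + (u a + (n - a)%:R * u n.+1) * (u n)^-1 * \prod_(1 <= j < n.+1 | P j) pole j u.
have key u : torus u ->
    (n.+1 - a)%:R * (\prod_(1 <= j < n.+1 | P j) pole j u) =
    (n - a)%:R * (\prod_(1 <= j < n | P j) pole j u) + D u.
  move=> Tu; have un : u n != 0 by exact: torus_neq0 Tu nv.
  have fn : fd n u != 0 by exact: fd_neq0 adn Tu.
  set X := \prod_(1 <= j < n.+1 | P j) pole j u.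
  have XE : \prod_(1 <= j < n | P j) pole j u = X * (fd n u / u n).
    rewrite /X [in RHS]big_mkcond big_nat_recr//= Pn -big_mkcond /= /pole.
    by field; rewrite fn un.
  have := sum_fd a (n - a) u; rewrite subnKC ?(ltnW an)//.
  rewrite big_nat_recr ?subn_gt0//= subnKC ?(ltnW an)// -subSn ?(ltnW an)// => h.
  have un2 : (n.+1 - a)%:R * u n = \sum_(1 <= i < n - a) i%:R * fd (a + i) u +
     (n - a)%:R * fd n u + u a + (n - a)%:R * u n.+1.
    by rewrite h; ring.
  rewrite XE /D -/X.
  have -> : \sum_(1 <= i < n - a) i%:R * (fd (a + i) u / u n * X) =
     (\sum_(1 <= i < n - a) i%:R * fd (a + i) u) * (u n)^-1 * X.
    by rewrite -mulrA mulr_suml; apply: eq_bigr => i _; rewrite -!mulrA.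
  apply: (mulIf un); rewrite [LHS]mulrAC un2; by field.
(* The second difference cancels the pole at [a + i] and leaves a bare factor [u_(a+i)]; no other
   factor has negative powers of this variable. *)
have vterm i : (1 <= i < n - a)%N ->
    lau_deg true (wt_at (a + i)) 1 (fun u => fd (a + i) u * (u n)^-1 *
      \prod_(1 <= j < n.+1 | P j) pole j u).
  move=> /andP[i1 ina]; set k := (a + i)%N.
  have kn : (k < n)%N by rewrite /k -ltn_subRL.
  have Pk : P k by apply: Pan; rewrite (ltnW kn) andbT /k -[X in (X < _)%N]addn0 ltn_add2l.
  have adk : admissible k.
    by apply: adm => //; rewrite (ltnW kn) andbT /k addn_gt0 i1 orbT.
  have [kv _ _] := adk.
  apply: (@lau_deg_eq _ _ _ _ _ _ _ (fun u => u k * ((u n)^-1 *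
      \prod_(1 <= j < n.+1 | (j != k) && P j) pole j u))).
    move=> u Tu; have fk : fd k u != 0 by exact: fd_neq0 adk Tu.
    rewrite [in RHS]big_mkcond (bigD1_seq k) ?iota_uniq//=; last first.
      by rewrite mem_index_iota ltnS (ltnW kn) /k addn_gt0 i1 orbT.
    rewrite Pk -big_mkcondr /=.
    have un : u n != 0 by exact: torus_neq0 Tu nv.
    by rewrite /pole; field; rewrite fk un.
  rewrite -[1]addr0; apply: (lau_degM r_gt0).
    by have := lvar true (wt_at k) k; rewrite /eff kv /wt_at eqxx.
  rewrite -[0]addr0; apply: (lau_degM r_gt0).
    have := linv true (wt_at k) nv.
    by rewrite /wt_at gtn_eqF// oppr0.
  apply: lau_deg_prod0 => j; rewrite mem_index_iota => /andP[j1 jn] /andP[jk Pj].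
  by apply: lau_deg_pole_at => //; apply: adm => //; rewrite j1.
have vlast : ct (fun u => (u a + (n - a)%:R * u n.+1) * (u n)^-1 *
     \prod_(1 <= j < n.+1 | P j) pole j u) = 0.
  (* With weight -1 on the run [(a, n]] and 0 elsewhere, [1 / u_n] gains 1. The poles of the run
     keep weight 0 because -1 is the minimum, and the earlier ones because [a] itself is not a pole,
     so their neighbours stay outside the run. *)
  pose w j : int := if (a < j <= n)%N then -1 else 0.
  have effw j : eff w j = if (j \in vs) && (a < j <= n)%N then -1 else 0.
    by rewrite /eff /w; case: (j \in vs).
  have eff0 j : ~~ (a < j <= n)%N -> eff w j = 0.
    by rewrite effw => /negbTE ->; rewrite andbF.
  have effN1 j : -1 <= eff w j by rewrite effw; case: ifP.
  apply: (@ct_vanish _ _ _ _ vs_uniq r_gt0 w).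
  rewrite -[1]addr0 -[1]add0r; apply: (lau_degM r_gt0).
    apply: (lau_degM r_gt0); last first.
      have := linv true w nv.
      by rewrite /w an leqnn /= opprK.
    apply: lau_degD.
      by have := lvar true w a; rewrite eff0// ltnn.
    apply: lau_degZ.
    by have := lvar true w n.+1; rewrite eff0// ltnn andbF.
  apply: lau_deg_prod0 => j; rewrite mem_index_iota => /andP[j1 jn] Pj.
  have adj : admissible j by apply: adm => //; rewrite j1.
  have nle k : (k <= a)%N -> eff w k = 0 by move=> ka; rewrite eff0// negb_and -leqNgt ka.
  rewrite ltnS in jn; apply: (lau_deg_pole vs_uniq r_gt0 adj) => /=;
    rewrite {1}/w jn andbT; case: ltnP => // ja; rewrite nle//.
    exact: leq_trans (leq_pred j) ja.
  rewrite ltn_neqAle ja andbT; apply: contraL Pj => /eqP ->.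
  by apply: Pa; rewrite (leq_trans j1).
have lt i : lauT (fun u => fd (a + i) u * (u n)^-1 *
      \prod_(1 <= j < n.+1 | P j) pole j u).
  by apply: lauTM; [apply: lauTM; [exact: lauT_fd|exact: lauT_inv]|exact: lP].
pose D1 u := \sum_(1 <= i < (n - a)%N) i%:R *
    (fd (a + i) u * (u n)^-1 * \prod_(1 <= j < n.+1 | P j) pole j u).
have lD1 : lauT D1.
  have h i : true -> lau_deg false (fun=> 0) 0 (fun u => i%:R * (fd (a + i) u * (u n)^-1 *
      \prod_(1 <= j < n.+1 | P j) pole j u)).
    move=> _; apply: lauZ; apply: lau_sub (lt i) => m _.
    by rewrite /= /wdeg big1// => j _; rewrite mul0r.
  exact: lau_degT (lau_deg_sum _ h).
have lX := lP n.+1 (leqnn _); have lX' := lP n (leqnSn _).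
have lD2 : lauT (fun u => (u a + (n - a)%:R * u n.+1) * (u n)^-1 *
     \prod_(1 <= j < n.+1 | P j) pole j u).
  apply: lauTM => //; apply: lauTM; last exact: lauT_inv.
  by apply: lauD; [exact: lauT_var|apply: lauZ; exact: lauT_var].
rewrite -!(ctZ vs_uniq r_gt0)// (eq_ct r_gt0 key) (ctD vs_uniq r_gt0)//.
- rewrite [X in _ + X = _](_ : _ = 0) ?addr0//.
  rewrite (ctD vs_uniq r_gt0 lD1 lD2) vlast addr0 (ct_sum vs_uniq r_gt0).
    rewrite big_nat_cond big1// => i /andP[hi _].
    by rewrite (ctZ vs_uniq r_gt0)// (ct_vanish vs_uniq r_gt0 (vterm i hi)) mulr0.
  by move=> i _; exact: lauZ.
- exact: lauZ.
- exact: lauD lD1 lD2.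
Qed.

(** The default 0 stands for the left end of the chain, which always counts as a breakpoint. *)
Fixpoint last_break (P : pred nat) n : nat :=
  if n is n'.+1 then if P n'.+1 then n'.+1 else last_break P n' else 0.

Lemma last_break_le P n : (last_break P n <= n)%N.
Proof. by elim: n => //= n IH; case: ifP => // _; exact: leqW. Qed.

Lemma last_breakP P n : (0 < last_break P n)%N -> P (last_break P n).
Proof. by elim: n => //= n IH; case: ifP. Qed.

Lemma last_break_gap P n j : (last_break P n < j <= n)%N -> ~~ P j.
Proof.
elim: n => [|n IH] /=; first by case: j.
case: ifP => [_|nP]; first by rewrite ltnNge => /andP[/negbTE ->].
move=> /andP[h1]; rewrite leq_eqVlt => /predU1P[->|]; first by rewrite nP.
by rewrite ltnS => h2; apply: IH; rewrite h1.
Qed.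

(** With 0 and [n] counted as breakpoints, this multiplies the lengths of the blocks; a block of
    length [m] holds [m - 1] poles and contributes [1/m] to the constant term. *)
Definition gaps (P : pred nat) n : nat :=
  ((\prod_(1 <= s < n | P s) (s - last_break P s.-1)) * (n - last_break P n.-1))%N.

Lemma ct_poles (P : pred nat) n : (0 < n)%N ->
  (forall j, (1 <= j < n)%N -> ~~ P j -> admissible j) ->
  ct (fun u => \prod_(1 <= j < n | ~~ P j) pole j u) * (gaps P n)%:R = 1.
Proof.
elim: n => // -[_ _ _|n IH _ adm].
  rewrite /gaps big_geq// mul1n mulr1 -[RHS](ct_cst b r_gt0 1).
  by apply: (eq_ct r_gt0) => u _; rewrite big_geq.
have adm' j : (1 <= j < n.+1)%N -> ~~ P j -> admissible j.
  by move=> /andP[j1 jn]; apply: adm; rewrite j1 ltnW.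
have {IH} := IH isT adm'; rewrite /gaps /=.
case Pn : (P n.+1) => /=.
  move=> h; rewrite -[RHS]h big_mkcond big_nat_recr//= Pn -big_mkcond /=.
  rewrite subSnn muln1; congr (_ * _).
  by apply: (eq_ct r_gt0) => u _; rewrite big_mkcond big_nat_recr//= Pn mulr1 -big_mkcond.
set a := last_break P n => h.
have lea : (a <= n)%N := last_break_le P n.
rewrite big_mkcond big_nat_recr//= Pn muln1 -big_mkcond /=.
have peel := @ct_pole_peel (fun j => ~~ P j) a n.+1 lea.
rewrite -[RHS]h !natrM mulrCA [_ * (n.+2 - a)%:R]mulrC peel.
- by ring.
- move=> j /andP[aj]; rewrite leq_eqVlt => /predU1P[->|]; first by rewrite Pn.
  by rewrite ltnS => jn; apply: (@last_break_gap P n); rewrite aj.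
- by move=> a0; rewrite negbK; exact: last_breakP.
- by move=> j /andP[j1 jn]; apply: adm; rewrite j1 ltnS.
Qed.
End Poles.

(** * Replacing factors modulo terms of positive weight *)

Section Replace.
Variable R : realType.
Local Notation C := R[i].
Variables (vs : seq nat) (r : nat -> R) (b : nat -> C).
Hypotheses (vs_uniq : uniq vs) (r_gt0 : forall j, j \in vs -> 0 < r j).
Local Notation lau_deg := (lau_deg vs r b).
Local Notation ct := (ct vs r b).

(* The factors of a product are replaced one at a time, the difference having
   positive weight for a suitable weight function. *)
Lemma ct_replace (s : seq nat) (w : nat -> nat -> int)
    (A B : nat -> (nat -> C) -> C) (Q : (nat -> C) -> C) : uniq s ->
  (forall i, i \in s -> lau_deg true (w i) 0 Q) ->
  (forall i, i \in s -> lau_deg true (w i) 1 (fun u => A i u - B i u)) ->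
  (forall i j, i \in s -> j \in s -> i != j -> lau_deg true (w i) 0 (A j)) ->
  (forall i j, i \in s -> j \in s -> i != j -> lau_deg true (w i) 0 (B j)) ->
  (forall i, i \in s -> lau vs r b xpredT (A i) /\ lau vs r b xpredT (B i)) ->
  lau vs r b xpredT Q ->
  ct (fun u => Q u * \prod_(i <- s) A i u) = ct (fun u => Q u * \prod_(i <- s) B i u).
Proof.
elim: s Q => [|k s IH] Q /=; first by move=> *; apply: (eq_ct r_gt0) => u _; rewrite !big_nil.
move=> /andP[ks us] hQ hAB hA hB hT lQ.
have ins i : i \in s -> i \in k :: s by rewrite inE => ->; rewrite orbT.
have kk : k \in k :: s by rewrite mem_head.
have nki i : i \in s -> k != i by apply: contraTneq => <-.
have [lAk lBk] := hT k kk.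
have lP : lau vs r b xpredT (fun u => \prod_(i <- s) A i u).
  by apply: (lauT_prod r_gt0) => i /ins/hT[].
transitivity (ct (fun u => (Q u * B k u) * \prod_(i <- s) A i u)).
  apply: (@ct_mod _ _ _ _ vs_uniq r_gt0 (w k)).
  - apply: (@eq_lau _ _ _ _ _ (fun u => Q u * (A k u * \prod_(i <- s) A i u))).
      by move=> u _; rewrite big_cons.
    by apply: (lauTM r_gt0) => //; exact: (lauTM r_gt0).
  - by apply: (lauTM r_gt0) => //; exact: (lauTM r_gt0).
  apply: (@lau_deg_eq _ _ _ _ _ _ _ (fun u => (Q u * \prod_(i <- s) A i u) * (A k u - B k u))).
    by move=> u _; rewrite big_cons; ring.
  rewrite -[1]add0r; apply: (lau_degM r_gt0); last exact: hAB.
  rewrite -[0]addr0; apply: (lau_degM r_gt0); first exact: hQ.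
  by apply: (lau_deg_prod0 r_gt0) => i si _; apply: hA => //; [exact: ins|exact: nki].
rewrite IH//.
- by apply: (eq_ct r_gt0) => u _; rewrite big_cons mulrA.
- move=> i si; rewrite -[0]addr0; apply: (lau_degM r_gt0); first exact/hQ/ins.
  by apply: hB => //; [exact: ins|rewrite eq_sym nki].
- by move=> i /ins/hAB.
- by move=> i j /ins hi /ins hj; exact: hA.
- by move=> i j /ins hi /ins hj; exact: hB.
- by move=> i /ins/hT.
- exact: (lauTM r_gt0).
Qed.

Lemma lau_deg_zero x w c : lau_deg x w c (fun=> 0).
Proof.
apply: (@lau_deg_eq _ _ _ _ _ _ _ (laurent vs [::])).
  by move=> u _; rewrite /laurent big_nil.
exact: lau_laurent.
Qed.

End Replace.

(** * The contour integral attached to one monomial *)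

Section PolyContour.
Variable R : realType.
Local Notation C := R[i].
Variables (d : nat) (z : nat -> C) (r : nat -> R).
Hypotheses (d_gt0 : (0 < d)%N) (adm : admissible_radii d z r).
Local Notation vs := (iota 1 d.-1).
Local Notation torus := (torus vs r z).
Local Notation lau_deg := (lau_deg vs r z).
Local Notation ct := (ct vs r z).
Implicit Types (u : nat -> C) (e : nat -> nat).

Lemma mem_vs j : (j \in vs) = (0 < j < d)%N.
Proof. by rewrite mem_iota add1n prednK. Qed.

Lemma vs_uniq : uniq vs. Proof. exact: iota_uniq. Qed.

Lemma adm_gt0 j : j \in vs -> 0 < r j.
Proof.
rewrite mem_vs; have [_ _ h] := adm => /h[zr _].
by move: (le_lt_trans (normr_ge0 _) zr); rewrite -[0]/(0%:C%C) ltcR.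
Qed.

Lemma adm_admissible j : (0 < j < d)%N -> admissible vs r z j.
Proof.
move=> hj; have [h0 hd h] := adm; have [zr rr] := h j hj.
have bd i u : (i <= d)%N -> torus u -> `|u i| <= (r i)%:C%C.
  move=> id /(_ i); rewrite mem_vs; case: ltnP => /= [i0|]; last first.
    by rewrite leqn0 => /eqP -> ->; rewrite h0.
  by case: ltngtP id => // [_ _ ->//|-> _ ->]; rewrite hd.
split; rewrite ?mem_vs// => u Tu; move/andP: hj => [j0 jd].
split; last exact: bd jd Tu.
by apply: (bd j.-1 u _ Tu); exact: leq_trans (leq_pred j) (ltnW jd).
Qed.

Definition simple_pole j u : C := u j / (u j - z j).

(** Against the simple pole, [u_j ^+ e j] may be replaced by its value at [z j], the difference
    being divisible by [u_j - z_j]. The simple poles may then be dropped, since they differ from 1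
    by negative powers only, and [ct_poles] evaluates what is left. *)
Lemma ct_monomial_contour e :
  ct (fun u => \prod_(1 <= j < d)
     ((if (0 < e j)%N then u j ^+ e j else pole j u) * simple_pole j u))
  * (gaps (fun j => 0 < e j)%N d)%:R = \prod_(1 <= j < d) z j ^+ e j.
Proof.
have vu := vs_uniq; have r0 := adm_gt0.
have vsE : index_iota 1 d = vs by rewrite /index_iota subn1.
have zr j : j \in vs -> `|z j| < (r j)%:C%C.
  by rewrite mem_vs; have [_ _ h] := adm => /h[].
have vadm j : j \in vs -> admissible vs r z j.
  by rewrite mem_vs; exact: adm_admissible.
have lvar x w j : lau_deg x w (eff vs w j) (fun u => u j) by exact: lau_deg_var.
have linv x w j : j \in vs -> lau_deg x w (- w j) (fun u => (u j)^-1).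
  exact: lau_deg_inv.
pose X j u : C := if (0 < e j)%N then z j ^+ e j else pole j u.
have lV x w j : j \in vs -> rel_deg x (w j) 0 -> lau_deg x w 0 (simple_pole j).
  by move=> jv wj; exact: (lau_deg_simple_pole _ vu r0 jv (zr j jv) wj).
have lVT j : j \in vs -> lau vs r z xpredT (simple_pole j).
  by move=> jv; apply: lau_degT (lV false (fun=> 0) j jv _).
have lu x w j n : lau_deg x w (eff vs w j *+ n) (fun u => u j ^+ n).
  by apply: (lau_degX r0); exact: lau_deg_var.
have luT j n : lau vs r z xpredT (fun u => u j ^+ n) by exact: lau_degT (lu false (fun=> 0) j n).
have step1 : ct (fun u => \prod_(1 <= j < d)
     ((if (0 < e j)%N then u j ^+ e j else pole j u) * simple_pole j u)) =
   ct (fun u => 1 * \prod_(j <- vs) (X j u * simple_pole j u)).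
  rewrite vsE.
  transitivity (ct (fun u => 1 * \prod_(j <- vs)
     ((if (0 < e j)%N then u j ^+ e j else pole j u) * simple_pole j u))).
    by apply: (eq_ct r0) => u _; rewrite mul1r.
  apply: (@ct_replace _ _ _ _ vu r0 vs wt_at
    (fun j u => (if (0 < e j)%N then u j ^+ e j else pole j u) * simple_pole j u)
    (fun j u => X j u * simple_pole j u) (fun=> 1)) => //.
  - by move=> i _; exact: lau_deg_cst.
  - move=> i iv; rewrite /X; case: (posnP (e i)) => ei.
      by apply: (lau_deg_eq _ (lau_deg_zero _ _ _ _ _ _)) => u _; rewrite subrr.
    (* The divided difference is a polynomial in [u_i], and the numerator of the simple pole
       supplies one further factor [u_i]. *)
    apply: (@lau_deg_eq _ _ _ _ _ _ _ (fun u => u i * \sum_(l < e i)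
       (z i ^+ l * u i ^+ ((e i).-1 - l)))).
      move=> u Tu; have uz : u i - z i != 0.
        rewrite subr_eq0; apply: contraTneq (zr i iv) => <-.
        by have := Tu i; rewrite iv => ->; rewrite ltxx.
      rewrite -mulrBl /simple_pole subrXX.
      under [in RHS]eq_bigr do rewrite mulrC.
      by field.
    rewrite -[1]addr0; apply: (lau_degM r0).
      by have := lvar true (wt_at i) i; rewrite /eff iv /wt_at eqxx; apply.
    apply: lau_deg_sum => l _; apply: lau_degZ.
    apply: (@lau_deg_weak _ _ _ _ _ _ _ _ _ _ (lu true (wt_at i) i _)).
    by rewrite /= mulrn_wge0// eff_wt_at_ge0.
  - move=> i j iv jv ij; rewrite -[0]addr0; apply: (lau_degM r0).
      case: (0 < e j)%N; last by apply: (lau_deg_pole_at vu r0 (vadm j jv)); rewrite eq_sym.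
      apply: (@lau_deg_weak _ _ _ _ _ _ _ _ _ _ (lu true (wt_at i) j _)).
      by rewrite /= mulrn_wge0// eff_wt_at_ge0.
    by apply: lV => //=; rewrite /wt_at eq_sym (negbTE ij).
  - move=> i j iv jv ij; rewrite -[0]addr0 /X; apply: (lau_degM r0).
      case: (0 < e j)%N; last by apply: (lau_deg_pole_at vu r0 (vadm j jv)); rewrite eq_sym.
      exact: lau_deg_cst.
    by apply: lV => //=; rewrite /wt_at eq_sym (negbTE ij).
  - move=> i iv; rewrite /X; case: (0 < e i)%N => /=; split;
      (apply: (lauTM r0); last exact: lVT);
      first [exact: luT|exact: lau_cst|apply: lauT_pole => //; exact: vadm].
  - exact: lau_cst.
have step2 : ct (fun u => 1 * \prod_(j <- vs) (X j u * simple_pole j u)) =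
    ct (fun u => 1 * \prod_(j <- vs) X j u).
  have lX i : i \in vs -> lau_deg true (fun=> -1) 0 (X i).
    move=> iv; rewrite /X; case: (0 < e i)%N; first exact: lau_deg_cst.
    by apply: (lau_deg_pole vu r0 (vadm i iv)); rewrite /= /eff; case: ifP.
  have lXT i : i \in vs -> lau vs r z xpredT (X i) by move=> /lX; exact: lau_degT.
  apply: (@ct_replace _ _ _ _ vu r0 vs (fun _ _ => -1)
     (fun j u => X j u * simple_pole j u) X (fun=> 1)) => //.
  - by move=> i _; exact: lau_deg_cst.
  - move=> i iv.
    apply: (@lau_deg_eq _ _ _ _ _ _ _ (fun u => X i u * (z i * (u i)^-1 * simple_pole i u))).
      move=> u Tu; have uz : u i - z i != 0.
        rewrite subr_eq0; apply: contraTneq (zr i iv) => <-.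
        by have := Tu i; rewrite iv => ->; rewrite ltxx.
      have ui : u i != 0 by apply: torus_neq0 Tu iv.
      by rewrite /simple_pole; field; rewrite uz ui.
    rewrite -[1]add0r; apply: (lau_degM r0); first exact: lX.
    rewrite -[1]addr0; apply: (lau_degM r0); last exact: lV.
    by apply: lau_degZ; have := linv true (fun=> -1) i iv; rewrite opprK; apply.
  - move=> i j iv jv ij; rewrite -[0]addr0; apply: (lau_degM r0); first exact: lX.
    exact: lV.
  - by move=> i j iv jv ij; exact: lX.
  - move=> i iv; split; last exact: lXT.
    by apply: (lauTM r0); [exact: lXT|exact: lVT].
  - exact: lau_cst.
rewrite step1 step2.
pose c := \prod_(j <- vs | (0 < e j)%N) z j ^+ e j.
have -> : ct (fun u => 1 * \prod_(j <- vs) X j u) =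
   ct (fun u => c * \prod_(1 <= j < d | ~~ (0 < e j)%N) pole j u).
  apply: (eq_ct r0) => u _; rewrite mul1r vsE (bigID (fun j => 0 < e j)%N) /=.
  congr (_ * _); apply: eq_bigr => j; rewrite /X; last by move/negbTE ->.
  by move=> ->.
rewrite (ctZ vu r0); last first.
  apply: (lauT_prod r0) => i; rewrite vsE => iv _; by apply: lauT_pole => //; exact: vadm.
rewrite -mulrA ct_poles ?mulr1//; last first.
  by move=> j hj _; apply: vadm; rewrite mem_vs.
rewrite /c vsE [RHS](bigID (fun j => 0 < e j)%N) /= [X in _ * X]big1 ?mulr1//.
by move=> j; rewrite lt0n negbK => /eqP ->.
Qed.
End PolyContour.

(** * From iterated contour integrals to means *)

Section IteratedIntegral.
Variable R : realType.
Local Notation C := R[i].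
Variables (vs : seq nat) (r : nat -> R) (b : nat -> C).
Hypotheses (vs_uniq : uniq vs) (r_gt0 : forall j, j \in vs -> 0 < r j).
Local Notation torus := (torus vs r b).
Local Notation lauT := (lau vs r b xpredT).
Implicit Types (u : nat -> C) (F : (nat -> C) -> C) (us : seq C).

Fixpoint upds u a us := if us is v :: us' then upds (upd u a v) a.+1 us' else u.

Lemma upds_out u a us j : (j < a)%N -> upds u a us j = u j.
Proof.
elim: us u a => //= v us IH u a ja; rewrite IH ?ltnS ?(ltnW ja)//.
by rewrite /upd ltn_eqF.
Qed.

Lemma upds_in u a us i : (i < size us)%N -> upds u a us (a + i) = us`_i.
Proof.
elim: us u a i => //= v us IH u a [|i] iu.
  by rewrite addn0 upds_out//= /upd eqxx.
by rewrite addnS -addSn IH.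
Qed.

Lemma upds_ge u a us j : (a + size us <= j)%N -> upds u a us j = u j.
Proof.
elim: us u a => //= v us IH u a; rewrite addnS -addSn => ja.
by rewrite IH// /upd gtn_eqF// (leq_trans _ ja)// ltnS leq_addr.
Qed.

Lemma eq_iter_circle_integral (rs : seq R) (f g : seq C -> C) :
  (forall us, size us = size rs -> f us = g us) ->
  iter_circle_integral rs f = iter_circle_integral rs g.
Proof.
elim: rs f g => [|r0 rs IH] f g fg /=; first exact: fg.
congr (circle_integral _ _); apply/funext => v.
by apply: IH => us hus; apply: fg; rewrite /= hus.
Qed.

(** On each circle [du = i u dt], which accounts for one factor [2 pi i] and one factor [u_j] per
    variable. *)
Lemma iter_circle_mean n a F u : {subset iota a n <= vs} -> lauT F -> torus u ->
  iter_circle_integral [seq r j | j <- iota a n] (fun us => F (upds u a us)) =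
  (2 * pi%:C%C * 'i%C) ^+ n *
  mean r (iota a n) (fun v => (\prod_(j <- iota a n) v j) * F v) u.
Proof.
move=> + lF; elim: n a u => [|n IH] a u sub Tu.
  by rewrite /= big_nil !mul1r.
have av : a \in vs by apply: sub; rewrite mem_head.
have sub' : {subset iota a.+1 n <= vs}.
  by move=> j hj; apply: sub; rewrite /= inE hj orbT.
have lvar j : lauT (fun v => v j) by exact: lauT_var.
set G := fun v => (\prod_(j <- iota a.+1 n) v j) * F v.
have lG : lauT G by apply: (lauTM r_gt0) => //; exact: (lauT_prod r_gt0).
pose H v := v a * mean r (iota a.+1 n) G v.
have lH : lauT H by apply: (lauTM r_gt0) => //; exact: (lau_mean vs_uniq r_gt0).
rewrite [LHS]/= /circle_integral exprSr -mulrA.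
set c := (2 * pi%:C%C * 'i%C) ^+ n.
transitivity (Cintegral `[0, 2 * pi] (fun t => (c * 'i%C) * H (upd u a (circle_point (r a) t)))).
  apply: eq_Cintegral => t _.
  rewrite (IH a.+1 (upd u a (circle_point (r a) t)) sub')//; last exact: torus_upd.
  rewrite -/c /H {2}/upd eqxx -!mulrA; congr (_ * _).
  by rewrite mulrC -mulrA.
rewrite CintegralZ; last exact: cunif_lau lH Tu av.
have -> : mean r (iota a n.+1) (fun v => (\prod_(j <- iota a n.+1) v j) * F v) u
    = circle_mean r a H u.
  rewrite /= /circle_mean; congr (_ * _); apply: eq_Cintegral => t _.
  have Tv : torus (upd u a (circle_point (r a) t)) by exact: torus_upd.
  rewrite /H -(mean_indepM (F := fun v => v a) vs_uniq r_gt0 sub' Tv _ lG); last first.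
    move=> x y _ _ xy; apply: xy; rewrite inE mem_iota ltnn//.
  apply: (eq_mean r_gt0 sub' Tv) => v _.
  by rewrite /= big_cons mulrA.
rewrite /circle_mean -!mulrA; congr (_ * _).
have p0 : pi%:C%C != 0 :> C by rewrite -(rmorph0 (real_complex R)) (inj_eq (@complexI _)) gt_eqF ?pi_gt0.
set I := Cintegral _ _.
have -> : ((2 * pi)^-1)%:C%C = (2 * pi%:C%C)^-1 :> C.
  by rewrite fmorphV rmorphM rmorph_nat.
by move: (pi%:C%C) I p0 => p I p0; field.
Qed.

End IteratedIntegral.

Section PolyValue.
Variable R : realType.
Local Notation C := R[i].
Variables (d : nat) (z : nat -> C) (r : nat -> R).
Hypotheses (d_gt0 : (0 < d)%N) (adm : admissible_radii d z r).
Local Notation vs := (iota 1 d.-1).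

(** The square [u_j^2] is shared between the two poles; the extra product of the [u_j] is the
    Jacobian of the parametrisation. *)
Lemma Poly_valueE : Poly_value d z r =
  d%:R * ct vs r z (fun u => (\prod_(1 <= j < d) u j) *
     \prod_(1 <= j < d) (pole j u * simple_pole z j u)).
Proof.
have vu := vs_uniq d; have r0 := adm_gt0 d_gt0 adm.
have vsE : index_iota 1 d = vs by rewrite /index_iota subn1.
pose F (v : nat -> C) := \prod_(1 <= j < d) (pole j v * simple_pole z j v).
have zr j : j \in vs -> `|z j| < (r j)%:C%C.
  by rewrite mem_vs//; have [_ _ h] := adm => /h[].
have vadm j : j \in vs -> admissible vs r z j.
  by rewrite mem_vs// => hj; exact: adm_admissible.
have lF : lau vs r z xpredT F.
  apply: (lauT_prod r0) => j; rewrite vsE => jv _.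
  apply: (lauTM r0); first by apply: lauT_pole => //; exact: vadm.
  apply: (@lau_degT _ _ _ _ false (fun=> 0) 0).
  exact: (lau_deg_simple_pole _ vu r0 jv (zr j jv)).
have T0 := torus_ptP z r0.
rewrite /Poly_value -mulrA; congr (_ * _).
rewrite (@eq_iter_circle_integral _ _ _ (fun us => F (upds (torus_pt vs r z) 1 us))).
  rewrite (iter_circle_mean vu r0 _ lF T0)// mulrA mulVf; last first.
    rewrite expf_neq0// !mulf_neq0//.
      by rewrite -(rmorph0 (real_complex R)) (inj_eq (@complexI _)) gt_eqF ?pi_gt0.
    by rewrite eq_complex /= oner_eq0 andbF.
  by rewrite mul1r /ct /F vsE.
move=> us; rewrite size_map size_iota => sus.
rewrite /Poly_integrand /F; apply: eq_big_nat => j hj.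
have E i : (i <= d)%N -> (z 0 :: rcons us (z d))`_i = upds (torus_pt vs r z) 1 us i.
  case: i => [_|i id] /=; first by rewrite upds_out// /torus_pt mem_vs.
  rewrite nth_rcons sus -add1n; case: ltngtP => [id1|id1|->].
  - by rewrite upds_in ?sus.
  - by move: id1 id; rewrite ltnNge -ltnS prednK// => /negbTE ->.
  - by rewrite upds_ge ?sus// /torus_pt add1n prednK// mem_vs// ltnn andbF.
have [j0 jd] := andP hj.
have jpd : (j.-1 <= d)%N := leq_trans (leq_pred j) (ltnW jd).
rewrite (E j.-1 jpd) (E j.+1 jd) (E j (ltnW jd)).
set v := upds _ _ _; rewrite /pole /simple_pole /fd !mulrA expr2.
by rewrite invfM !mulrA; ring.
Qed.

End PolyValue.

(** * Expansion in products of second differences *)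

Section Decomposition.
Variable R : realType.
Local Notation C := R[i].
Variable d : nat.
Hypothesis d_gt0 : (0 < d)%N.
Implicit Types (u : nat -> C) (e : nat -> nat) (f g : (nat -> C) -> C).

(** Multiplied by all the poles, [theta e] cancels exactly those at the breakpoints, the [j] with
    [e j > 0], and leaves [u_j ^+ e j] there. This is the integrand of [ct_monomial_contour]. *)
Definition theta e u : C := u 0 ^+ e 0%N * u d ^+ e d *
  \prod_(1 <= j < d) (if (0 < e j)%N then fd j u * u j ^+ (e j).-1 else 1).

Definition incr e i : nat -> nat := fun j => (e j + (j == i))%N.

Definition total e : nat := (\sum_(0 <= i < d.+1) e i)%N.

Lemma total_incr e i : (i <= d)%N -> total (incr e i) = (total e).+1.
Proof.
move=> id; rewrite /total /incr big_split /= -[RHS]addn1; congr addn.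
rewrite (bigD1_seq i) ?iota_uniq ?mem_index_iota//= eqxx big1 ?addn0//.
by move=> j /negbTE ->.
Qed.

Lemma theta_fd e i u : (0 < i < d)%N -> e i = 0%N ->
  fd i u * theta e u = theta (incr e i) u.
Proof.
move=> /andP[i0 id] ei; rewrite /theta /incr.
have i1 : (0 == i)%N = false by rewrite ltn_eqF.
have i2 : (d == i)%N = false by rewrite gtn_eqF.
rewrite i1 i2 !addn0 mulrCA; congr (_ * _).
rewrite (bigD1_seq i) ?iota_uniq ?mem_index_iota ?i0//= ei /= mul1r.
rewrite [RHS](bigD1_seq i) ?iota_uniq ?mem_index_iota ?i0//= ei eqxx /= mulr1.
by congr (_ * _); apply: eq_bigr => j /negbTE ->; rewrite addn0.
Qed.

Lemma theta_var e i u : (i <= d)%N -> [|| i == 0, i == d | 0 < e i]%N ->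
  u i * theta e u = theta (incr e i) u.
Proof.
move=> id; rewrite /theta /incr.
case: (eqVneq i 0%N) => [->|i0].
  have d0 : (d == 0)%N = false by rewrite gtn_eqF.
  move=> _; rewrite ?eqxx d0 /= addn0 addn1 exprS -!mulrA; congr (_ * (_ * (_ * _))).
  by apply: eq_big_nat => j /andP[j0 _]; rewrite (gtn_eqF j0) addn0.
case: (eqVneq i d) => [->|ind].
  move=> _; rewrite /= addn0 addn1 exprS [LHS]mulrA [u d * _]mulrCA.
  congr (_ * _).
  by apply: eq_big_nat => j /andP[_ jd]; rewrite (ltn_eqF jd) addn0.
move=> /= ei.
have hi : i \in index_iota 1 d by rewrite mem_index_iota lt0n i0 ltn_neqAle ind.
rewrite !addn0 mulrCA; congr (_ * _).
rewrite (bigD1_seq i) ?iota_uniq//= [RHS](bigD1_seq i) ?iota_uniq//= ei eqxx addn1 /=.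
rewrite mulrA mulrCA -exprS prednK//; congr (_ * _).
by apply: eq_bigr => j /negbTE ->; rewrite addn0.
Qed.

(** The coefficients are rational because those of [Poly] are; the degree is recorded because
    [phi_monomialE] needs exponents of sum [d - 1]. *)
Definition theta_span n f := exists2 l : seq (rat * (nat -> nat)),
  all (fun p => total p.2 == n) l &
  forall u, f u = \sum_(p <- l) ratr p.1 * theta p.2 u.

Lemma theta_span_eq n f g : (forall u, f u = g u) -> theta_span n f -> theta_span n g.
Proof. by move=> fg [l hl lf]; exists l => // u; rewrite -fg. Qed.

Lemma theta_spanD n f g : theta_span n f -> theta_span n g ->
  theta_span n (fun u => f u + g u).
Proof.
move=> [l hl lf] [l' hl' lg]; exists (l ++ l'); first by rewrite all_cat hl.
by move=> u; rewrite big_cat lf lg.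
Qed.

Lemma theta_span0 n : theta_span n (fun=> 0).
Proof. by exists [::] => // u; rewrite big_nil. Qed.

Lemma theta_spanZ n (c : rat) f : theta_span n f -> theta_span n (fun u => ratr c * f u).
Proof.
move=> [l hl lf]; exists [seq (c * p.1, p.2) | p <- l]; first by rewrite all_map.
move=> u; rewrite big_map lf mulr_sumr; apply: eq_bigr => p _ /=.
by rewrite rmorphM mulrA.
Qed.

Lemma theta_span_theta e : theta_span (total e) (theta e).
Proof.
exists [:: (1, e)]; first by rewrite /= eqxx.
by move=> u; rewrite big_seq1 rmorph1 mul1r.
Qed.

Lemma theta_span_sum n (I : eqType) (s : seq I) (F : I -> (nat -> C) -> C) :
  (forall i, i \in s -> theta_span n (F i)) ->
  theta_span n (fun u => \sum_(i <- s) F i u).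
Proof.
elim: s => [|i s IH] h.
  by apply: (theta_span_eq _ (theta_span0 n)) => u; rewrite big_nil.
apply: (@theta_span_eq _ (fun u => F i u + \sum_(j <- s) F j u)).
  by move=> u; rewrite big_cons.
apply: theta_spanD; first by apply: h; rewrite mem_head.
by apply: IH => j js; apply: h; rewrite inE js orbT.
Qed.

(* Away from a breakpoint [i], the variable [u_i] is an average of the preceding
   breakpoint, of [u_(i+1)] and of second differences. *)
Lemma theta_span_var e i : (i <= d)%N ->
  theta_span (total e).+1 (fun u => u i * theta e u).
Proof.
have hv j : (j <= d)%N -> [|| j == 0, j == d | 0 < e j]%N ->
    theta_span (total e).+1 (fun u => u j * theta e u).
  move=> jd hj; rewrite -(total_incr e jd).
  apply: (@theta_span_eq _ (theta (incr e j))); last exact: theta_span_theta.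
  by move=> u; rewrite theta_var.
(* Induction on the distance to the right end, since [u_i] is expressed through [u_(i+1)]. *)
move=> id; move: {2}(d - i)%N (erefl (d - i)%N) => k; elim: k i id => [|k IH] i id hk.
  apply: hv => //; suff -> : i = d by rewrite eqxx orbT.
  by apply/eqP; rewrite eqn_leq id -subn_eq0 hk.
have iltd : (i < d)%N by rewrite -subn_gt0 hk.
have [h|] := boolP [|| i == 0, i == d | 0 < e i]%N; first exact: hv.
rewrite !negb_or -leqNgt leqn0 => /and3P[i0 _ ei].
pose P j := (0 < e j)%N; pose a := last_break P i; pose m := (i - a)%N.
have ai : (a <= i)%N := last_break_le P i.
have am : (a + m)%N = i by rewrite subnKC.
have IHi : theta_span (total e).+1 (fun u => u i.+1 * theta e u).
  by apply: IH => //; rewrite subnS hk.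
have ha : theta_span (total e).+1 (fun u => u a * theta e u).
  apply: hv; first exact: leq_trans ai id.
  case: (posnP a) => [->//|a0]; have ea : (0 < e a)%N := last_breakP a0.
  by rewrite ea !orbT.
have hf j : (a < j <= i)%N -> theta_span (total e).+1 (fun u => fd j u * theta e u).
  move=> /andP[aj ji]; have jd := leq_ltn_trans ji iltd.
  have j0 : (0 < j)%N by apply: leq_ltn_trans aj.
  rewrite -(total_incr e (ltnW jd)).
  apply: (@theta_span_eq _ (theta (incr e j))); last exact: theta_span_theta.
  move=> u; rewrite theta_fd ?j0//; apply/eqP.
  by rewrite -leqn0 leqNgt; apply: (@last_break_gap P i); rewrite aj ji.
(* The coefficients come from [sum_fd] on the run [a + 1, ..., i], solved for [u_(a+m)], which is
   [u_i]. *)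
apply: (@theta_span_eq _ (fun u => ratr (m.+1%:R^-1) * (u a * theta e u +
    (ratr m%:R * (u i.+1 * theta e u) + \sum_(l <- index_iota 1 m.+1)
       ratr l%:R * (fd (a + l) u * theta e u))))).
  move=> u; rewrite fmorphV !rmorph_nat.
  have -> : \sum_(l <- index_iota 1 m.+1) ratr l%:R * (fd (a + l) u * theta e u) =
     (\sum_(1 <= l < m.+1) l%:R * fd (a + l) u) * theta e u.
    by rewrite mulr_suml; apply: eq_bigr => l _; rewrite mulrA rmorph_nat.
  rewrite sum_fd am; have m0 : m.+1%:R != 0 :> C by rewrite pnatr_eq0.
  by apply: (mulfI m0); rewrite mulVKf//; ring.
apply: theta_spanZ; apply: theta_spanD => //; apply: theta_spanD; first exact: theta_spanZ.
apply: theta_span_sum => l; rewrite mem_index_iota ltnS => /andP[l1 lm].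
apply: theta_spanZ; apply: hf.
by rewrite -am -[X in (X < _)%N]addn0 ltn_add2l l1 leq_add2l.
Qed.

Lemma theta_span_monomial (js : seq nat) : all (fun j => j <= d)%N js ->
  theta_span (size js) (fun u => \prod_(j <- js) u j).
Proof.
elim: js => [_|j js IH /= /andP[jd /IH[l hl lf]]].
  have t0 : total (fun=> 0%N) = 0%N by rewrite /total big1.
  rewrite /= -{1}t0; apply: (theta_span_eq _ (theta_span_theta _)) => u.
  by rewrite /theta /= !mul1r big1// big_nil.
apply: (@theta_span_eq _ (fun u => \sum_(p <- l) ratr p.1 * (u j * theta p.2 u))).
  move=> u; rewrite big_cons lf mulr_sumr; apply: eq_bigr => p _.
  by rewrite mulrCA.
elim: l hl {lf} => [_|p l IHl /= /andP[/eqP hp hl]].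
  by apply: (theta_span_eq _ (theta_span0 _)) => u; rewrite big_nil.
apply: (@theta_span_eq _ (fun u => ratr p.1 * (u j * theta p.2 u) +
    \sum_(q <- l) ratr q.1 * (u j * theta q.2 u))).
  by move=> u; rewrite big_cons.
apply: theta_spanD; last exact: IHl.
by apply: theta_spanZ; rewrite -hp; exact: theta_span_var.
Qed.

End Decomposition.

(** * Uniqueness and expansion of [Poly] *)

Section PolyDecomposition.
Variable R : realType.
Local Notation C := R[i].
Implicit Types (e : nat -> nat) (z : nat -> C).

Definition mnm_of d e : multinom d.+1 := Multinom [tuple e (val i) | i < d.+1].

Lemma mnm_ofE d e (i : 'I_d.+1) : mnm_of d e i = e i.
Proof. exact: mnmE. Qed.

(** A coefficient is recovered as a constant term on the unit torus, after division by its
    monomial. *)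
Lemma mmap_inj d (P Q : mpoly d.+1 rat) :
  (forall z, mmap (ratr : rat -> C) (fun i : 'I_d.+1 => z i) P =
             mmap (ratr : rat -> C) (fun i : 'I_d.+1 => z i) Q) -> P = Q.
Proof.
move=> PQ; apply/mpolyP => m0; apply/eqP; rewrite -subr_eq0 -mcoeffB; apply/eqP.
set S := P - Q; pose vs := iota 0 d.+1; pose r : nat -> R := fun=> 1.
have vu : uniq vs by exact: iota_uniq.
have r0 j : j \in vs -> 0 < r j by rewrite ltr01.
have S0 z : mmap (ratr : rat -> C) (fun i : 'I_d.+1 => z i) S = 0.
  by rewrite /S mmapB PQ subrr.
have [m0S|/memN_msupp_eq0//] := boolP (m0 \in msupp S).
pose ex (m : multinom d.+1) (j : nat) : int := (m (inord j))%:Z - (m0 (inord j))%:Z.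
have monoE m u : torus vs r (fun=> 0) u ->
    mono vs (fun j => - (m0 (inord j))%:Z) u * mmap1 (fun i : 'I_d.+1 => u i) m
    = mono vs (ex m) u.
  move=> Tu; rewrite /mono /mmap1.
  have -> : \prod_(i < d.+1) u i ^+ m i = \prod_(j <- vs) u j ^ ((m (inord j))%:Z).
    rewrite -[vs]/(index_iota 0 d.+1) big_mkord; apply: eq_bigr => i _.
    by rewrite inord_val.
  rewrite -big_split; apply: eq_big_seq => j jv /=; rewrite /ex addrC.
  by rewrite expfzDr//; exact: torus_neq0 Tu jv.
have lm m : lau vs r (fun=> 0) xpredT (mono vs (ex m)) by exact: lau_mono.
have ctm m : ct vs r (fun=> 0) (mono vs (ex m)) = (m == m0)%:R.
  have [->|mm] := eqVneq m m0.
    rewrite -[RHS](ct_cst (fun=> 0) r0); apply: (eq_ct r0) => u _.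
    by rewrite /mono big1// => j _; rewrite /ex subrr expr0z.
  have /existsP[i mi] : [exists i, m i != m0 i].
    rewrite -[X in is_true X]negbK negb_exists; apply: contra mm => /forallP h.
    by apply/eqP/mnmP => i; apply/eqP; rewrite -[_ == _]negbK h.
  apply: (@mean_vanish _ _ _ _ vu r0 (fun m' => m' (val i) != 0)) => //.
  - exact: torus_ptP.
  - by apply: lau_mono; rewrite /ex inord_val subr_eq0 eqz_nat.
  - move=> m' m'i; apply: contra m'i => /allP; apply.
    by rewrite mem_iota add0n ltn_ord.
have : ct vs r (fun=> 0) (fun u => \sum_(m <- msupp S)
    ratr (mcoeff m S) * mono vs (ex m) u) = 0.
  rewrite -[RHS](ct_cst (fun=> 0) r0); apply: (eq_ct r0) => u Tu.
  transitivity (mono vs (fun j => - (m0 (inord j))%:Z) u *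
    mmap (ratr : rat -> C) (fun i : 'I_d.+1 => u i) S); last by rewrite S0 mulr0.
  rewrite /mmap mulr_sumr; apply: eq_bigr => m _.
  by rewrite mulrCA monoE.
rewrite (ct_sum vu r0); last by move=> m _; exact: lauZ.
rewrite (bigD1_seq m0) ?msupp_uniq//= (ctZ vu r0)// ctm eqxx mulr1 big1.
  by rewrite addr0 => /eqP; rewrite fmorph_eq0 => /eqP.
by move=> m /negbTE mm; rewrite (ctZ vu r0)// ctm mm mulr0.
Qed.

Lemma admissible_radii_ex d z : (0 < d)%N ->
  exists r : nat -> R, admissible_radii d z r.
Proof.
move=> d0; pose N (x : C) : R := Normc.normc x.
have NE x : (N x)%:C%C = `|x| by [].
have N0 x : 0 <= N x by rewrite -ler0c NE.
pose B := \sum_(i < d.+1) N (z i).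
have NB i : (i <= d)%N -> N (z i) <= B.
  rewrite -ltnS => id; rewrite /B (bigD1 (Ordinal id))//= lerDl.
  by apply: sumr_ge0 => j _.
(* The function [i (d - i)] has second difference -2, so the profile is strictly concave; the offset
   [B + 1] exceeds every [|z i|], and lowering the two ends to the prescribed values only helps. *)
pose p i : R := if (i == 0)%N || (i == d) then N (z i) else B + 1 + i%:R * (d%:R - i%:R).
exists p; rewrite /p; split; rewrite ?eqxx ?orbT// => j /andP[j0 jd].
rewrite (gtn_eqF j0) (ltn_eqF jd) /=; split.
  rewrite -NE ltcR (le_lt_trans (NB j (ltnW jd)))// -addrA ltrDl ltr_wpDr//.
  by rewrite mulr_ge0// subr_ge0 ler_nat ltnW.
have h i : (i <= d)%N -> (if (i == 0)%N || (i == d) then N (z i)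
    else B + 1 + i%:R * (d%:R - i%:R)) <= B + 1 + i%:R * (d%:R - i%:R).
  move=> id; case: ifP => // _; rewrite (le_trans (NB i id))// -addrA lerDl.
  by rewrite addr_ge0// mulr_ge0// subr_ge0 ler_nat.
have jpd : (j.-1 <= d)%N := leq_trans (leq_pred j) (ltnW jd).
apply: (le_lt_trans (lerD (h _ jpd) (h _ jd))).
case: j j0 {jd jpd h} => // j _; rewrite /= -!natr1.
by lra.
Qed.

Lemma is_Poly_inj d (P Q : mpoly d.+1 rat) : (0 < d)%N ->
  is_Poly R P -> is_Poly R Q -> P = Q.
Proof.
move=> d0 hP hQ; apply: mmap_inj => z.
by have [r hr] := admissible_radii_ex z d0; rewrite (hP z r hr) (hQ z r hr).
Qed.

Lemma gaps_gt0 (P : pred nat) n : (0 < n)%N -> (0 < gaps P n)%N.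
Proof.
have h m : (0 < m)%N -> (0 < m - last_break P m.-1)%N.
  by case: m => // m _; rewrite subn_gt0 ltnS last_break_le.
move=> n0; rewrite /gaps muln_gt0 h// andbT big_seq_cond prodn_cond_gt0//.
by move=> s /andP[]; rewrite mem_index_iota => /andP[s0 _] _; exact: h.
Qed.

(** The expansions of [\prod u_j] and of [Poly] are indexed by the same list, which is what later
    allows a comparison term by term. *)
Lemma Poly_decomposition d : (0 < d)%N ->
  exists l : seq (rat * (nat -> nat)),
  [/\ all (fun p => total d p.2 == d.-1) l,
      forall u : nat -> C, \prod_(1 <= j < d) u j =
        \sum_(p <- l) ratr p.1 * theta d p.2 u &
      Defs.Poly R d = \sum_(p <- l)
        (d%:R * p.1 / (gaps (fun j => 0 < p.2 j)%N d)%:R) *: mpolyX rat (mnm_of d p.2)].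
Proof.
move=> d0; have [] := @theta_span_monomial R d d0 (index_iota 1 d).
  by apply/allP => j; rewrite mem_index_iota => /andP[_ /ltnW].
rewrite size_iota subn1 => l hl lE; exists l; split => //.
set P := \sum_(p <- l) _.
(* [xget] returns some solution as soon as one exists; uniqueness identifies it with [P]. *)
have hP : is_Poly R P; last (rewrite /Defs.Poly; apply: is_Poly_inj => //; by apply: xgetI hP).
move=> z r adm; rewrite Poly_valueE//.
have vu := vs_uniq d; have r0 := adm_gt0 d0 adm.
have vsE : index_iota 1 d = iota 1 d.-1 by rewrite /index_iota subn1.
have lT j : j \in iota 1 d.-1 ->
    lau (iota 1 d.-1) r z xpredT (fun u => pole j u * simple_pole z j u).
  move=> jv; have hj : (0 < j < d)%N by rewrite -mem_vs.
  apply: (lauTM r0); first by apply: lauT_pole => //; exact: adm_admissible.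
  apply: (@lau_degT _ _ _ _ false (fun=> 0) 0).
  apply: (lau_deg_simple_pole _ vu r0 jv) => //.
  by have [_ _ /(_ j hj)[]] := adm.
have lTh e : lau (iota 1 d.-1) r z xpredT (theta d e).
  have lX j n : lau (iota 1 d.-1) r z xpredT (fun u => u j ^+ n).
    apply: (@lau_degT _ _ _ _ false (fun=> 0) (0 *+ n)); apply: (lau_degX r0).
    by have := lau_deg_var r z vu false (fun=> 0) j; rewrite /eff if_same.
  rewrite /theta; apply: (lauTM r0); first exact: (lauTM r0).
  apply: (lauT_prod r0) => j _ _; case: (0 < e j)%N; last exact: lau_cst.
  by apply: (lauTM r0) => //; exact: lauT_fd.
have lG : lau (iota 1 d.-1) r z xpredT
    (fun u => \prod_(1 <= j < d) (pole j u * simple_pole z j u)).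
  by apply: (lauT_prod r0) => j; rewrite vsE => jv _; exact: lT.
have lTG e : lau (iota 1 d.-1) r z xpredT
    (fun u => theta d e u * \prod_(1 <= j < d) (pole j u * simple_pole z j u)).
  exact: (lauTM r0).
transitivity (d%:R * \sum_(p <- l) ratr p.1 * ct (iota 1 d.-1) r z
   (fun u => theta d p.2 u * \prod_(1 <= j < d) (pole j u * simple_pole z j u))); last first.
  congr (_ * _).
  transitivity (\sum_(p <- l) ct (iota 1 d.-1) r z (fun u => ratr p.1 *
     (theta d p.2 u * \prod_(1 <= j < d) (pole j u * simple_pole z j u)))).
    by apply: eq_bigr => p _; rewrite (ctZ vu r0).
  rewrite -(ct_sum vu r0); last by move=> p _; exact: lauZ.
  apply: (eq_ct r0) => u _; rewrite (lE u) [RHS]mulr_suml; apply: eq_bigr => p _.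
  by rewrite mulrA.
rewrite /P raddf_sum mulr_sumr; apply: eq_bigr => p _ /=.
pose e := p.2; rewrite -/e mmapZ mmapX; set g := gaps _ _.
have hx : ratr (d%:R * p.1 / g%:R) = d%:R * ratr p.1 / g%:R :> C.
  have rM (x y : rat) : ratr (x * y) = ratr x * ratr y :> C by exact: rmorphM.
  have rV (x : rat) : ratr x^-1 = (ratr x)^-1 :> C by exact: fmorphV.
  by rewrite !rM rV !ratr_nat.
rewrite -[X in X * mmap1 _ _]/(ratr (d%:R * p.1 / g%:R) : C) hx.
move: (ratr p.1) => a; rewrite -!mulrA; congr (_ * (_ * _)).
(* The end variables are frozen at [z 0] and [z d], which gives the end powers of the monomial. *)
have -> : ct (iota 1 d.-1) r z (fun u => theta d e u *
     \prod_(1 <= j < d) (pole j u * simple_pole z j u)) =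
   ct (iota 1 d.-1) r z (fun u => (z 0%N ^+ e 0%N * z d ^+ e d) * \prod_(1 <= j < d)
     ((if (0 < e j)%N then u j ^+ e j else pole j u) * simple_pole z j u)).
  apply: (eq_ct r0) => u Tu; rewrite /theta.
  have -> : u 0%N = z 0%N by have := Tu 0%N; rewrite mem_vs.
  have -> : u d = z d by have := Tu d; rewrite mem_vs// ltnn andbF.
  rewrite -!mulrA; congr (_ * (_ * _)); rewrite -big_split.
  apply: eq_big_nat => j hj /=; rewrite mulrA; congr (_ * _).
  have fj : fd j u != 0 by apply: fd_neq0 (adm_admissible d0 adm hj) Tu.
  case: (posnP (e j)) => ej; first by rewrite mul1r.
  by rewrite -[in RHS](prednK ej) exprS /pole; field.
rewrite (ctZ vu r0); last first.
  apply: (lauT_prod r0) => j; rewrite vsE => jv _.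
  have hj : (0 < j < d)%N by rewrite -mem_vs.
  apply: (lauTM r0).
    case: (0 < e j)%N; last by apply: lauT_pole => //; exact: adm_admissible.
    apply: (@lau_degT _ _ _ _ false (fun=> 0) (0 *+ e j)); apply: (lau_degX r0).
    by have := lau_deg_var r z vu false (fun=> 0) j; rewrite /eff if_same.
  apply: (@lau_degT _ _ _ _ false (fun=> 0) 0).
  apply: (lau_deg_simple_pole _ vu r0 jv) => //.
  by have [_ _ /(_ j hj)[]] := adm.
have := ct_monomial_contour d0 adm e; set c := ct _ _ _ _ => hc.
have g0 : g%:R != 0 :> C.
  by rewrite pnatr_eq0 -lt0n gaps_gt0.
apply: (mulIf g0); rewrite [LHS]mulrAC mulVf// mul1r -[RHS]mulrA hc /mmap1.
have -> : \prod_(i < d.+1) z i ^+ (mnm_of d e) i = \prod_(0 <= i < d.+1) z i ^+ e i.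
  by rewrite big_mkord; apply: eq_bigr => i _; rewrite mnm_ofE.
by rewrite big_nat_recr//= big_ltn// mulrAC.
Qed.
End PolyDecomposition.

(** * The map [phi] on monomials, block by block *)

Section PhiMonomial.
Variable k : nat.
Implicit Types (L : int -> nat -> rat) (N n : int) (e : nat -> nat).

(** Additivity of [phi] needs a common index list, because [P], [Q] and [P + Q] have different
    supports. *)
Lemma phi_supp L N n d (P : mpoly d.+1 rat) (t : seq (multinom d.+1)) :
  uniq t -> {subset msupp P <= t} ->
  phi k L N n P = \sum_(m <- t) mcoeff m P * phi_monomial k L N n m.
Proof.
move=> ut sub; rewrite /phi [RHS](bigID (fun m => m \in msupp P)) /=.
rewrite [X in _ = _ + X]big1 ?addr0; last by move=> m /memN_msupp_eq0 ->; rewrite mul0r.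
rewrite -[RHS]big_filter; apply: perm_big; apply: uniq_perm; rewrite ?filter_uniq//.
by move=> m; rewrite mem_filter; case: (boolP (m \in msupp P)) => // /sub ->.
Qed.

Lemma phiD L N n d (P Q : mpoly d.+1 rat) :
  phi k L N n (P + Q) = phi k L N n P + phi k L N n Q.
Proof.
pose t := undup (msupp P ++ msupp Q ++ msupp (P + Q)).
have ut : uniq t by exact: undup_uniq.
rewrite !(@phi_supp _ _ _ _ _ t)//.
- by rewrite -big_split; apply: eq_bigr => m _; rewrite mcoeffD mulrDl.
all: by move=> m hm; rewrite mem_undup !mem_cat hm ?orbT.
Qed.

Lemma phi_sum (I : Type) (s : seq I) L N n d (c : I -> rat) (m : I -> multinom d.+1) :
  phi k L N n (\sum_(i <- s) c i *: mpolyX rat (m i)) =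
  \sum_(i <- s) c i * phi_monomial k L N n (m i).
Proof.
elim: s => [|i s IH].
  by rewrite !big_nil /phi msupp0 big_nil.
rewrite !big_cons phiD IH; congr (_ + _).
rewrite (@phi_supp _ _ _ _ _ [:: m i])//.
  by rewrite big_seq1 mcoeffZ mcoeffX eqxx mulr1.
move=> m'; rewrite mcoeff_msupp mcoeffZ mcoeffX inE.
by case: (eqVneq m' (m i)) => // _; rewrite mulr0 eqxx.
Qed.

Fixpoint chain_prod (X : nat -> nat -> rat) x (s : seq nat) : rat :=
  if s is y :: s' then X x y * chain_prod X y s' else 1.

Lemma chain_prod_rcons X x s y :
  chain_prod X x (rcons s y) = chain_prod X x s * X (last x s) y.
Proof. by elim: s x => [|z s IH] x /=; rewrite ?mulr1 ?mul1r// IH mulrA. Qed.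

Lemma chain_prodE X x s :
  \prod_(1 <= j < (size s).+1) X (nth 0%N (x :: s) j.-1) (nth 0%N (x :: s) j) =
  chain_prod X x s.
Proof.
elim: s x => [|y s IH] x; first by rewrite big_geq.
rewrite big_ltn//= -IH [in LHS]big_add1 /=; congr (_ * _).
by apply: eq_big_nat => j /andP[j1 _]; case: j j1.
Qed.

Lemma iota1_rcons (n : nat) : iota 1 n.+1 = rcons (iota 1 n) n.+1.
Proof. by rewrite -[in iota 1 n.+1](addn1 n) iotaD cats1 add1n. Qed.

Lemma last_filter_break (P : pred nat) (n : nat) :
  last 0%N [seq i <- iota 1 n | P i] = last_break P n.
Proof.
elim: n => // n IH; rewrite iota1_rcons filter_rcons /=.
by case: (P n.+1); rewrite ?last_rcons.
Qed.

Lemma chain_prod_filter X (P : pred nat) (n : nat) :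
  chain_prod X 0 [seq i <- iota 1 n | P i] =
  \prod_(1 <= b < n.+1 | P b) X (last_break P b.-1) b.
Proof.
elim: n => [|n IH]; first by rewrite big_geq.
rewrite iota1_rcons filter_rcons big_mkcond big_nat_recr//= -big_mkcond -IH /=.
by case: (P n.+1); rewrite ?mulr1// chain_prod_rcons last_filter_break.
Qed.

(** The indices skipped between breakpoints carry exponent 0, so summing over breakpoints amounts to
    summing over an initial segment. *)
Lemma sum_filter_break e (n j : nat) :
  let s := [seq i <- iota 1 n | 0 < e i]%N in (j <= size s)%N ->
  (\sum_(0 <= p < j.+1) e (nth 0 (0 :: s) p) =
   \sum_(0 <= t < (nth 0 (0 :: s) j).+1) e t)%N.
Proof.
elim: n j => [|n IH] j; cbv zeta.
  by rewrite /= leqn0 => /eqP ->; rewrite !big_nat1.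
rewrite iota1_rcons filter_rcons; set s := [seq i <- iota 1 n | 0 < e i]%N in IH *.
case: ifP => [en|_]; last exact: IH.
have E : forall p, (p <= size s)%N -> nth 0%N (0%N :: rcons s n.+1) p = nth 0%N (0%N :: s) p.
  by move=> p ps; rewrite -rcons_cons nth_rcons /= ltnS ps.
rewrite size_rcons leq_eqVlt ltnS => /predU1P[->|js]; last first.
  rewrite E// -[RHS]IH//.
  by apply: eq_big_nat => p /andP[_ pj]; rewrite E// -ltnS (leq_trans pj).
rewrite -rcons_cons nth_rcons /= ltnn eqxx big_nat_recr//= -rcons_cons nth_rcons /= ltnn eqxx.
transitivity ((\sum_(0 <= p < (size s).+1) e (nth 0 (0 :: s) p)) + e n.+1)%N.
  by congr addn; apply: eq_big_nat => p /andP[_ ps]; rewrite -E.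
rewrite IH// [RHS]big_nat_recr//=; congr addn.
have -> : nth 0%N (0%N :: s) (size s) = last_break (fun i => 0 < e i)%N n.
  by rewrite -last_filter_break -/s -[RHS]/(last 0%N (0%N :: s)) -nth_last.
set a := last_break _ n; have an : (a <= n)%N := last_break_le _ n.
rewrite [RHS](@big_cat_nat _ _ _ a.+1)//= [X in _ = (_ + X)%N]big_nat_cond [X in _ = (_ + X)%N]big1 ?addn0//.
move=> t /andP[ht _]; apply/eqP; rewrite -leqn0 leqNgt.
exact: (@last_break_gap (fun i => 0 < e i)%N n).
Qed.

(* The index of the factor attached to the block starting at the breakpoint
   [a] is [n + shift_index N e a]. *)
Definition shift_index N e (a : nat) : int :=
  a%:Z * (N + 1 - k%:Z) - (\sum_(0 <= t < a.+1) e t)%:Z.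

(** In [delta] the counts of breakpoints cancel down to [1 - d]. As the exponents sum to [d - 1],
    those beyond the start of the block can be traded for those up to it, which leaves
    [shift_index]. *)
Lemma phi_monomialE L N n d e : (0 < d)%N -> total d e = d.-1 ->
  phi_monomial k L N n (mnm_of d e) =
  \prod_(1 <= b < d.+1 | (0 < e b)%N || (b == d))
    L (n + shift_index N e (last_break (fun i => 0 < e i)%N b.-1))
      (b - last_break (fun i => 0 < e i)%N b.-1)%N.
Proof.
move=> d0 te; set P := fun i => (0 < e i)%N.
have mE i : (i <= d)%N -> mnm_of d e (inord i) = e i.
  by move=> id; rewrite mnm_ofE inordK.
set s := [seq i <- iota 1 d.-1 | P i].
have bpE : breakpoints (mnm_of d e) = 0%N :: rcons s d.
  rewrite /breakpoints; congr (_ :: rcons _ _); apply: eq_in_filter => i.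
  by rewrite mem_iota add1n prednK// => /andP[_ /ltnW id]; rewrite mE.
have X0 : \prod_(1 <= b < d.+1 | P b || (b == d))
    L (n + shift_index N e (last_break P b.-1)) (b - last_break P b.-1)%N =
    chain_prod (fun a b => L (n + shift_index N e a) (b - a)%N) 0 (rcons s d).
  rewrite chain_prod_rcons chain_prod_filter last_filter_break.
  rewrite big_mkcond big_nat_recr//= eqxx orbT prednK//; congr (_ * _).
  rewrite [RHS]big_mkcond; apply: eq_big_nat => b /andP[_ bd].
  by rewrite (ltn_eqF bd) orbF.
rewrite X0 -chain_prodE /phi_monomial bpE /=.
apply: eq_big_nat => j /andP[j1 jl]; congr (L _ _).
rewrite /delta bpE /=; congr (_ + _); rewrite size_rcons in jl *.
rewrite ltnS in jl; set l := (size s).+1 in jl *.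
set i := nth 0%N (0%N :: rcons s d).
have is_ p : (p < l)%N -> i p = nth 0%N (0%N :: s) p.
  by move=> pl; rewrite /i -rcons_cons nth_rcons /= pl.
have il : i l = d by rewrite /i -rcons_cons nth_rcons /= ltnn eqxx.
have ib p : (p <= l)%N -> (i p <= d)%N.
  rewrite leq_eqVlt => /predU1P[->|pl]; first by rewrite il.
  rewrite is_//; case: p pl => //= p pl.
  have : s`_p \in s by apply: mem_nth.
  rewrite mem_filter mem_iota add1n prednK// => /andP[_ /andP[_]].
  exact: ltnW.
rewrite mE ?ib// il.
have jl1 : (j.-1 < l)%N by case: j j1 jl.
have S1 : (\sum_(0 <= p < j) e (i p) = \sum_(0 <= t < (i j.-1).+1) e t)%N.
  have := @sum_filter_break e d.-1 j.-1; rewrite /= -/P -/s => /(_ _).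
  rewrite -ltnS -/l jl1 prednK// -is_// => /(_ isT) <-.
  by apply: eq_big_nat => p /andP[_ pj]; rewrite is_// (leq_trans pj).
have S2 : (\sum_(0 <= p < l) e (i p) + e d = d.-1)%N.
  rewrite -te /total [RHS]big_nat_recr//=; congr addn.
  transitivity (\sum_(0 <= p < l) e (nth 0 (0 :: s) p))%N.
    by apply: eq_big_nat => p /andP[_ pl]; rewrite is_.
  have := @sum_filter_break e d.-1 (size s); rewrite /= -/P -/s => /(_ (leqnn _)) ->.
  have -> : nth 0%N (0%N :: s) (size s) = last_break P d.-1.
    by rewrite -last_filter_break -/s -[RHS]/(last 0%N (0%N :: s)) -nth_last.
  set a := last_break _ _; have an : (a <= d.-1)%N := last_break_le _ _.
  rewrite [RHS](@big_cat_nat _ _ _ a.+1)//=; last by rewrite -(prednK d0) ltnS.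
  rewrite [X in _ = (_ + X)%N]big_nat_cond [X in _ = (_ + X)%N]big1 ?addn0//.
  move=> t /andP[/andP[t1 t2] _]; apply/eqP; rewrite -leqn0 leqNgt.
  by apply: (@last_break_gap P d.-1); rewrite t1 -ltnS prednK.
have S3 : \sum_(j <= p < l) ((mnm_of d e (inord (i p)))%:Z - 1) =
   (\sum_(j <= p < l) e (i p))%:Z - (l%:Z - j%:Z).
  rewrite (eq_big_nat _ _ (F2 := fun p => (e (i p))%:Z + -1)); last first.
    by move=> p /andP[_ /ltnW pl]; rewrite mE// ib.
  rewrite big_split /= sumr_const_nat subzn// mulNrn natz.
  by rewrite (big_morph Posz (id1 := 0) (op1 := +%R) PoszD).
rewrite S3.
have S4 : (\sum_(0 <= p < j) e (i p) + \sum_(j <= p < l) e (i p) + e d = d.-1)%N.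
  by rewrite -S2 [in RHS](@big_cat_nat _ _ _ j)//.
rewrite /shift_index -S1.
have hd : d%:Z = (d.-1)%:Z + 1 by rewrite -{1}(prednK d0) -addn1 PoszD.
have hj : j%:Z = (j.-1)%:Z + 1 by rewrite -{1}(prednK j1) -addn1 PoszD.
rewrite hd -S4 !PoszD hj; ring.
Qed.

End PhiMonomial.

(** * Chains, the integrands of the closed form *)

Section Chain.
Variable R : realType.
Local Notation C := R[i].
Variables (k M : nat).
Hypothesis k_gt0 : (0 < k)%N.
Implicit Types (u v : nat -> C) (w : nat -> int) (N n : int) (e : nat -> nat).

(* Strict concavity gives [|u_(j-1) + u_(j+1)| < 2 |u_j|] on the torus. *)
Definition radius (j : nat) : R := 2 - 2^-1 ^+ j.

Local Notation vs := (iota 0 M).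
Local Notation b0 := (fun _ : nat => 0 : C).
Local Notation torus := (torus vs radius b0).
Local Notation lauT := (lau vs radius b0 xpredT).
Local Notation lau_deg := (lau_deg vs radius b0).
Local Notation admissible := (admissible vs radius b0).
Local Notation ct := (ct vs radius b0).
Local Notation eff := (eff vs).

Lemma mem_all j : (j \in vs) = (j < M)%N.
Proof. by rewrite mem_iota add0n. Qed.

Lemma all_uniq : uniq vs. Proof. exact: iota_uniq. Qed.

Lemma radius_gt0 j : 0 < radius j.
Proof.
have h : 2^-1 ^+ j <= 1 :> R.
  by apply: exprn_ile1; [rewrite invr_ge0|rewrite invf_le1 ?ler1n].
by rewrite /radius subr_gt0 (le_lt_trans h) ?ltr1n.
Qed.

Lemma all_gt0 j : j \in vs -> 0 < radius j.
Proof. by move=> _; exact: radius_gt0. Qed.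

Local Notation vu := all_uniq.
Local Notation r0 := all_gt0.

Lemma all_admissible j : (0 < j)%N -> (j.+1 < M)%N -> admissible j.
Proof.
move=> j0 jM; have jM' := ltnW jM.
have hu i u : (i < M)%N -> torus u -> `|u i| <= (radius i)%:C%C.
  by move=> iM /(_ i); rewrite mem_all iM => ->.
split; first by rewrite mem_all.
  case: j j0 {jM jM'} => // j _; rewrite /radius /= !exprS.
  have : 0 < 2^-1 ^+ j :> R by rewrite exprn_gt0.
  by lra.
move=> u Tu; split; apply: hu => //.
exact: leq_ltn_trans (leq_pred j) jM'.
Qed.

Lemma all_neq0 u j : torus u -> (j < M)%N -> u j != 0.
Proof. by move=> Tu jM; apply: (torus_neq0 r0 Tu); rewrite mem_all. Qed.

Lemma degV x w j (m : int) : (j < M)%N -> lau_deg x w (w j * m) (fun u => u j ^ m).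
Proof. by move=> jM; apply: lau_deg_varX => //; [exact: vu|rewrite mem_all]. Qed.

Lemma deg_var x w j : (j < M)%N -> lau_deg x w (w j) (fun u => u j).
Proof. by move=> jM; have := degV x w 1 jM; rewrite mulr1; apply. Qed.

Lemma deg_pole x w j : (0 < j)%N -> (j.+1 < M)%N ->
  rel_deg x (w j) (w j.-1) -> rel_deg x (w j) (w j.+1) -> lau_deg x w 0 (pole j).
Proof.
move=> j0 jM h1 h2; have jM1 : (j.-1 < M)%N.
  by apply: leq_ltn_trans (leq_pred j) (ltnW jM).
apply: (lau_deg_pole vu r0); first exact: all_admissible.
  by rewrite /eff mem_all jM1.
by rewrite /eff mem_all jM.
Qed.

Definition edge (x y : C) : C := k%:R * \prod_(1 <= m < k) (m%:R * x + (k - m)%:R * y).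

Lemma deg_edge x w c i j : (i < M)%N -> (j < M)%N ->
  rel_deg x c (w i) -> rel_deg x c (w j) ->
  lau_deg x w (c *+ k.-1) (fun u => edge (u i) (u j)).
Proof.
move=> iM jM ci cj; apply: lau_degZ.
have -> : c *+ k.-1 = \sum_(1 <= m < k) c by rewrite sumr_const_nat subn1.
apply: (lau_deg_prod r0) => m _ _; apply: lau_degD; apply: lau_degZ.
  by apply: lau_deg_weak ci _; exact: deg_var.
by apply: lau_deg_weak cj _; exact: deg_var.
Qed.

(** Each interior power is split as [u_j^(1-N)] times a pole, to reuse the weights of poles. The
    exponent at the right end makes the total degree 0, and the offset [a] allows chains to be
    concatenated. *)
Definition chain N a d n u : C :=
  u a ^ (- n) * u (a + d)%N ^ (n - (N - 1 - (N - k%:Z) * d%:Z)) *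
  \prod_(1 <= j < d) (u (a + j)%N ^ (1 - N) * pole (a + j) u) *
  \prod_(1 <= j < d.+1) edge (u (a + j).-1) (u (a + j)%N).

Lemma deg_chain x w c N a d n : (0 < d)%N -> (a + d < M)%N ->
  (forall j, (1 <= j < d)%N -> rel_deg x (w (a + j)%N) (w (a + j).-1) /\
                               rel_deg x (w (a + j)%N) (w (a + j).+1)) ->
  (forall j, (j <= d)%N -> rel_deg x c (w (a + j)%N)) ->
  lau_deg x w (w a * - n + w (a + d)%N * (n - (N - 1 - (N - k%:Z) * d%:Z)) +
     \sum_(1 <= j < d) (w (a + j)%N * (1 - N)) + c *+ k.-1 *+ d)
   (chain N a d n).
Proof.
move=> d0 adM hw hc; have jM j : (j <= d)%N -> (a + j < M)%N.
  by move=> jd; apply: leq_ltn_trans adM; rewrite leq_add2l.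
apply: (lau_degM r0).
  apply: (lau_degM r0).
    apply: (lau_degM r0); first by apply: degV; have := jM 0%N; rewrite addn0; apply.
    exact: degV.
  apply: (lau_deg_prod r0) => j; rewrite mem_index_iota => hj _.
  have [h1 h2] := hw j hj; have /andP[j1 jd] := hj.
  rewrite -[_ * _]addr0; apply: (lau_degM r0); first exact/degV/jM/ltnW.
  apply: deg_pole => //; first by rewrite addn_gt0 j1 orbT.
  by rewrite -addnS; exact: jM.
have -> : c *+ k.-1 *+ d = \sum_(1 <= j < d.+1) c *+ k.-1.
  by rewrite sumr_const_nat subn1.
apply: (lau_deg_prod r0) => -[|j]; rewrite mem_index_iota//= ltnS => jd _.
rewrite addnS /=; apply: deg_edge.
- exact/jM/ltnW.
- by rewrite -addnS; exact: jM.
- exact/hc/ltnW.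
- by rewrite -addnS; exact: hc.
Qed.

Lemma lauT_chain N a d n : (0 < d)%N -> (a + d < M)%N -> lauT (chain N a d n).
Proof.
move=> d0 adM; apply: (@lau_degT _ _ _ _ false (fun=> 0) _).
by apply: (@deg_chain false (fun=> 0) 0).
Qed.

Lemma eq_chain N a d n u v : (forall j, (j <= d)%N -> u (a + j)%N = v (a + j)%N) ->
  chain N a d n u = chain N a d n v.
Proof.
move=> E; have E' j : (0 < j <= d)%N -> u (a + j).-1 = v (a + j).-1.
  by case: j => // j /= jd; rewrite addnS /= E// ltnW.
rewrite /chain E//; have := E _ (leq0n d); rewrite addn0 => ->.
congr (_ * _ * _); apply: eq_big_nat => j /andP[j1 jd].
  by rewrite /pole /fd E ?(ltnW jd)// E' ?j1 ?(ltnW jd)// -addnS E.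
by rewrite E// E'// j1.
Qed.

End Chain.

(** * The closed form for [N = 2k] *)

Section ClosedForm.
Variable R : realType.
Local Notation C := R[i].
Variables (k M : nat).
Hypothesis k_gt0 : (0 < k)%N.
Implicit Types (u v : nat -> C) (w : nat -> int) (N n : int) (e : nat -> nat).

Local Notation vs := (iota 0 M).
Local Notation radius := (radius R).
Local Notation b0 := (fun _ : nat => 0 : C).
Local Notation torus := (torus vs radius b0).
Local Notation lauT := (lau vs radius b0 xpredT).
Local Notation lau_deg := (lau_deg vs radius b0).
Local Notation ct := (ct vs radius b0).
Local Notation vu := (all_uniq M).
Local Notation r0 := (@all_gt0 R M).
Local Notation chain := (@chain R k).

Definition edge_poly : {poly rat} :=
  k%:R *: \prod_(1 <= j < k) (j%:R *: 'X + (k - j)%:R%:P).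

Lemma size_edge_poly : (size edge_poly <= k)%N.
Proof.
pose g j : {poly rat} := j%:R *: 'X + (k - j)%:R%:P.
have sz m : (size (\prod_(1 <= j < m.+1) g j)%R <= m.+1)%N.
  elim: m => [|m IH]; first by rewrite big_geq// size_poly1.
  rewrite big_nat_recr//= (leq_trans (size_polyMleq _ _))//.
  have h2 : (size (g m.+1) <= 2)%N.
    rewrite /g (leq_trans (size_polyD _ _))// geq_max size_polyC.
    rewrite (leq_trans (size_scale_leq _ _)) ?size_polyX//=.
    by case: eqP.
  by rewrite -subn1 leq_subLR add1n -(addn2 m.+1); exact: leq_add IH h2.
rewrite (leq_trans (size_scale_leq _ _))//.
by have := sz k.-1; rewrite prednK.
Qed.

(** [edge k] is the homogenisation, in degree [k - 1], of the polynomial whose coefficients define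
    [vsc_base]. *)
Lemma edge_polyE (x y : C) : y != 0 ->
  edge k x y = \sum_(i < k) ratr edge_poly`_i * (x ^+ i * y ^ (k.-1%:Z - i%:Z)).
Proof.
move=> y0; pose f := map_poly (ratr : rat -> C).
have szE : (size (f edge_poly) <= k)%N by rewrite size_map_poly size_edge_poly.
have -> : edge k x y = y ^+ k.-1 * (f edge_poly).[x / y].
  rewrite /f map_polyZ rmorph_prod /= hornerZ horner_prod rmorph_nat mulrCA.
  congr (_ * _); have -> : y ^+ k.-1 = \prod_(1 <= j < k) y.
    by rewrite prodr_const_nat subn1.
  rewrite -big_split; apply: eq_bigr => m _ /=.
  rewrite rmorphD /= map_polyZ map_polyX map_polyC /= hornerD hornerZ hornerX hornerC !rmorph_nat.
  by field.
rewrite (horner_coef_wide _ szE) mulr_sumr; apply: eq_bigr => i _.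
rewrite coef_map /= mulrCA; congr (_ * _).
rewrite expr_div_n mulrCA; congr (_ * _).
by rewrite expfzDr// -exprnP -exprnN.
Qed.

Lemma ct_ratio a (c : int) : (a.+1 < M)%N ->
  ct (fun u => u a ^ c * u a.+1 ^ (- c)) = (c == 0)%:R.
Proof.
move=> aM; have aM' := ltnW aM.
have lc (c' : int) x w : lau_deg x w (w a * c' + w a.+1 * (- c')) (fun u => u a ^ c' * u a.+1 ^ (- c')).
  by apply: (lau_degM r0); exact: degV.
have [->|c0] := eqVneq c 0.
  rewrite -[RHS](ct_cst b0 r0); apply: (eq_ct r0) => u _.
  by rewrite oppr0 !expr0z mulr1.
case: (ltrgtP c 0) c0 => // hc _.
- apply: (ct_vanish vu r0 (w := wt_at a.+1)); apply: lau_deg_weak (lc c true _).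
  by rewrite /= /wt_at eqxx ltn_eqF// mul0r add0r mul1r; lia.
- apply: (ct_vanish vu r0 (w := wt_at a)); apply: lau_deg_weak (lc c true _).
  by rewrite /= /wt_at eqxx gtn_eqF// mul0r addr0 mul1r; lia.
Qed.

(** For [d = 1] there is no pole and the constant term reads off one coefficient of [edge_poly]. For
    [d >= 2] the end exponents are [- n] and [n + 1 + k (d - 2)]: one of them is positive, and no
    edge or pole brings negative powers of an end variable. *)
Lemma ct_chain_base a d n : (0 < d)%N -> (a + d < M)%N ->
  ratr (vsc_base k n d) = d%:R * ct (chain (2 * k)%:Z a d n).
Proof.
move=> d0 adM; have [d1|d1] := leqP d 1.
  have dE : d = 1%N by case: d d0 d1 {adM} => [|[]].
  move: adM; rewrite {}dE {d d0 d1} addn1 => aM; have aM' := ltnW aM.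
  have lr (c : int) : lauT (fun u => u a ^ c * u a.+1 ^ (- c)).
    by apply: (lauTM r0); apply: (@lau_degT _ _ _ _ false (fun=> 0)); exact: degV.
  rewrite mul1r (@eq_ct _ _ _ _ r0 _ (fun u => \sum_(i < k) ratr edge_poly`_i *
      (u a ^ (i%:Z - n) * u a.+1 ^ (- (i%:Z - n))))); last first.
    move=> u Tu; have u0 := all_neq0 Tu aM'; have u1 := all_neq0 Tu aM.
    rewrite /chain big_geq// mulr1 big_nat1 addn1 /= edge_polyE// mulr_sumr.
    apply: eq_bigr => i _; rewrite mulrCA; congr (_ * _).
    rewrite exprnP mulrACA -(expfzDr _ _ u0) -(expfzDr _ _ u1).
    congr (_ ^ _ * _ ^ _); first by rewrite addrC.
    by have := k_gt0; lia.
  rewrite (ct_sum vu r0); last by move=> i _; exact: lauZ.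
  under eq_bigr do rewrite (ctZ vu r0)// ct_ratio// subr_eq0.
  rewrite /vsc_base -/edge_poly; case: n => n; last first.
    by rewrite rmorph0 big1// => i _; rewrite mulr0.
  case: (ltnP n k) => nk; last first.
    rewrite nth_default ?rmorph0; last by apply: leq_trans nk; exact: size_edge_poly.
    by rewrite big1// => i _; rewrite eqz_nat ltn_eqF ?mulr0// (leq_trans _ nk).
  rewrite (bigD1 (Ordinal nk))//= eqxx mulr1 big1 ?addr0//.
  by move=> i; rewrite eqz_nat -val_eqE /= => /negbTE ->; rewrite mulr0.
have -> : vsc_base k n d = 0 by case: n => n; case: d d1 {d0 adM} => [|[]].
rewrite rmorph0.
have hdeg w : (forall j, (1 <= j < d)%N -> w (a + j)%N = 0) -> 0 <= w a -> 0 <= w (a + d)%N ->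
    1 <= w a * - n + w (a + d)%N * (n - ((2 * k)%:Z - 1 - ((2 * k)%:Z - k%:Z) * d%:Z)) ->
    ct (chain (2 * k)%:Z a d n) = 0.
  move=> w0 wa wd h.
  apply: (ct_vanish vu r0 (w := w)).
  have hw j : (j <= d)%N -> 0 <= w (a + j)%N.
    case: j => [|j]; first by rewrite addn0.
    rewrite leq_eqVlt => /predU1P[->//|jd]; by rewrite w0.
  have hrel j : (1 <= j < d)%N -> rel_deg true (w (a + j)%N) (w (a + j).-1) /\
                               rel_deg true (w (a + j)%N) (w (a + j).+1).
    move=> /andP[j1 jd] /=; rewrite w0 ?j1//; split; last by rewrite -addnS; exact: hw.
    by case: j j1 jd => // j _ jd; rewrite addnS /=; exact/hw/ltnW/ltnW.
  apply: (@lau_deg_weak _ _ _ _ _ _ _ _ _ _ (deg_chain k _ _ d0 adM hrel hw)).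
  rewrite /= mul0rn mul0rn addr0 big_nat big1 ?addr0//.
  by move=> j hj; rewrite w0// mul0r.
have hd : 2 <= d%:Z :> int by lia.
have hk : 1 <= k%:Z :> int by lia.
have hkd : k%:Z * 2 <= k%:Z * d%:Z by rewrite ler_pM2l// lia.
rewrite (_ : ct _ = 0) ?mulr0//.
case: (ltrP n 0) => hn.
- apply: (hdeg (wt_at a)); rewrite /wt_at ?eqxx//.
  + by move=> j /andP[j1 _]; rewrite gtn_eqF// -[X in (X < _)%N]addn0 ltn_add2l.
  + rewrite (_ : (a + d == a)%N = false); last by rewrite gtn_eqF// -[X in (X < _)%N]addn0 ltn_add2l.
    lia.
- apply: (hdeg (wt_at (a + d)%N)); rewrite /wt_at ?eqxx//.
  + by move=> j /andP[_ jd]; rewrite ltn_eqF// ltn_add2l.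
  + rewrite (_ : (a == a + d)%N = false); last by rewrite ltn_eqF// -[X in (X < _)%N]addn0 ltn_add2l.
    rewrite PoszM; nia.
Qed.

End ClosedForm.

(** * Cutting a chain at its breakpoints *)

Section ClosedFormStep.
Variable R : realType.
Local Notation C := R[i].
Variables (k M : nat).
Hypothesis k_gt0 : (0 < k)%N.
Implicit Types (u v : nat -> C) (w : nat -> int) (N n : int) (e : nat -> nat).

Local Notation vs := (iota 0 M).
Local Notation radius := (radius R).
Local Notation b0 := (fun _ : nat => 0 : C).
Local Notation torus := (torus vs radius b0).
Local Notation lauT := (lau vs radius b0 xpredT).
Local Notation lau_deg := (lau_deg vs radius b0).
Local Notation ct := (ct vs radius b0).
Local Notation vu := (all_uniq M).
Local Notation r0 := (@all_gt0 R M).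
Local Notation chain := (@chain R k).

(** For [b = d] this is the integrand for [N] with [theta e] in place of [\prod u_j], as
    [broken_chain_theta] shows. For smaller [b] it is an initial piece, the exponent of [u_(a+b)]
    being adjusted to total degree 0 as [ct_split] requires. *)
Definition broken_chain N e a b n u : C :=
  u a ^ ((e 0%N)%:Z - n) *
  u (a + b)%N ^ (n + b%:Z * (N + 1 - k%:Z) - (\sum_(0 <= t < b) e t)%:Z - N) *
  \prod_(1 <= j < b)
     (u (a + j)%N ^ ((e j)%:Z - N) * (if (0 < e j)%N then 1 else pole (a + j) u)) *
  \prod_(1 <= j < b.+1) edge k (u (a + j).-1) (u (a + j)%N).

Lemma deg_broken_chain N e a b n : (0 < b)%N -> (a + b < M)%N ->
  lau_deg false (fun=> 1) 0 (broken_chain N e a b n).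
Proof.
move=> h0 abM; have jM j : (j <= b)%N -> (a + j < M)%N.
  by move=> jb; apply: leq_ltn_trans abM; rewrite leq_add2l.
have H : rel_deg false 0 (1 * ((e 0%N)%:Z - n) +
  1 * (n + b%:Z * (N + 1 - k%:Z) - (\sum_(0 <= t < b) e t)%:Z - N) +
  \sum_(1 <= j < b) ((e j)%:Z - N) + \sum_(1 <= j < b.+1) 1 *+ k.-1).
  apply/eqP/esym.
  rewrite sumr_const_nat subn1 big_split /= sumr_const_nat big_ltn// PoszD.
  rewrite (big_morph Posz (id1 := 0) (op1 := +%R) PoszD)//.
  have hb : b%:Z = (b - 1)%N%:Z + 1 by lia.
  have hk : k%:Z = k.-1%:Z + 1 by have := k_gt0; lia.
  rewrite -[_ *+ b]mulr_natr -[_ *+ k.-1]mulr_natr -[- N *+ _]mulr_natr !natz hk hb.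
  by ring.
apply: (lau_deg_weak H).
apply: (lau_degM r0).
  apply: (lau_degM r0).
    apply: (lau_degM r0); last exact: degV.
    by apply: degV; have := jM 0%N; rewrite addn0; apply.
  apply: (lau_deg_prod r0) => j; rewrite mem_index_iota => /andP[j1 jb] _.
  have h := @degV R M false (fun=> 1) (a + j) ((e j)%:Z - N) (jM j (ltnW jb)).
  rewrite -[X in lau_deg _ _ X _]addr0; apply: (lau_degM r0).
    by rewrite -[X in lau_deg _ _ X _]mul1r.
  case: (0 < e j)%N; first exact: lau_deg_cst.
  apply: deg_pole => //; first by rewrite addn_gt0 j1 orbT.
  by rewrite -addnS; exact: jM.
apply: (lau_deg_prod r0) => -[|j]; rewrite mem_index_iota//= ltnS => jb _.
rewrite addnS /=; apply: deg_edge => //; first exact/jM/ltnW.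
by rewrite -addnS; exact: jM.
Qed.

(** There is no pole at the breakpoint [c], so the two sides share only a power of [u_(a+c)],
    distributed to give the left factor degree 0. Beyond [c] the exponents [e j] vanish, and
    [- N = 1 - (N + 1)] turns the right factor into a chain for [N + 1]. *)
Lemma broken_chain_split N e a b c n u :
  (0 < c < b)%N -> (0 < e c)%N -> (forall j, (c < j < b)%N -> e j = 0%N) ->
  (a + b < M)%N -> torus u ->
  broken_chain N e a b n u =
  broken_chain N e a c n u * chain (N + 1) (a + c) (b - c) (n + shift_index k N e c) u.
Proof.
move=> /andP[c0 cb] ec ej abM Tu.
have uc : u (a + c)%N != 0.
  by apply: (all_neq0 Tu); apply: ltn_trans abM; rewrite ltn_add2l.
have sumE : (\sum_(0 <= t < b) e t = \sum_(0 <= t < c.+1) e t)%N.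
  rewrite (@big_cat_nat _ _ _ c.+1)//= [X in (_ + X)%N]big_nat [X in (_ + X)%N]big1 ?addn0//.
rewrite /broken_chain /chain -addnA subnKC 1?ltnW//.
have -> : \prod_(1 <= j < b.+1) edge k (u (a + j).-1) (u (a + j)%N) =
   (\prod_(1 <= j < c.+1) edge k (u (a + j).-1) (u (a + j)%N)) *
   \prod_(1 <= j < (b - c).+1) edge k (u (a + c + j).-1) (u (a + c + j)%N).
  rewrite (@big_cat_nat _ _ _ c.+1)//=; last exact: ltnW.
  congr (_ * _); rewrite -add1n big_addn subSn; last exact: ltnW.
  by apply: eq_bigr => j _; rewrite [(j + c)%N]addnC addnA.
have -> : \prod_(1 <= j < b)
     (u (a + j)%N ^ ((e j)%:Z - N) * (if (0 < e j)%N then 1 else pole (a + j) u)) =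
   (\prod_(1 <= j < c)
     (u (a + j)%N ^ ((e j)%:Z - N) * (if (0 < e j)%N then 1 else pole (a + j) u))) *
   u (a + c)%N ^ ((e c)%:Z - N) *
   \prod_(1 <= j < b - c) (u (a + c + j)%N ^ (1 - (N + 1)) * pole (a + c + j) u).
  rewrite (@big_cat_nat _ _ _ c)//=; last exact: ltnW.
  rewrite -mulrA; congr (_ * _); rewrite big_ltn// ec mulr1; congr (_ * _).
  rewrite -add1n big_addn; apply: eq_big_nat => j /andP[j1 jbc].
  rewrite [(j + c)%N]addnC addnA ej ?ltnn; last by lia.
  by congr (_ ^ _ * _); rewrite opprD addrCA subrr addr0 sub0r.
have -> : n + b%:Z * (N + 1 - k%:Z) - (\sum_(0 <= t < b) e t)%:Z - N =
   n + shift_index k N e c - (N + 1 - 1 - (N + 1 - k%:Z) * (b - c)%N%:Z).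
  by rewrite sumE /shift_index -subzn; [ring|exact: ltnW].
have -> : u (a + c)%N ^ ((e c)%:Z - N) =
   u (a + c)%N ^ (n + c%:Z * (N + 1 - k%:Z) - (\sum_(0 <= t < c) e t)%:Z - N) *
   u (a + c)%N ^ (- (n + shift_index k N e c)).
  rewrite -expfzDr//; congr (_ ^ _).
  by rewrite /shift_index big_nat_recr//= PoszD; ring.
by move: (\prod_(_ <= _ < _) _) (\prod_(_ <= _ < _) _) (\prod_(_ <= _ < _) _)
   (\prod_(_ <= _ < _) _) => ? ? ? ?; ring.
Qed.

(** Strong induction through the last breakpoint: [ct_split] detaches the last block, whose
    normalising factor is its length, and these lengths multiply to [gaps]. *)
Lemma ct_broken_chain (L : int -> nat -> rat) N e :
  (forall a d n, (0 < d)%N -> (a + d < M)%N ->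
     ratr (L n d) = d%:R * ct (chain (N + 1) a d n)) ->
  forall a b n, (0 < b)%N -> (a + b < M)%N ->
  let P := fun i => (0 < e i)%N in
  let F s := L (n + shift_index k N e (last_break P s.-1)) (s - last_break P s.-1)%N in
  ratr (\prod_(1 <= s < b | P s) F s * F b) =
  (gaps P b)%:R * ct (broken_chain N e a b n).
Proof.
move=> HL a b n + + P F; elim/ltn_ind: b => b IH h0 abM.
have := last_break_le P b.-1; have := @last_breakP P b.-1.
have := @last_break_gap P b.-1; rewrite {1}/F /gaps.
set c := last_break P b.-1 => gap cP cb.
have gap' j : (c < j < b)%N -> e j = 0%N.
  move=> /andP[cj jb]; apply/eqP; rewrite -leqn0 leqNgt; apply: gap.
  by rewrite cj -ltnS prednK.
have [c0|c0] := posnP c.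
  have Pb s : (1 <= s < b)%N -> P s = false by move=> h; rewrite /P gap' ?c0.
  rewrite big_nat_cond big_pred0; last by move=> s; case hs : (_ <= _ < _)%N => //=; rewrite Pb.
  rewrite big_nat_cond big_pred0; last by move=> s; case hs : (_ <= _ < _)%N => //=; rewrite Pb.
  rewrite mul1r mul1n /F -/c c0 subn0 (HL a)//; congr (_ * _); apply: (eq_ct r0) => u Tu.
  have S0 : (\sum_(0 <= t < b) e t = e 0)%N.
    rewrite big_ltn// big_nat big1 ?addn0// => t ht; by apply: gap'; rewrite c0.
  rewrite /broken_chain /chain /shift_index S0 big_nat1 mul0r sub0r.
  congr (_ * _); congr (_ * _ * _).
  - by congr (_ ^ _); ring.
  - by congr (_ ^ _); ring.
  - apply: eq_big_nat => j hj; have := Pb j hj; rewrite /P => ->; rewrite gap' ?c0//.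
    by congr (_ ^ _ * _); ring.
have cltb : (c < b)%N by rewrite -ltnS prednK in cb *.
have Pc : P c := cP c0.
have {}IH := IH c cltb c0 (ltn_trans (_ : a + c < a + b)%N abM).
have bigE (T : Type) (idx : T) (op : Monoid.com_law idx) (G : nat -> T) :
    \big[op/idx]_(1 <= s < b | P s) G s = op (\big[op/idx]_(1 <= s < c | P s) G s) (G c).
  rewrite (@big_cat_nat _ _ _ c)//=; last exact: ltnW.
  rewrite [X in op _ X]big_ltn_cond// Pc [X in op _ (op _ X)]big_nat_cond.
  rewrite [X in op _ (op _ X)]big_pred0 ?Monoid.mulm1// => s.
  by case hs : (_ <= _ < _)%N => //=; rewrite /P gap'.
rewrite !bigE /= rmorphM /= IH ?ltn_add2l// natrM.
have abc : (a + c + (b - c) = a + b)%N by rewrite -addnA subnKC// ltnW.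
rewrite (HL (a + c)%N) ?subn_gt0// ?abc//.
rewrite mulrACA; congr (_ * _).
have acM : (a + c < M)%N by apply: ltn_trans abM; rewrite ltn_add2l.
rewrite -(@ct_split _ _ _ _ vu r0 (fun=> 1) (a + c)%N)//.
- apply: (eq_ct r0) => u Tu; rewrite (@broken_chain_split N e a b c)//.
  by rewrite c0.
- by rewrite mem_all.
- exact: deg_broken_chain.
- by apply: lauT_chain; rewrite ?subn_gt0 ?abc.
- move=> u v Tu Tv uv.
  have E j : (j <= a + c)%N -> u j = v j.
    by move=> jac; apply: uv; rewrite inE mem_filter negb_and -leqNgt jac.
  have Ej j : (j <= c)%N -> u (a + j)%N = v (a + j)%N by move=> jc; rewrite E// leq_add2l.
  have Ep j : (j <= c)%N -> u (a + j).-1 = v (a + j).-1.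
    by move=> jc; rewrite E// (leq_trans (leq_pred _))// leq_add2l.
  rewrite /broken_chain Ej// (E a) ?leq_addr//.
  congr (_ * _ * _); apply: eq_big_nat => j /andP[j1 jc]; last by rewrite Ej// Ep.
  rewrite Ej ?(ltnW jc)//; congr (_ * _).
  by rewrite /pole /fd Ej ?(ltnW jc)// Ep ?(ltnW jc)// -addnS Ej.
- move=> u v Tu Tv uv; apply: eq_chain => j jb.
  by apply: uv; rewrite inE mem_filter negb_and -leqNgt -addnA leq_add2l leq_addr.
Qed.

End ClosedFormStep.

(** * The descending induction on [N] *)

Section ClosedFormVsc.
Variable R : realType.
Local Notation C := R[i].
Variables (k M : nat).
Hypothesis k_gt0 : (0 < k)%N.
Implicit Types (u v : nat -> C) (N n : int) (e : nat -> nat).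

Local Notation vs := (iota 0 M).
Local Notation radius := (radius R).
Local Notation b0 := (fun _ : nat => 0 : C).
Local Notation torus := (torus vs radius b0).
Local Notation lauT := (lau vs radius b0 xpredT).
Local Notation ct := (ct vs radius b0).
Local Notation vu := (all_uniq M).
Local Notation r0 := (@all_gt0 R M).
Local Notation chain := (@chain R k).

Lemma broken_chain_theta N e a d n u : (0 < d)%N -> (a + d < M)%N ->
  total d e = d.-1 -> torus u ->
  broken_chain k N e a d n u = theta d e (fun j => u (a + j)%N) *
   (u a ^ (- n) * u (a + d)%N ^ (n - (N - 1 - (N - k%:Z) * d%:Z)) *
    \prod_(1 <= j < d) (u (a + j)%N ^ (- N) * pole (a + j) u) *
    \prod_(1 <= j < d.+1) edge k (u (a + j).-1) (u (a + j)%N)).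
Proof.
move=> d0 adM te Tu; have uj j : (j <= d)%N -> u (a + j)%N != 0.
  by move=> jd; apply: (all_neq0 Tu); apply: leq_ltn_trans adM; rewrite leq_add2l.
have ua : u a != 0 by have := uj 0%N; rewrite addn0; apply.
have ud := uj d (leqnn d).
rewrite /broken_chain /theta addn0.
have -> : u a ^ ((e 0%N)%:Z - n) = u a ^+ e 0%N * u a ^ (- n).
  by rewrite expfzDr.
have -> : n + d%:Z * (N + 1 - k%:Z) - (\sum_(0 <= t < d) e t)%:Z - N =
   (e d)%:Z + (n - (N - 1 - (N - k%:Z) * d%:Z)).
  have : (\sum_(0 <= t < d) e t + e d = d.-1)%N by rewrite -te /total [RHS]big_nat_recr.
  move: (\sum_(0 <= t < d) e t)%N => s hs.
  have {hs} : s%:Z + (e d)%:Z = d%:Z - 1 by lia.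
  move=> hs; have -> : s%:Z = d%:Z - 1 - (e d)%:Z by rewrite -hs addrK.
  by ring.
rewrite (expfzDr _ _ ud) -exprnP.
have -> : \prod_(1 <= j < d)
     (u (a + j)%N ^ ((e j)%:Z - N) * (if (0 < e j)%N then 1 else pole (a + j) u)) =
   \prod_(1 <= j < d) (if (0 < e j)%N then
      fd j (fun j => u (a + j)%N) * u (a + j)%N ^+ (e j).-1 else 1) *
   \prod_(1 <= j < d) (u (a + j)%N ^ (- N) * pole (a + j) u).
  rewrite -big_split; apply: eq_big_nat => j /andP[j1 jd] /=.
  have ujn := uj j (ltnW jd).
  rewrite expfzDr// -exprnP; case: (posnP (e j)) => ej.
    by rewrite ej expr0 !mul1r.
  have fE : fd j (fun j => u (a + j)%N) = fd (a + j) u.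
    by rewrite /fd addnS; case: j j1 {jd ujn ej} => // j _; rewrite !addnS.
  have fn : fd (a + j) u != 0.
    apply: fd_neq0 Tu; apply: all_admissible; first by rewrite addn_gt0 j1 orbT.
    by rewrite -addnS (leq_ltn_trans _ adM)// leq_add2l.
  rewrite fE -[in LHS](prednK ej) exprS /pole.
  by move: (u _ ^ - N) => x; field.
by ring.
Qed.

(** The factors [gaps] from [Poly] and from the broken chains cancel term by term. The combination
    of the [theta] then sums back to [\prod u_j], which raises each [u_j^(-N)] to [u_j^(1-N)]. *)
Lemma vsc_closed_form (m : nat) a d n : (0 < d)%N -> (a + d < M)%N ->
  ratr (vsc k R ((2 * k)%:Z - m%:Z) n d) = d%:R * ct (chain ((2 * k)%:Z - m%:Z) a d n).
Proof.
elim: m a d n => [|m IH] a d n d0 adM.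
  by rewrite subr0 vsc_ge//; exact: ct_chain_base.
set N := (2 * k)%:Z - m.+1%:Z.
have N1 : N + 1 = (2 * k)%:Z - m%:Z by rewrite /N; lia.
have ltN : N < (2 * k)%:Z by rewrite /N; lia.
rewrite vsc_lt//; have [l [hl lE ->]] := Poly_decomposition R d0.
rewrite phi_sum (raddf_sum (ratr : {additive rat -> C})).
have HL a' d' n' : (0 < d')%N -> (a' + d' < M)%N ->
   ratr (vsc k R (N + 1) n' d') = d'%:R * ct (chain (N + 1) a' d' n').
  by rewrite N1; exact: IH.
have term p : total d p.2 = d.-1 ->
   ratr (d%:R * p.1 / (gaps (fun j => 0 < p.2 j)%N d)%:R *
      phi_monomial k (vsc k R (N + 1)) N n (mnm_of d p.2)) =
   d%:R * (ratr p.1 * ct (broken_chain k N p.2 a d n)) :> C.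
  move=> tp; rewrite phi_monomialE// big_mkcond big_nat_recr//= eqxx orbT.
  have -> : \prod_(1 <= i < d) (if (0 < p.2 i)%N || (i == d) then
     vsc k R (N + 1) (n + shift_index k N p.2 (last_break (fun i0 => 0 < p.2 i0)%N i.-1))
       (i - last_break (fun i0 => 0 < p.2 i0)%N i.-1) else 1) =
     \prod_(1 <= i < d | (0 < p.2 i)%N)
     vsc k R (N + 1) (n + shift_index k N p.2 (last_break (fun i0 => 0 < p.2 i0)%N i.-1))
       (i - last_break (fun i0 => 0 < p.2 i0)%N i.-1).
    rewrite [RHS]big_mkcond; apply: eq_big_nat => i /andP[_ id].
    by rewrite (ltn_eqF id) orbF.
  have rM (x y : rat) : ratr (x * y) = ratr x * ratr y :> C by exact: rmorphM.
  have rV (x : rat) : ratr x^-1 = (ratr x)^-1 :> C by exact: fmorphV.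
  have cb := @ct_broken_chain R k M k_gt0 (vsc k R (N + 1)) N p.2 HL a d n d0 adM.
  rewrite rM [X in _ * X]cb !rM rV !ratr_nat.
  set g := gaps _ _; have g0 : g%:R != 0 :> C by rewrite pnatr_eq0 -lt0n gaps_gt0.
  by move: (ratr p.1) (ct _) => x y; field.
have lB p : lauT (broken_chain k N p.2 a d n).
  exact: lau_degT (deg_broken_chain k_gt0 N p.2 n d0 adM).
transitivity (d%:R * ct (fun u => \sum_(p <- l) ratr p.1 * broken_chain k N p.2 a d n u)).
  rewrite (ct_sum vu r0); last by move=> p _; exact: lauZ.
  rewrite mulr_sumr; elim: l hl {lE} => [|p l IHl] /=; first by rewrite !big_nil.
  move=> /andP[/eqP hp /IHl {}IHl]; rewrite !big_cons IHl; congr (_ + _).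
  by rewrite (ctZ vu r0)// -term.
congr (_ * _); apply: (eq_ct r0) => u Tu.
have uj j : (j <= d)%N -> u (a + j)%N != 0.
  by move=> jd; apply: (all_neq0 Tu); apply: leq_ltn_trans adM; rewrite leq_add2l.
transitivity ((\prod_(1 <= j < d) u (a + j)%N) *
   (u a ^ (- n) * u (a + d)%N ^ (n - (N - 1 - (N - k%:Z) * d%:Z)) *
    \prod_(1 <= j < d) (u (a + j)%N ^ (- N) * pole (a + j) u) *
    \prod_(1 <= j < d.+1) edge k (u (a + j).-1) (u (a + j)%N))).
  rewrite (lE (fun j => u (a + j)%N)) mulr_suml.
  elim: l hl {lE lB} => [|p l IHl] /=; first by rewrite !big_nil.
  move=> /andP[/eqP hp /IHl {}IHl]; rewrite !big_cons IHl; congr (_ + _).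
  by rewrite broken_chain_theta// mulrA.
rewrite /chain.
have -> : \prod_(1 <= j < d) (u (a + j)%N ^ (1 - N) * pole (a + j) u) =
  \prod_(1 <= j < d) u (a + j)%N *
  \prod_(1 <= j < d) (u (a + j)%N ^ (- N) * pole (a + j) u).
  rewrite -big_split; apply: eq_big_nat => j /andP[_ jd] /=.
  by rewrite expfzDr ?expr1z ?mulrA// uj// ltnW.
by ring.
Qed.

End ClosedFormVsc.

(** * Ratios of consecutive variables modulo second differences *)

Section Elimination.
Variable R : realType.
Local Notation C := R[i].
Variables (M a d : nat).
Hypotheses (d_gt0 : (0 < d)%N) (adM : (a + d < M)%N).
Implicit Types (u v : nat -> C) (w : nat -> int) (Q f g : (nat -> C) -> C).

Local Notation vs := (iota 0 M).
Local Notation radius := (radius R).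
Local Notation b0 := (fun _ : nat => 0 : C).
Local Notation torus := (torus vs radius b0).
Local Notation lauT := (lau vs radius b0 xpredT).
Local Notation lau_deg := (lau_deg vs radius b0).
Local Notation ct := (ct vs radius b0).
Local Notation vu := (all_uniq M).
Local Notation r0 := (@all_gt0 R M).

Definition poles u : C := \prod_(1 <= j < d) pole (a + j) u.

Lemma ltn_chain j : (j <= d)%N -> (a + j < M)%N.
Proof. by move=> jd; apply: leq_ltn_trans adM; rewrite leq_add2l. Qed.

Lemma wt_at_ge0 x i : 0 <= wt_at x i.
Proof. by []. Qed.

Lemma deg_poles x : (forall j, (1 <= j < d)%N -> x != (a + j)%N) ->
  lau_deg true (wt_at x) 0 poles.
Proof.
move=> hx; apply: (lau_deg_prod0 r0) => j; rewrite mem_index_iota => hj _.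
have /andP[j1 jd] := hj; have xj : (a + j == x)%N = false by rewrite eq_sym (negbTE (hx j hj)).
apply: deg_pole; rewrite /= ?{1}/wt_at ?xj//.
  by rewrite addn_gt0 j1 orbT.
by rewrite -addnS; exact: ltn_chain.
Qed.

Lemma lauT_poles : lauT poles.
Proof.
apply: (lauT_prod r0) => j; rewrite mem_index_iota => /andP[j1 jd] _.
apply: (lauT_pole vu r0); apply: all_admissible; first by rewrite addn_gt0 j1 orbT.
by rewrite -addnS; exact: ltn_chain.
Qed.

Lemma lauT_var1 j : lauT (fun u => u j).
Proof. by apply: lauT_var; exact: vu. Qed.

Lemma lauT_fd1 j : lauT (fd j).
Proof. by apply: lauT_fd; exact: vu. Qed.

Lemma ct_fd_poles i Q : (1 <= i < d)%N -> lau_deg true (wt_at (a + i)) 0 Q ->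
  ct (fun u => Q u * fd (a + i) u * poles u) = 0.
Proof.
move=> hi lQ; have /andP[i1 id] := hi.
apply: (ct_vanish vu r0 (w := wt_at (a + i))).
apply: (@lau_deg_eq _ _ _ _ _ _ _ (fun u => Q u * (u (a + i)%N *
   \prod_(1 <= j < d | j != i) pole (a + j) u))).
  move=> u Tu; rewrite /poles [in RHS](bigD1_seq i) ?iota_uniq ?mem_index_iota//=.
  have fi : fd (a + i) u != 0.
    apply: fd_neq0 Tu; apply: all_admissible; first by rewrite addn_gt0 i1 orbT.
    by rewrite -addnS; exact: ltn_chain.
  by rewrite /pole; field.
rewrite -[1 : int]add0r; apply: (lau_degM r0) => //.
rewrite -[1 : int]addr0; apply: (lau_degM r0).
  have := @deg_var R M true (wt_at (a + i)) (a + i)%N (ltn_chain (ltnW id)).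
  by rewrite {2}/wt_at eqxx.
apply: (lau_deg_prod0 r0) => j; rewrite mem_index_iota => /andP[j1 jd] ji.
apply: deg_pole; rewrite /= ?{1}/wt_at ?eqn_add2l ?(negbTE ji)//.
  by rewrite addn_gt0 j1 orbT.
by rewrite -addnS; exact: ltn_chain.
Qed.

Definition quot i u : C := u (a + i)%N / u (a + i.+1)%N.
Definition origin i u : C := u a / u (a + i.+1)%N.
Definition mid i u : C := i%:R / i.+1%:R + i.+1%:R^-1 * origin i u.

Lemma deg_inv x w j : (j < M)%N -> lau_deg x w (- w j) (fun u => (u j)^-1).
Proof.
move=> jM; have := @degV R M x w j (-1) jM; rewrite mulrN1 => h.
by apply: (lau_deg_eq _ h) => u _; rewrite exprN1.
Qed.

Lemma deg_quot x i : (i < d)%N -> x != (a + i.+1)%N ->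
  lau_deg true (wt_at x) 0 (quot i).
Proof.
move=> id xi; apply: (@lau_deg_weak _ _ _ _ _ _ (wt_at x (a + i)%N - wt_at x (a + i.+1)%N)).
  by rewrite /= {2}/wt_at eq_sym (negbTE xi) subr0.
by apply: (lau_degM r0); [exact/deg_var/ltn_chain/ltnW|exact/deg_inv/ltn_chain].
Qed.

Lemma deg_origin x i : (i < d)%N -> x != (a + i.+1)%N ->
  lau_deg true (wt_at x) (wt_at x a) (origin i).
Proof.
move=> id xi; apply: (@lau_deg_weak _ _ _ _ _ _ (wt_at x a - wt_at x (a + i.+1)%N)).
  by rewrite /= {3}/wt_at eq_sym (negbTE xi) subr0.
apply: (lau_degM r0); last exact/deg_inv/ltn_chain.
by apply: deg_var; have := ltn_chain (leq0n d); rewrite addn0.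
Qed.

Lemma deg_origin0 x i : (i < d)%N -> x != (a + i.+1)%N ->
  lau_deg true (wt_at x) 0 (origin i).
Proof. by move=> id xi; apply: lau_deg_weak (deg_origin id xi); exact: wt_at_ge0. Qed.

Lemma deg_mid x i : (i < d)%N -> x != (a + i.+1)%N ->
  lau_deg true (wt_at x) 0 (mid i).
Proof.
move=> id xi; apply: lau_degD; first exact: lau_deg_cst.
by apply: lau_degZ; exact: deg_origin0.
Qed.

Lemma deg_horner w (G : {poly C}) f : lau_deg true w 0 f ->
  lau_deg true w 0 (fun u => G.[f u]).
Proof.
move=> lf; apply: (@lau_deg_eq _ _ _ _ _ _ _ (fun u => \sum_(l < size G) G`_l * f u ^+ l)).
  by move=> u _; rewrite horner_coef.
apply: lau_deg_sum => l _; apply: lau_degZ.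
by have := lau_degX r0 l lf; rewrite mul0rn.
Qed.

Lemma lauT_horner (G : {poly C}) f : lauT f -> lauT (fun u => G.[f u]).
Proof.
have l0 g : lauT g -> lau_deg true (fun=> 0) 0 g.
  by apply: lau_sub => m _; rewrite /= /wdeg big1// => j _; rewrite mul0r.
by move=> /l0 lf; exact: lau_degT (deg_horner G lf).
Qed.

(* Modulo the second differences, [u_(a+i)] interpolates linearly between [u_a]
   and [u_(a+i+1)]. *)
Lemma ct_interpolate i Q (G : {poly C}) : (i < d)%N -> lauT Q ->
  (forall s, (1 <= s <= i)%N -> lau_deg true (wt_at (a + s)) 0 Q) ->
  ct (fun u => Q u * G.[quot i u] * poles u) =
  ct (fun u => Q u * G.[mid i u] * poles u).
Proof.
move=> id lQ hQ; have lP := lauT_poles.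
have aM : (a < M)%N by have := ltn_chain (leq0n d); rewrite addn0.
have lq : lauT (quot i).
  apply: (lauTM r0); first exact: lauT_var1.
  by apply: lauT_inv; [exact: vu|rewrite mem_all ltn_chain].
have lm : lauT (mid i).
  apply: lauD; first exact: lau_cst.
  apply: lauZ; apply: (lauTM r0); first exact: lauT_var1.
  by apply: lauT_inv; [exact: vu|rewrite mem_all ltn_chain].
(* [h] is the divided difference of [G] between [quot] and [mid], written as a polynomial in both so
   that its weight is controlled. *)
pose h u := \sum_(l < size G) G`_l *
   (\sum_(j < l) quot i u ^+ (l.-1 - j) * mid i u ^+ j).
have hh s : (1 <= s <= i)%N -> lau_deg true (wt_at (a + s)) 0 h.
  move=> /andP[s1 si]; have ne : (a + s)%N != (a + i.+1)%N.
    by rewrite eqn_add2l ltn_eqF.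
  apply: lau_deg_sum => l _; apply: lau_degZ; apply: lau_deg_sum => j _.
  rewrite -[0 : int]addr0; apply: (lau_degM r0).
    by have := lau_degX r0 (l.-1 - j) (deg_quot id ne); rewrite mul0rn.
  by have := lau_degX r0 j (deg_mid id ne); rewrite mul0rn.
(* By [sum_fd], [quot - mid] is a combination of the [fd (a + s)] over [u_(a+i+1)]; each summand
   falls to [ct_fd_poles]. *)
pose S s u := (s%:R / i.+1%:R) * (Q u * h u * (u (a + i.+1)%N)^-1 * fd (a + s) u * poles u).
have hS s : (1 <= s <= i)%N -> ct (S s) = 0.
  move=> hs; have /andP[s1 si] := hs.
  have lS : lau_deg true (wt_at (a + s)) 0 (fun u => Q u * h u * (u (a + i.+1)%N)^-1).
    rewrite -[0 : int]addr0; apply: (lau_degM r0).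
      by rewrite -[0 : int]addr0; apply: (lau_degM r0); [exact: hQ|exact: hh].
    have := @deg_inv true (wt_at (a + s)) _ (ltn_chain id).
    by rewrite {2}/wt_at eqn_add2l gtn_eqF// oppr0.
  rewrite (ctZ vu r0).
    by rewrite ct_fd_poles ?mulr0// s1 (leq_ltn_trans si).
  by apply: (lauTM r0) => //; apply: (lauTM r0); [exact: lau_degT lS|exact: lauT_fd1].
have lT s : (1 <= s <= i)%N -> lauT (S s).
  move=> hs; apply: lauZ; apply: (lauTM r0) => //; apply: (lauTM r0); last exact: lauT_fd1.
  apply: (lauTM r0); last by apply: lauT_inv; [exact: vu|rewrite mem_all ltn_chain].
  by apply: (lauTM r0) => //; exact: lau_degT (hh s hs).
have key u : torus u -> Q u * G.[quot i u] * poles u =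
   Q u * G.[mid i u] * poles u + \sum_(1 <= s < i.+1) S s u.
  move=> Tu; have un : u (a + i.+1)%N != 0 := all_neq0 Tu (ltn_chain id).
  have i0 : i.+1%:R != 0 :> C by rewrite pnatr_eq0.
  have dq : quot i u - mid i u = (\sum_(1 <= s < i.+1) s%:R * fd (a + s) u) /
      (i.+1%:R * u (a + i.+1)%N).
    rewrite sum_fd /mid /origin /quot addnS; rewrite addnS in un.
    by field; rewrite un nat1r i0.
  have dG : G.[quot i u] - G.[mid i u] = (quot i u - mid i u) * h u.
    rewrite !horner_coef -sumrB /h mulr_sumr; apply: eq_bigr => l _.
    by rewrite -mulrBr subrXX mulrCA.
  have -> : \sum_(1 <= s < i.+1) S s u =
     Q u * h u * poles u * ((\sum_(1 <= s < i.+1) s%:R * fd (a + s) u) /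
      (i.+1%:R * u (a + i.+1)%N)).
    rewrite mulr_suml mulr_sumr; apply: eq_bigr => s _; rewrite /S.
    by field; rewrite un nat1r i0.
  by rewrite -dq -(subrK (G.[mid i u]) G.[quot i u]) dG; ring.
rewrite (eq_ct r0 key).
have lsum : lauT (fun u => \sum_(1 <= s < i.+1) S s u).
  have : lau_deg true (fun=> 0) 0 (fun u => \sum_(s <- index_iota 1 i.+1 | (1 <= s <= i)%N) S s u).
    apply: lau_deg_sum => s hs; apply: lau_sub (lT s hs) => m _.
    by rewrite /= /wdeg big1// => j _; rewrite mul0r.
  move=> /lau_degT; apply: eq_lau => u _.
  by rewrite [RHS]big_nat_cond; apply: eq_bigl => s; rewrite ltnS andbT.
rewrite (ctD vu r0)//; last first.
  by apply: (lauTM r0) => //; apply: (lauTM r0) => //; exact: lauT_horner.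
rewrite [X in _ + X](_ : _ = 0) ?addr0//.
rewrite (@eq_ct _ _ _ _ r0 _ (fun u => \sum_(s <- index_iota 1 i.+1 | (1 <= s <= i)%N) S s u)).
  by rewrite (ct_sum vu r0)// big1.
by move=> u _; rewrite [LHS]big_nat_cond; apply: eq_bigl => s; rewrite ltnS andbT.
Qed.

End Elimination.

(** * Expansion at the points [i/(i+1)] *)

Section Expansion.
Variable R : realType.
Local Notation C := R[i].
Variables (M a d : nat).
Hypotheses (d_gt0 : (0 < d)%N) (adM : (a + d < M)%N).
Implicit Types (u v : nat -> C) (w : nat -> int) (Q f g : (nat -> C) -> C).

Local Notation vs := (iota 0 M).
Local Notation radius := (radius R).
Local Notation b0 := (fun _ : nat => 0 : C).
Local Notation torus := (torus vs radius b0).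
Local Notation lauT := (lau vs radius b0 xpredT).
Local Notation lau_deg := (lau_deg vs radius b0).
Local Notation ct := (ct vs radius b0).
Local Notation vu := (all_uniq M).
Local Notation r0 := (@all_gt0 R M).
Local Notation poles := (@poles R a d).
Local Notation mid := (@mid R a).
Local Notation origin := (@origin R a).

Lemma start_lt : (a < M)%N.
Proof. by have := ltn_chain adM (leq0n d); rewrite addn0. Qed.

Lemma start_neq j : (0 < j)%N -> a != (a + j)%N.
Proof. by move=> j0; rewrite -[X in X == _]addn0 eqn_add2l ltn_eqF. Qed.

Lemma lauT_origin i : (i < d)%N -> lauT (origin i).
Proof.
move=> id; apply: (lauTM r0); first exact: lauT_var1.
by apply: lauT_inv; [exact: vu|rewrite mem_all (ltn_chain adM)].
Qed.

Lemma lauT_mid i : (i < d)%N -> lauT (mid i).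
Proof. by move=> id; apply: lauD; [exact: lau_cst|apply: lauZ; exact: lauT_origin]. Qed.

(** Two divisions by ['X - t] give a Taylor formula whose remainder is again polynomial, hence again
    of controlled weight. *)
Lemma horner_expand (G : {poly C}) (t : C) :
  exists G2 : {poly C}, forall h, G.[t + h] = G.[t] + h * G^`().[t] + h ^+ 2 * G2.[t + h].
Proof.
have /factor_theorem[G1 hG1] : root (G - G.[t]%:P) t.
  by rewrite /root !hornerE subrr.
have /factor_theorem[G2 hG2] : root (G1 - G1.[t]%:P) t.
  by rewrite /root !hornerE subrr.
have E1 x : G.[x] = G.[t] + (x - t) * G1.[x].
  have := congr1 (horner^~ x) hG1; rewrite /= !(hornerE, hornerD, hornerN, hornerC) => h.
  by rewrite mulrC -h addrC subrK.
have E2 x : G1.[x] = G1.[t] + (x - t) * G2.[x].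
  have := congr1 (horner^~ x) hG2; rewrite /= !(hornerE, hornerD, hornerN, hornerC) => h.
  by rewrite mulrC -h addrC subrK.
have dG : G^`().[t] = G1.[t].
  have -> : G = G.[t]%:P + G1 * ('X - t%:P) by rewrite -hG1 addrC subrK.
  by rewrite derivD derivC add0r derivM derivXsubC mulr1 hornerD hornerM hornerXsubC subrr mulr0 add0r.
exists G2 => h; rewrite E1 addrAC subrr add0r E2 addrAC subrr add0r dG; ring.
Qed.

(** [mid] differs from [i/(i+1)] by a multiple of [u_a], and no other factor has a negative power of
    [u_a]. *)
Lemma ct_horner_mid0 i Q (G : {poly C}) : (i < d)%N -> lauT Q ->
  lau_deg true (wt_at a) 0 Q ->
  ct (fun u => Q u * G.[mid i u] * poles u) =
  G.[i%:R / i.+1%:R] * ct (fun u => Q u * poles u).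
Proof.
move=> id lQ hQ; have lP := (lauT_poles adM); have lm := lauT_mid id.
rewrite -(ctZ vu r0); last exact: (lauTM r0).
apply: (@ct_mod _ _ _ _ vu r0 (wt_at a)).
- by apply: (lauTM r0) => //; apply: (lauTM r0) => //; exact: lauT_horner.
- by apply: lauZ; exact: (lauTM r0).
have [G2 hG2] := horner_expand G (i%:R / i.+1%:R).
set t := i%:R / i.+1%:R in hG2 *; set c : C := i.+1%:R^-1.
apply: (@lau_deg_eq _ _ _ _ _ _ _ (fun u => Q u *
   (c * (origin i u * (G^`().[t] + c * (origin i u * G2.[mid i u])))) * poles u)).
  by move=> u Tu; rewrite /mid -/t -/c hG2; ring.
have ne := @start_neq i.+1 isT.
have lo : lau_deg true (wt_at a) 1 (origin i).
  by have := @deg_origin R _ _ _ adM _ _ id ne; rewrite {2}/wt_at eqxx.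
have lo0 : lau_deg true (wt_at a) 0 (origin i) by apply: (deg_origin0 adM id ne).
have lP0 : lau_deg true (wt_at a) 0 poles.
  by apply: deg_poles => // j /andP[j1 _]; exact: start_neq.
rewrite -[1 : int]addr0; apply: (lau_degM r0) => //.
rewrite -[1 : int]add0r; apply: (lau_degM r0) => //.
apply: lau_degZ; rewrite -[1 : int]addr0; apply: (lau_degM r0) => //.
apply: lau_degD; first exact: lau_deg_cst.
apply: lau_degZ; have := lau_degM r0 lo0 (deg_horner G2 (deg_mid adM id ne)).
by rewrite addr0.
Qed.

(** Here [Q] may contain [1 / u_a] once, so the first-order term survives and only the second-order
    remainder has positive weight. *)
Lemma ct_horner_mid1 i Q (G : {poly C}) : (i < d)%N -> lauT Q ->
  lau_deg true (wt_at a) (-1) Q ->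
  ct (fun u => Q u * G.[mid i u] * poles u) =
  G.[i%:R / i.+1%:R] * ct (fun u => Q u * poles u) +
  i.+1%:R^-1 * G^`().[i%:R / i.+1%:R] * ct (fun u => Q u * origin i u * poles u).
Proof.
move=> id lQ hQ; have lP := (lauT_poles adM); have lm := lauT_mid id.
have lo := lauT_origin id.
rewrite -(ctZ vu r0); last exact: (lauTM r0).
rewrite -[in RHS](ctZ vu r0); last by apply: (lauTM r0) => //; exact: (lauTM r0).
rewrite -(ctD vu r0); last 2 first.
- by apply: lauZ; exact: (lauTM r0).
- by apply: lauZ; apply: (lauTM r0) => //; exact: (lauTM r0).
apply: (@ct_mod _ _ _ _ vu r0 (wt_at a)).
- by apply: (lauTM r0) => //; apply: (lauTM r0) => //; exact: lauT_horner.
- apply: lauD; first by apply: lauZ; exact: (lauTM r0).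
  by apply: lauZ; apply: (lauTM r0) => //; exact: (lauTM r0).
have [G2 hG2] := horner_expand G (i%:R / i.+1%:R).
set t := i%:R / i.+1%:R in hG2 *; set c : C := i.+1%:R^-1.
apply: (@lau_deg_eq _ _ _ _ _ _ _ (fun u => Q u *
   (c ^+ 2 * (origin i u * (origin i u * G2.[mid i u]))) * poles u)).
  by move=> u Tu; rewrite /mid -/t -/c hG2; ring.
have ne := @start_neq i.+1 isT.
have lo1 : lau_deg true (wt_at a) 1 (origin i).
  by have := @deg_origin R _ _ _ adM _ _ id ne; rewrite {2}/wt_at eqxx.
have lP0 : lau_deg true (wt_at a) 0 poles.
  by apply: deg_poles => // j /andP[j1 _]; exact: start_neq.
rewrite -[1 : int]addr0; apply: (lau_degM r0) => //.
apply: (@lau_deg_weak _ _ _ _ _ _ (-1 + (1 + (1 + 0)))) => //; apply: (lau_degM r0) => //.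
apply: lau_degZ; apply: (lau_degM r0) => //; apply: (lau_degM r0) => //.
exact: (deg_horner G2 (deg_mid adM id ne)).
Qed.

(** Declaring every index up to [a] a breakpoint leaves one block of length [d], all the others
    having length 1. *)
Lemma ct_poles_all : d%:R * ct poles = 1.
Proof.
have ad0 : (0 < a + d)%N by rewrite addn_gt0 d_gt0 orbT.
have := @ct_poles _ _ _ b0 vu r0 (fun j => j <= a)%N (a + d) ad0.
have lb m : last_break (fun j => j <= a)%N m = minn m a.
  elim: m => [|m IH] /=; first by rewrite min0n.
  by rewrite IH; case: (boolP (m < a)%N) => h; lia.
have gE : gaps (fun j => j <= a)%N (a + d) = d.
  rewrite /gaps lb big_nat_cond big1.
    by rewrite mul1n (minn_idPr _) ?addKn// -ltnS prednK// -addn1 leq_add2l.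
  by move=> [|s] /andP[_ sa]//=; rewrite lb (minn_idPl _) ?subSnn// ltnW.
rewrite gE => h; rewrite -[RHS]h; last first.
  move=> j /andP[j1 jd]; rewrite -ltnNge => aj; apply: all_admissible => //.
  exact: leq_ltn_trans jd adM.
rewrite mulrC; congr (_ * _); apply: (eq_ct r0) => u _.
rewrite /poles [RHS](@big_cat_nat _ _ _ a.+1)//=; last by rewrite -addn1 leq_add2l.
rewrite [X in _ = X * _]big_nat_cond [X in _ = X * _]big1 ?mul1r; last first.
  by move=> j /andP[/andP[_ ja]]; rewrite -ltnS ja.
rewrite -[a.+1]add1n big_addn addKn [RHS]big_mkcond; apply: eq_big_nat => j /andP[j1 _].
by rewrite addnC -ltnNge -[X in (X < _)%N]add0n ltn_add2r j1.
Qed.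

End Expansion.

(** * Recurrences along the chain for [N = k] *)

Section Recurrence.
Variable R : realType.
Local Notation C := R[i].
Variables (k M a d : nat).
Hypotheses (k_gt0 : (0 < k)%N) (d_gt0 : (0 < d)%N) (adM : (a + d < M)%N).
Implicit Types (u v : nat -> C) (w : nat -> int) (Q f g : (nat -> C) -> C).

Local Notation vs := (iota 0 M).
Local Notation radius := (radius R).
Local Notation b0 := (fun _ : nat => 0 : C).
Local Notation torus := (torus vs radius b0).
Local Notation lauT := (lau vs radius b0 xpredT).
Local Notation lau_deg := (lau_deg vs radius b0).
Local Notation ct := (ct vs radius b0).
Local Notation vu := (all_uniq M).
Local Notation r0 := (@all_gt0 R M).
Local Notation poles := (@poles R a d).
Local Notation mid := (@mid R a).
Local Notation quot := (@quot R a).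
Local Notation origin := (@origin R a).

Definition edge_cpoly : {poly C} :=
  k%:R *: \prod_(1 <= m < k) (m%:R *: 'X + (k - m)%:R%:P).

Lemma horner_edge_cpoly t : edge_cpoly.[t] = k%:R * \prod_(1 <= m < k) (m%:R * t + (k - m)%:R).
Proof.
rewrite hornerZ horner_prod; congr (_ * _); apply: eq_bigr => m _.
by rewrite hornerD hornerZ hornerX hornerC.
Qed.

Lemma edgeE (x y : C) : y != 0 -> y ^ (1 - k%:Z) * edge k x y = edge_cpoly.[x / y].
Proof.
move=> y0; rewrite horner_edge_cpoly /edge mulrCA; congr (_ * _).
have -> : y ^ (1 - k%:Z) = \prod_(1 <= m < k) y^-1.
  rewrite prodr_const_nat exprVn exprnN; congr (_ ^ _); lia.
by rewrite -big_split; apply: eq_bigr => m _ /=; field.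
Qed.

Definition tail i u : C := \prod_(i <= j < d) edge_cpoly.[quot j u].

Lemma tailS i u : (i < d)%N -> tail i u = edge_cpoly.[quot i u] * tail i.+1 u.
Proof. by move=> id; rewrite /tail big_ltn. Qed.

(** At [N = k] each variable after [u_a] carries the power [1 - k] that turns its edge into a
    polynomial in the ratio. *)
Lemma chainE (n : nat) u : torus u ->
  chain k k%:Z a d n%:Z u = u a ^- n * u (a + d)%N ^+ n * tail 0 u * poles u.
Proof.
move=> Tu; have uj j : (j <= d)%N -> u (a + j)%N != 0.
  by move=> jd; apply: (all_neq0 Tu); exact: (ltn_chain adM jd).
have -> : tail 0 u = \prod_(1 <= j < d.+1)
    (u (a + j)%N ^ (1 - k%:Z) * edge k (u (a + j).-1) (u (a + j)%N)).
  rewrite /tail [RHS]big_add1; apply: eq_big_nat => j /andP[_ jd].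
  by rewrite edgeE ?uj// /quot addnS.
rewrite /chain big_split /= subrr mul0r subr0 [in RHS]big_split /= !(big_nat_recr d)//=.
have -> : n%:Z - (k%:Z - 1) = n%:Z + (1 - k%:Z) by lia.
rewrite expfzDr ?uj// -exprnP -/(poles u) exprnN.
by rewrite /poles; ring.
Qed.

Lemma deg_tail x i : (forall j, (i < j <= d)%N -> x != (a + j)%N) ->
  lau_deg true (wt_at x) 0 (tail i).
Proof.
move=> hx; apply: (lau_deg_prod0 r0) => j; rewrite mem_index_iota => /andP[ij jd] _.
by apply: deg_horner; apply: (deg_quot adM jd); apply: hx; rewrite ltnS ij.
Qed.

Lemma lauT_tail i : lauT (tail i).
Proof.
apply: (lauT_prod r0) => j; rewrite mem_index_iota => /andP[_ jd] _.
apply: lauT_horner; apply: (lauTM r0); first exact: lauT_var1.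
by apply: lauT_inv; [exact: vu|rewrite mem_all (ltn_chain adM)].
Qed.

Local Notation ratio i := (i%:R / i.+1%:R : C).
Local Notation lauT_poles := (lauT_poles adM).

Definition ct_tail i := ct (fun u => tail i u * poles u).
(** The factor [1 / u_a] lowers the weight in [u_a] to -1, which is what lets first-order terms
    survive. *)
Definition ct_src i := ct (fun u => (u a)^-1 * u (a + i)%N * tail i u * poles u).
(** Kept apart from [ct_src], since the numerator [u_(a+1)] is already one step ahead of
    [tail 0]. *)
Definition ct_src1 := ct (fun u => (u a)^-1 * u a.+1 * tail 0 u * poles u).

Lemma ct_tail_rec i : (i < d)%N -> ct_tail i = edge_cpoly.[ratio i] * ct_tail i.+1.
Proof.
move=> id; have lt := @lauT_tail i.+1.
rewrite -ct_horner_mid0//; last first.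
  by apply: deg_tail => j /andP[ij _]; apply: start_neq; exact: leq_ltn_trans ij.
rewrite -ct_interpolate//; last first.
  move=> s /andP[s1 si]; apply: deg_tail => j /andP[ij _].
  by rewrite eqn_add2l ltn_eqF// (leq_ltn_trans si)// ltnW.
by apply: (eq_ct r0) => u _; rewrite tailS//; ring.
Qed.

Lemma lauT_src i : (i <= d)%N -> lauT (fun u => (u a)^-1 * u (a + i)%N).
Proof.
move=> id; apply: (lauTM r0); last exact: lauT_var1.
by apply: lauT_inv; [exact: vu|rewrite mem_all (start_lt adM)].
Qed.

Lemma deg_src s i : (i <= d)%N -> (0 < s)%N ->
  lau_deg true (wt_at (a + s)) (s == i)%:Z (fun u => (u a)^-1 * u (a + i)%N).
Proof.
move=> id s0; have -> : (s == i)%:Z = - wt_at (a + s)%N a + wt_at (a + s)%N (a + i)%N :> int.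
  rewrite /wt_at (negbTE (start_neq a s0)). by rewrite oppr0 add0r eqn_add2l eq_sym.
by apply: (lau_degM r0); [apply: deg_inv; exact: (start_lt adM)|exact: (deg_var _ _ (ltn_chain adM id))].
Qed.

(** The first-order term carries [origin i], which cancels the source factor [u_(a+i+1) / u_a] and
    so leaves a [ct_tail]. *)
Lemma ct_src_horner i (G : {poly C}) : (i < d)%N ->
  ct (fun u => (u a)^-1 * u (a + i.+1)%N * G.[quot i u] * tail i.+1 u * poles u) =
  G.[ratio i] * ct_src i.+1 + i.+1%:R^-1 * G^`().[ratio i] * ct_tail i.+1.
Proof.
move=> id; have lt := @lauT_tail i.+1.
pose Q u := (u a)^-1 * u (a + i.+1)%N * tail i.+1 u.
have lQ : lauT Q by apply: (lauTM r0) => //; exact: lauT_src.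
rewrite (@eq_ct _ _ _ _ r0 _ (fun u => Q u * G.[quot i u] * poles u)); last first.
  by move=> u _; rewrite /Q; ring.
rewrite ct_interpolate//; last first.
  move=> s /andP[s1 si]; rewrite -[0 : int]addr0; apply: (lau_degM r0).
    by have := deg_src id s1; rewrite ltn_eqF.
  apply: deg_tail => j /andP[ij _].
  by rewrite eqn_add2l ltn_eqF// (leq_ltn_trans si)// ltnW.
rewrite ct_horner_mid1//; last first.
  rewrite -[-1 : int]addr0; apply: (lau_degM r0).
    apply: (@lau_deg_eq _ _ _ _ _ _ _ (fun u => (u a)^-1 * u (a + i.+1)%N)) => //.
    rewrite -[-1 : int]addr0; apply: (lau_degM r0).
      have := @deg_inv R M true (wt_at a) a (start_lt adM).
      by rewrite {2}/wt_at eqxx.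
    have := @deg_var R M true (wt_at a) _ (ltn_chain adM id).
    by rewrite {2}/wt_at eq_sym (negbTE (start_neq a (ltn0Sn i))).
  by apply: deg_tail => j /andP[ij _]; apply: start_neq; exact: leq_ltn_trans ij.
congr (_ + _ * _); apply: (eq_ct r0) => u Tu.
have u0 := all_neq0 Tu (start_lt adM); have u1 := all_neq0 Tu (ltn_chain adM id).
by rewrite /Q /origin; field; rewrite u0 u1.
Qed.

(** Since [u_(a+i)] is [quot i] times [u_(a+i+1)], the polynomial to expand is ['X * edge_cpoly]. *)
Lemma ct_src_rec i : (i < d)%N -> ct_src i = ratio i * edge_cpoly.[ratio i] * ct_src i.+1 +
  i.+1%:R^-1 * (edge_cpoly.[ratio i] + ratio i * edge_cpoly^`().[ratio i]) * ct_tail i.+1.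
Proof.
move=> id; have := @ct_src_horner i ('X * edge_cpoly) id.
rewrite derivM derivX mul1r hornerD !hornerM !hornerX => <-.
apply: (eq_ct r0) => u Tu; have u1 := all_neq0 Tu (ltn_chain adM id).
by rewrite hornerM hornerX tailS// /quot; field; rewrite u1 (all_neq0 Tu (start_lt adM)).
Qed.

Lemma ct_src1_rec : ct_src1 = edge_cpoly.[0] * ct_src 1 + edge_cpoly^`().[0] * ct_tail 1.
Proof.
have := @ct_src_horner 0 edge_cpoly d_gt0; rewrite mul0r invr1 mul1r => <-.
by apply: (eq_ct r0) => u Tu; rewrite tailS// addn1; ring.
Qed.

Lemma ct_tail_last : ct_tail d = d%:R^-1.
Proof.
apply: (@mulfI _ d%:R); first by rewrite pnatr_eq0 -lt0n.
rewrite mulfV ?pnatr_eq0 -?lt0n// -[RHS](ct_poles_all R d_gt0 adM); congr (_ * _).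
by apply: (eq_ct r0) => u _; rewrite /tail big_geq// mul1r.
Qed.

(** [u_(a+d)] carries no pole, so nothing compensates its positive power. *)
Lemma ct_src_last : ct_src d = 0.
Proof.
apply: (ct_vanish vu r0 (w := wt_at (a + d))).
rewrite -[1 : int]addr0; apply: (lau_degM r0); last first.
  by apply: deg_poles => // j /andP[_ jd]; rewrite eqn_add2l gtn_eqF.
rewrite -[1 : int]addr0; apply: (lau_degM r0).
  by have := deg_src (leqnn d) d_gt0; rewrite eqxx.
by apply: deg_tail => j /andP[dj /(leq_trans dj)]; rewrite ltnn.
Qed.

End Recurrence.

(** * Solving the recurrences *)

Section Solution.
Variable R : realType.
Local Notation C := R[i].
Variables (k : nat).
Hypotheses (k_gt0 : (0 < k)%N).

Local Notation edge_cpoly := (@edge_cpoly R k).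
Local Notation ratio i := (i%:R / i.+1%:R : C).

Definition eps i : C := edge_cpoly.[ratio i].
Definition eps_prod i : C := \prod_(0 <= j < i) eps j.
Definition rho i : C := \sum_(1 <= m < k) m%:R / (i%:R * (k%:R * i%:R - m%:R)).

Lemma factor_neq0 m i : (m < k)%N -> k%:R * i.+1%:R - m%:R != 0 :> C.
Proof.
move=> mk; rewrite -natrM -natrB ?pnatr_eq0 -?lt0n ?subn_gt0//.
  by rewrite (leq_trans mk)// leq_pmulr.
by rewrite (leq_trans (ltnW mk))// leq_pmulr.
Qed.

Lemma ratio_factor m i : (m < k)%N ->
  m%:R * ratio i + (k - m)%:R = (k%:R * i.+1%:R - m%:R) / i.+1%:R :> C.
Proof.
move=> mk; have i0 : i.+1%:R != 0 :> C by rewrite pnatr_eq0.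
rewrite natrB ?(ltnW mk)//; move: i0; rewrite -natr1 => i0; by field.
Qed.

Lemma epsE i : eps i * i.+1%:R ^+ k = \prod_(0 <= m < k) (k%:R * i.+1%:R - m%:R).
Proof.
have i0 : i.+1%:R != 0 :> C by rewrite pnatr_eq0.
have -> : i.+1%:R ^+ k = i.+1%:R * \prod_(1 <= m < k) i.+1%:R :> C.
  by rewrite prodr_const_nat subn1 -exprS prednK.
rewrite /eps horner_edge_cpoly [RHS]big_ltn// mulr0n subr0 mulrACA; congr (_ * _).
rewrite -big_split; apply: eq_big_nat => m /andP[_ mk] /=.
by rewrite ratio_factor// divfK.
Qed.

(** By [epsE], passing from [d] to [d + 1] multiplies by the [k] top factors of [(k (d + 1))!] over
    [(d + 1)^k]. *)
Lemma eps_prodE d : eps_prod d = (k * d)`!%:R / d`!%:R ^+ k.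
Proof.
elim: d => [|d IH]; first by rewrite /eps_prod big_geq// muln0 fact0 expr1n divr1.
have d0 : d.+1%:R != 0 :> C by rewrite pnatr_eq0.
have f0 : d`!%:R != 0 :> C by rewrite pnatr_eq0 -lt0n fact_gt0.
rewrite /eps_prod big_nat_recr//= -/(eps_prod d) IH.
have -> : eps d = \prod_(0 <= m < k) (k%:R * d.+1%:R - m%:R) / d.+1%:R ^+ k.
  by rewrite -epsE mulfK// expf_neq0.
have -> : (k * d.+1)`!%:R = (k * d)`!%:R * \prod_(0 <= m < k) (k%:R * d.+1%:R - m%:R) :> C.
  have le : (k <= k * d.+1)%N by rewrite leq_pmulr.
  rewrite -(ffact_fact le) {2}mulnS addKn natrM mulrC; congr (_ * _).
  rewrite ffact_prod natr_prod big_mkord; apply: eq_bigr => m _.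
  by rewrite natrB ?natrM// (leq_trans _ le)// ltnW.
rewrite factS natrM exprMn.
move: (expf_neq0 k d0) (expf_neq0 k f0); move: (_ ^+ k) (_ ^+ k) => s t s0 t0.
by field; rewrite s0 t0.
Qed.

(** This is the logarithmic derivative: each linear factor contributes [m (i+1) / (k (i+1) - m)],
    and extracting [(i+1)^2] leaves a term of [rho]. *)
Lemma deriv_edge_cpoly i : edge_cpoly^`().[ratio i] = eps i * (i.+1%:R ^+ 2 * rho i.+1).
Proof.
have i0 : i.+1%:R != 0 :> C by rewrite pnatr_eq0.
have gen (s : seq nat) : {in s, forall m, (m < k)%N} ->
  (\prod_(m <- s) (m%:R *: 'X + (k - m)%:R%:P))^`().[ratio i] =
  (\prod_(m <- s) (m%:R * ratio i + (k - m)%:R)) *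
  \sum_(m <- s) m%:R / ((k%:R * i.+1%:R - m%:R) / i.+1%:R) :> C.
  elim: s => [|m s IH] hs; first by rewrite !big_nil derivC horner0 mulr0.
  have mk : (m < k)%N by apply: hs; rewrite mem_head.
  have hs' : {in s, forall m, (m < k)%N} by move=> j js; apply: hs; rewrite inE js orbT.
  rewrite !big_cons derivM hornerD !hornerM IH// derivD derivZ derivX derivC addr0.
  rewrite alg_polyC horner_prod !(hornerD, hornerZ, hornerX, hornerC).
  have -> : \prod_(j <- s) (j%:R *: 'X + (k - j)%:R%:P).[ratio i] =
     \prod_(j <- s) (j%:R * ratio i + (k - j)%:R).
    by apply: eq_bigr => j _; rewrite !(hornerD, hornerZ, hornerX, hornerC).
  rewrite ratio_factor//; have := factor_neq0 i mk.
  move: (k%:R * _ - _) i0 => x; rewrite -natr1 => i0 x0; field.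
  by rewrite i0 x0.
rewrite /edge_cpoly derivZ hornerZ gen; last by move=> m; rewrite mem_index_iota => /andP[].
rewrite /eps horner_edge_cpoly -mulrA; congr (_ * (_ * _)).
rewrite /rho mulr_sumr; apply: eq_big_nat => m /andP[_ mk].
have := factor_neq0 i mk; move: (k%:R * _ - _) i0 => x; rewrite -natr1 => i0 x0; field.
by rewrite i0 x0.
Qed.

Variables (M a d : nat).
Hypotheses (d_gt0 : (0 < d)%N) (adM : (a + d < M)%N).
Local Notation ct_tail := (@ct_tail R k M a d).
Local Notation ct_src := (@ct_src R k M a d).
Local Notation ct_src1 := (@ct_src1 R k M a d).

Lemma ct_tail0 : ct_tail 0 = eps_prod d / d%:R.
Proof.
rewrite -(ct_tail_last R k d_gt0 adM); suff h i : (i <= d)%N -> ct_tail 0 = eps_prod i * ct_tail i by apply: h.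
elim: i => [|i IH] id; first by rewrite /eps_prod big_geq// mul1r.
by rewrite IH 1?ltnW// ct_tail_rec// /eps_prod big_nat_recr//= mulrA.
Qed.

Lemma ct_src1_eq : d%:R * ct_src1 - d.-1%:R * ct_tail 0 = eps_prod d * \sum_(1 <= i < d.+1) rho i.
Proof.
have dn0 : d%:R != 0 :> C by rewrite pnatr_eq0 -lt0n.
have dp : d.-1%:R = d%:R - 1 :> C by rewrite -subn1 natrB.
(* The ratios [j/(j+1)] telescope to the [1/(i+1)] in front of [ct_src]. At [i + 1 = d] the source
   term is 0 and [1 - d/(i+1)] vanishes, which leaves the sum of the [rho]. *)
suff h i : (i < d)%N -> d%:R * ct_src1 - d.-1%:R * ct_tail 0 =
    d%:R * eps_prod i.+1 / i.+1%:R * ct_src i.+1 +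
    eps_prod i.+1 * (1 + d%:R * \sum_(1 <= j < i.+2) rho j - d%:R / i.+1%:R) * ct_tail i.+1.
  have := h d.-1; rewrite prednK// => -> //.
  by rewrite ct_src_last// ct_tail_last// mulr0 add0r; field.
elim: i => [|i IH] id.
  rewrite ct_src1_rec// (@ct_tail_rec R k M a d adM 0)// dp /eps_prod !big_nat1 /eps mul0r.
  have := deriv_edge_cpoly 0; rewrite /eps mul0r => ->.
  by rewrite expr1n; field.
have i1 : i.+1%:R != 0 :> C by rewrite pnatr_eq0.
have i2 : i.+2%:R != 0 :> C by rewrite pnatr_eq0.
rewrite IH 1?ltnW// (@ct_src_rec R k M a d adM i.+1)// (@ct_tail_rec R k M a d adM i.+1)// deriv_edge_cpoly -/(eps i.+1).
rewrite [in RHS]big_nat_recr//= [eps_prod i.+2]big_nat_recr//= -/(eps_prod i.+1).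
move: (eps_prod _) (eps _) (\sum_(_ <= _ < _) _) (rho _) (ct_src _) (ct_tail _) => e ep s r x y.
move: i1 i2; rewrite -[i.+2%:R]natr1; move: (i.+1%:R : C) => t t0 t1.
by field; rewrite t0 t1.
Qed.

End Solution.

(** * The convolution identity for [n = 1] *)

Section Convolution.
Variable R : realType.
Local Notation C := R[i].
Variables (k M : nat).
Hypotheses (k_gt0 : (0 < k)%N).
Implicit Types (u v : nat -> C).

Local Notation vs := (iota 0 M).
Local Notation radius := (radius R).
Local Notation b0 := (fun _ : nat => 0 : C).
Local Notation torus := (torus vs radius b0).
Local Notation lauT := (lau vs radius b0 xpredT).
Local Notation ct := (ct vs radius b0).
Local Notation vu := (all_uniq M).
Local Notation r0 := (@all_gt0 R M).
Local Notation chain_k a d n := (@chain R k k%:Z a d n%:Z).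
Local Notation eps_prod := (@eps_prod R k).

Lemma vsc_chain a (n : nat) d : (0 < d)%N -> (a + d < M)%N ->
  ratr (vsc k R k%:Z n%:Z d) = d%:R * ct (chain_k a d n).
Proof.
move=> d0 adM; have := @vsc_closed_form R k M k_gt0 k a d n%:Z d0 adM.
by have -> : (2 * k)%:Z - k%:Z = k%:Z by lia.
Qed.

Lemma ct_chain0 a d : (0 < d)%N -> (a + d < M)%N -> ct (chain_k a d 0%N) = eps_prod d / d%:R.
Proof.
move=> d0 adM; rewrite -(@ct_tail0 R k M a d d0 adM); apply: (eq_ct r0) => u Tu.
by rewrite (chainE k_gt0 d0 adM)// !expr0 invr1 !mul1r.
Qed.

(** The weight [n - s] is the normalising factor of a chain of length [n - s], the right half of a
    chain cut at [s]. *)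
Lemma sum_weighted_fd n u : (0 < n)%N -> \sum_(1 <= s < n) (n - s)%:R * fd s u =
  n%:R * u 1%N - n.-1%:R * u 0%N - u n.
Proof.
have tel m : \sum_(1 <= s < m.+1) fd s u = u 1%N - u 0%N + u m - u m.+1.
  elim: m => [|m IH]; first by rewrite big_geq//; ring.
  by rewrite big_nat_recr//= IH /fd /=; ring.
case: n => // n _; elim: n => [|n IH]; first by rewrite big_geq//=; ring.
rewrite (eq_big_nat _ _ (F2 := fun s => (n.+1 - s)%:R * fd s u + fd s u)).
  rewrite big_split /= tel big_nat_recr//= subnn mul0r addr0 IH /= -!natr1; ring.
by move=> s /andP[_ sn]; rewrite subSn// -natr1 mulrDl mul1r.
Qed.

Variable D : nat.
Hypotheses (D0 : (0 < D)%N) (DM : (0 + D < M)%N).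

Local Notation tail0 d := (@tail R k 0 d 0).
Local Notation poles0 d := (@poles R 0 d).

(** Two chains meeting at [u_s] have all the poles of the long chain except the one at [s], hence a
    factor [fd s / u_s]; the first power of [u_s] ending the left chain cancels this denominator. *)
Lemma chain_join s u : (1 <= s < D)%N -> torus u ->
  chain_k 0%N s 1%N u * chain_k s (D - s)%N 0%N u =
  (u 0%N)^-1 * tail0 D u * poles0 D u * fd s u.
Proof.
move=> /andP[s0 sD] Tu; have sM : (0 + s < M)%N by rewrite (ltn_trans sD).
have sDM : (s + (D - s) < M)%N by rewrite subnKC// ltnW.
have Ds : (0 < D - s)%N by rewrite subn_gt0.
rewrite (chainE k_gt0 s0 sM)// (chainE k_gt0 Ds sDM)// !expr0 !expr1 invr1 !mul1r.
have fn : fd s u != 0.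
  by apply: fd_neq0 Tu; apply: all_admissible => //; exact: leq_ltn_trans DM.
have -> : poles0 D u = poles0 s u * pole s u * poles s (D - s) u.
  rewrite /poles [LHS](@big_cat_nat _ _ _ s)//=; last exact: ltnW.
  rewrite [X in _ * X]big_ltn// add0n mulrA; congr (_ * _).
  rewrite -[s.+1]add1n big_addn; apply: eq_big_nat => j _.
  by rewrite add0n addnC.
have -> : tail0 D u = tail0 s u * tail k s (D - s) 0 u.
  rewrite /tail [LHS](@big_cat_nat _ _ _ s)//=; last exact: ltnW.
  rewrite -[in X in _ * X = _](add0n s) big_addn; congr (_ * _).
  by apply: eq_big_nat => j _; rewrite /quot !add0n addnC addnS.
rewrite /pole add0n; move: fn; move: (_^-1) (poles0 _ _) (tail0 _ _) => x p t fn.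
by field.
Qed.

Lemma ct_chain_join s : (1 <= s < D)%N ->
  ct (chain_k 0%N s 1%N) * eps_prod (D - s) =
  (D - s)%:R * ct (fun u => (u 0%N)^-1 * tail0 D u * poles0 D u * fd s u).
Proof.
move=> hs; have /andP[s0 sD] := hs; have sM : (0 + s < M)%N by rewrite (ltn_trans sD).
have sDM : (s + (D - s) < M)%N by rewrite subnKC// ltnW.
have Ds : (0 < D - s)%N by rewrite subn_gt0.
have Dn : (D - s)%:R != 0 :> C by rewrite pnatr_eq0 -lt0n.
apply: (mulIf (invr_neq0 Dn)); rewrite [RHS]mulrAC mulfV// mul1r -mulrA -(ct_chain0 Ds sDM).
rewrite -(@ct_split _ _ _ _ vu r0 (fun=> 1) s)//.
- by apply: (eq_ct r0) => u Tu; rewrite chain_join.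
- by rewrite mem_all.
- have := @deg_chain R k M false (fun=> 1) 1 k%:Z 0 s 1 s0 sM.
  rewrite /= => h; apply: lau_deg_weak (h _ _) => //.
  rewrite subrr mul0r subr0 sumr_const_nat subn1 !mul1r.
  rewrite -[_ *+ s]mulr_natr -[_ *+ k.-1]mulr_natr -[(1 - k%:Z) *+ _]mulr_natr !natz.
  have hs1 : s%:Z = s.-1%:Z + 1 by lia.
  have hk : k%:Z = k.-1%:Z + 1 by have := k_gt0; lia.
  by rewrite hs1 hk; apply/eqP; ring.
- by apply: lauT_chain.
- move=> u v Tu Tv uv; apply: eq_chain => j js.
  by apply: uv; rewrite inE mem_filter negb_and -leqNgt js.
- move=> u v Tu Tv uv; apply: eq_chain => j js.
  by apply: uv; rewrite inE mem_filter negb_and -leqNgt leq_addr.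
Qed.

Lemma convolution :
  \sum_(1 <= s < D) ct (chain_k 0%N s 1%N) * eps_prod (D - s) + ct (chain_k 0%N D 1%N) =
  eps_prod D * \sum_(1 <= i < D.+1) rho R k i.
Proof.
have lt : lauT (tail0 D) by apply: lauT_tail.
have lp : lauT (poles0 D) by exact: lauT_poles DM.
have li : lauT (fun u => (u 0%N)^-1).
  by apply: lauT_inv; [exact: vu|rewrite mem_all (leq_ltn_trans _ DM)].
have lB : lauT (fun u => (u 0%N)^-1 * tail0 D u * poles0 D u).
  by apply: (lauTM r0) => //; exact: (lauTM r0).
have lv j : lauT (fun u => u j) by apply: lauT_var; exact: vu.
pose B u := (u 0%N)^-1 * tail0 D u * poles0 D u.
have lBu j : lauT (fun u => B u * u j) by exact: (lauTM r0).
have lBv c j : lauT (fun u => c * (B u * u j)) by exact: lauZ.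
have -> : \sum_(1 <= s < D) ct (chain_k 0%N s 1%N) * eps_prod (D - s) =
    ct (fun u => B u * \sum_(1 <= s < D) (D - s)%:R * fd s u).
  rewrite (@eq_ct _ _ _ _ r0 _
    (fun u => \sum_(s <- index_iota 1 D) (D - s)%:R * (B u * fd s u))); last first.
    by move=> u _; rewrite mulr_sumr; apply: eq_bigr => s _; rewrite mulrCA.
  rewrite (ct_sum vu r0); last first.
    by move=> s _; apply: lauZ; apply: (lauTM r0) => //; exact: lauT_fd1.
  apply: eq_big_nat => s hs; rewrite (ct_chain_join hs) -(ctZ vu r0)//.
  by apply: (lauTM r0) => //; exact: lauT_fd1.
(* The terms in [u_1] and [u_0] become [ct_src1] and [ct_tail 0]; the term in [u_D] cancels the
   chain of full length [D]. *)
rewrite (@eq_ct _ _ _ _ r0 _ (fun u => (D%:R * (B u * u 1%N) + - D.-1%:R * (B u * u 0%N)) +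
   - 1 * (B u * u D))); last first.
  by move=> u _; rewrite sum_weighted_fd//; ring.
rewrite (ctD vu r0)//; last by apply: lauD.
rewrite (ctD vu r0)// !(ctZ vu r0)//.
rewrite -(@ct_src1_eq R k M 0 D D0 DM).
have -> : ct (fun u => B u * u 1%N) = ct_src1 R k M 0 D.
  by apply: (eq_ct r0) => u _; rewrite /B; ring.
have -> : ct (fun u => B u * u 0%N) = ct_tail R k M 0 D 0.
  by apply: (eq_ct r0) => u Tu; rewrite /B; field; apply: (all_neq0 Tu); exact: leq_ltn_trans DM.
have -> : ct (chain_k 0%N D 1%N) = ct (fun u => B u * u D).
  by apply: (eq_ct r0) => u Tu; rewrite (chainE k_gt0 D0 DM)// /B !expr1 add0n; ring.
ring.
Qed.

End Convolution.

(** * Ring laws for formal power series *)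

Section FormalSeries.
Variable R : realType.
Implicit Types (a b f : fps R).

Local Notation trunc n a := (\poly_(i < n.+1) a i).

(** Low coefficients of a product of series are those of truncated polynomials, from which the ring
    laws are transferred. *)
Lemma coef_trunc_mul n m a b : (m <= n)%N ->
  (trunc n a * trunc n b)`_m = fps_mul a b m.
Proof.
move=> mn; rewrite coefM; apply: eq_bigr => -[i /= im] _.
by rewrite !coef_poly !ltnS (leq_trans _ mn)// (leq_trans (leq_subr _ _) mn).
Qed.

Lemma fps_mulC a b : fps_mul a b = fps_mul b a.
Proof. by apply/funext => n; rewrite -!(@coef_trunc_mul n)// mulrC. Qed.

Lemma fps_mulA a b f : fps_mul a (fps_mul b f) = fps_mul (fps_mul a b) f.
Proof.
apply/funext => n; have Ec a' : {in [pred i | (i <= n)%N], forall i, (trunc n a')`_i = a' i}.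
  by move=> i; rewrite inE coef_poly ltnS => ->.
transitivity ((trunc n a * (trunc n b * trunc n f))`_n).
  rewrite coefM; apply: eq_bigr => -[i /= im] _.
  by rewrite Ec ?inE// coef_trunc_mul// leq_subr.
rewrite mulrA coefM; apply: eq_bigr => -[i /= im] _.
by rewrite Ec ?inE ?leq_subr// coef_trunc_mul.
Qed.

Lemma fps_mul1 a : fps_mul a (@fps1 R) = a.
Proof.
apply/funext => n; rewrite /fps_mul big_ord_recr /= subnn mulr1 big1 ?add0r//.
by move=> -[i /= im] _; rewrite /fps1 subn_eq0 leqNgt im mulr0.
Qed.

Lemma fps_divP a b f : b 0%N != 0 -> fps_mul a b = f -> fps_div f b = a.
Proof. by move=> b0 <-; rewrite /fps_div -fps_mulA [fps_mul b _]fps_mulC fps_mulV// fps_mul1. Qed.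

End FormalSeries.

(** * The hypergeometric series and the two identities *)

Section Hypergeometric.
Variables (R : realType) (k : nat).

Lemma w_0 : w R k 0 = hypergeometric R k.
Proof.
apply/funext => d; rewrite /w derive1n0 /hypergeometric !big1 ?mulr1// => i _.
  by rewrite mulr0 addr0 expr1n invr1.
by rewrite mulr0 addr0.
Qed.

Lemma is_derive_prod_lin (c : nat -> R) (s : seq nat) :
  is_derive (0 : R) (1 : R) (fun z : R => \prod_(i <- s) (1 + c i * z)) (\sum_(i <- s) c i).
Proof.
elim: s => [|i s IH].
  rewrite big_nil (_ : (fun z => _) = cst (1 : R)); first exact: is_derive_cst.
  by apply/funext => z; rewrite big_nil.
rewrite (_ : (fun z => _) = (fun z => 1 + c i * z) * (fun z => \prod_(i <- s) (1 + c i * z))); last first.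
  by apply/funext => z; rewrite big_cons.
apply: is_derive_eq.
have -> : \prod_(j <- s) (1 + c j * 0) = 1 by rewrite big1// => j _; rewrite mulr0 addr0.
rewrite mulr0 addr0 !scale1r add0r mul1r big_cons addrC; congr (_ + _).
exact: mulr1.
Qed.

(** Passing from [d] to [d + 1] adds the indices [kd + 1, ..., kd + k]. The last one gives [1/(d+1)]
    and cancels one of the [k] subtracted copies; the others pair with the remaining copies after
    the reversal of [m] into [k - m]. *)
Lemma sum_harmonic d : (0 < k)%N ->
  \sum_(1 <= i < (k * d).+1) k%:R / i%:R - k%:R * \sum_(1 <= i < d.+1) i%:R^-1 =
  \sum_(1 <= i < d.+1) \sum_(1 <= m < k) m%:R / (i%:R * (k%:R * i%:R - m%:R)) :> R.
Proof.
move=> k0; elim: d => [|d IH]; first by rewrite muln0 !big_geq// mulr0 subr0.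
rewrite [in RHS]big_nat_recr//= -IH [in X in _ - X]big_nat_recr//= mulrDr opprD.
rewrite (@big_cat_nat _ _ _ (k * d).+1)//=; last by rewrite ltnS leq_pmul2l.
rewrite addrACA; congr (_ + _); rewrite -[(k * d).+1]add1n big_addn.
have -> : ((k * d.+1).+1 - k * d = k.-1.+2)%N by rewrite mulnS; lia.
rewrite big_nat_recr//= prednK// [X in _ + X = _](_ : _ = - \sum_(1 <= m < k) d.+1%:R^-1 - d.+1%:R^-1); last first.
  rewrite -opprD sumr_const_nat; congr (- _).
  by rewrite -[X in _ + X]mulr1n -mulrnDr subn1 addn1 prednK// mulr_natl.
have d0 : d.+1%:R != 0 :> R by rewrite pnatr_eq0.
have k0' : k%:R != 0 :> R by rewrite pnatr_eq0 -lt0n.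
have -> : k%:R / (k + k * d)%:R = d.+1%:R^-1 :> R.
  by rewrite -mulnS natrM invfM mulrA mulfV// mul1r.
rewrite addrACA subrr addr0 -sumrB [RHS]big_nat_rev /=; apply: eq_big_nat => m /andP[m1 mk].
have -> : (1 + k - m.+1 = k - m)%N by lia.
have h0 : (m + k * d)%:R != 0 :> R by rewrite pnatr_eq0 -lt0n addn_gt0 m1.
have -> : k%:R * d.+1%:R - (k - m)%:R = (m + k * d)%:R :> R.
  by rewrite natrB ?(ltnW mk)// natrD natrM -natr1; ring.
rewrite natrB ?(ltnW mk)//.
have -> : k%:R / (m + k * d)%:R - d.+1%:R^-1 =
   (k%:R * d.+1%:R - (m + k * d)%:R) / (d.+1%:R * (m + k * d)%:R) :> R.
  move: h0 d0; move: ((m + k * d)%:R : R) (d.+1%:R : R) => x y x0 y0.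
  by field; rewrite x0 y0.
by congr (_ / _); rewrite natrD natrM -natr1; ring.
Qed.

(** Both products equal 1 at [z = 0], so the derivative reduces to the difference of harmonic sums
    computed in [sum_harmonic]. *)
Lemma w_1 : (0 < k)%N -> w R k 1 = hypergeometric_log R k.
Proof.
move=> k0; apply/funext => d; rewrite /w derive1n1 derive1E.
pose A (z : R) := \prod_(1 <= i < (k * d).+1) (1 + k%:R / i%:R * z).
pose B (z : R) := \prod_(1 <= i < d.+1) (1 + 1 / i%:R * z).
have dA : is_derive (0 : R) (1 : R) A (\sum_(1 <= i < (k * d).+1) k%:R / i%:R).
  exact: is_derive_prod_lin.
have dB : is_derive (0 : R) (1 : R) B (\sum_(1 <= i < d.+1) 1 / i%:R).
  exact: is_derive_prod_lin.
have A0 : A 0 = 1 by rewrite /A big1// => i _; rewrite mulr0 addr0.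
have B0 : B 0 = 1 by rewrite /B big1// => i _; rewrite mulr0 addr0.
set c := (k * d)`!%:R / _.
rewrite (_ : (fun z => _) = c \*: (A * (fun z => (B z ^+ k)^-1))); last first.
  apply/funext => z; rewrite /= -mulrA; congr (_ * (_ * _)).
  by rewrite -exprVn -prodfV -prodrXl; apply: eq_bigr => i _; rewrite exprVn.
have Bk0 : B 0 ^+ k != 0 by rewrite B0 expr1n oner_neq0.
have dBk : is_derive (0 : R) (1 : R) (fun z => B z ^+ k) (k%:R * \sum_(1 <= i < d.+1) 1 / i%:R).
  have := @is_deriveX R _ B k 0 1 _ dB.
  by rewrite exprfctE B0 expr1n mulr1.
have dV := @is_deriveV R (fun z => B z ^+ k) 0 _ 1 Bk0 dBk.
have [_ ->] := is_deriveZ c (is_deriveM dA dV).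
have -> : hypergeometric_log R k d =
    c * \sum_(1 <= i < d.+1) \sum_(1 <= m < k) m%:R / (i%:R * (k%:R * i%:R - m%:R)).
  by rewrite /c; case: (d) => [|//]; rewrite big_geq// mulr0.
rewrite -sum_harmonic// A0 B0 expr1n expr1n invr1 !scale1r; congr (c * _).
rewrite addrC scaleN1r; congr (_ - _ * _); apply: eq_bigr => i _; exact: mul1r.
Qed.

Hypothesis k_gt0 : (0 < k)%N.

Lemma L_series_0 : L_series R k 0 = hypergeometric R k.
Proof.
apply/funext => -[|d]; rewrite /L_series /hypergeometric.
  by rewrite muln0 fact0 expr1n divr1.
(* Variables [u_0, ..., u_(d+1)] are exactly what a chain of length [d + 1] occupies. *)
have dM : (0 + d.+1 < d.+2)%N by [].
have h := @vsc_chain R k d.+2 k_gt0 0 0 d.+1 isT dM.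
apply: (@complexI R); rewrite /= fmorph_rat h ct_chain0// eps_prodE//.
by rewrite rmorphM fmorphV rmorphXn !rmorph_nat mulrC divfK//.
Qed.

(** Dividing by [d] integrates in [x]. At [d = 0] the convention that division by zero gives 0
    removes the constant coefficient 1, which [L_series_1] recovers from the term [x]. *)
Lemma L1_convolution :
  fps_mul (fun d => L_series R k 1 d / d%:R) (hypergeometric R k) = hypergeometric_log R k.
Proof.
apply/funext => -[|d]; first by rewrite /fps_mul big_ord1 /= invr0 mulr0 mul0r.
pose T s : R := L_series R k 1 s / s%:R.
have hT s : (0 < s <= d.+1)%N ->
    (T s)%:C%C = ct (iota 0 d.+2) (radius R) (fun=> 0) (chain k k%:Z 0 s 1%N%:Z).
  move=> /andP[s0 sd]; have sM : (0 + s < d.+2)%N by rewrite ltnS.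
  rewrite /T /L_series; case: s s0 sd sM => // s _ _ sM.
  have h := @vsc_chain R k d.+2 k_gt0 0 1 s.+1 isT sM.
  by rewrite rmorphM fmorphV fmorph_rat rmorph_nat [ratr _]h mulrC mulKf.
have hE s : (hypergeometric R k s)%:C%C = eps_prod R k s.
  by rewrite eps_prodE// rmorphM fmorphV rmorphXn !rmorph_nat.
have dM : (0 + d.+1 < d.+2)%N by [].
have := @convolution R k d.+2 k_gt0 d.+1 isT dM.
rewrite -hE -hT ?ltnSn// => h; apply: (@complexI R).
rewrite /fps_mul -(big_mkord xpredT (fun i => T i * hypergeometric R k (d.+1 - i)%N)).
rewrite big_ltn// {1}/T invr0 mulr0 mul0r add0r big_nat_recr//= subnn.
rewrite rmorphD rmorph_sum.
have -> : hypergeometric R k 0 = 1 by rewrite /hypergeometric muln0 fact0 expr1n divr1.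
rewrite mulr1; transitivity ((hypergeometric R k d.+1)%:C%C *
    \sum_(1 <= i < d.+2) rho R k i).
  rewrite -h; congr (_ + _); apply: eq_big_nat => s /andP[s0 sd].
  by rewrite [LHS]rmorphM; congr (_ * _); [apply: hT; rewrite s0 ltnW|exact: hE].
rewrite [RHS]rmorphM; congr (_ * _); rewrite rmorph_sum; apply: eq_bigr => i _.
rewrite rmorph_sum; apply: eq_bigr => m _.
by rewrite rmorphM fmorphV rmorphM rmorphB rmorphM !rmorph_nat.
Qed.

Lemma L_series_1 :
  L_series R k 1 = dx (LogSeries 1 (fps_div (hypergeometric_log R k) (hypergeometric R k))).
Proof.
rewrite (fps_divP _ L1_convolution); last first.
  by rewrite /hypergeometric muln0 fact0 expr1n divr1 oner_neq0.
apply/funext => -[|d]; rewrite /dx /=; first by rewrite mulr1n mul0r addr0.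
by rewrite mulr0n add0r mulrC divfK// pnatr_eq0.
Qed.

End Hypergeometric.

Theorem theorem2 (R : realType) (k : nat) (hk : (2 <= k)%N) :
  (L_series R k 0 = w R k 0
   /\ w R k 0 = hypergeometric R k)
  /\ (L_series R k 1
      = dx (LogSeries 1 (fps_div (w R k 1) (w R k 0)))
   /\ dx (LogSeries 1 (fps_div (w R k 1) (w R k 0)))
      = dx (LogSeries 1
              (fps_div (hypergeometric_log R k) (hypergeometric R k)))).
Proof.
have k_gt0 : (0 < k)%N by exact: ltnW.
by rewrite w_1// w_0 L_series_0// L_series_1.
Qed.
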